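(* Let $[B]\sqsubseteq[A]$, that is, $\operatorname{Row}(A)\subseteq\operatorname{Row}(B)$, with $A=TB$ for a real matrix $T$. Let $f\in\mathbb{C}^A$ and $g=\Phi(f)\in\mathbb{C}^B$. Suppose that $E_\beta(g)$ meets $H_T$, so that $E_\beta(g)\cap H_T\subset E$ (viewed in $\mathbb{R}^{1+n}$ via $\iota^{-1}$) for some connected component $E$ of $\mathbb{R}^{1+n}\setminus\mathcal{A}(f)$. Then $\operatorname{ord}_f(E)=T\beta$.
   Context: $A\subset\mathbb{R}^{1+n}$ is a finite set of cardinality $N$; its elements $\alpha(1),\dots,\alpha(N)$ are arranged as the columns of a $(1+n)\times N$ matrix, also denoted $A$. It is assumed that $A$ is pseudo-homogeneous: there is a linear form $\xi$ with $\langle\xi,\alpha\rangle=1$ for all $\alpha\in A$, i.e. $\mathbf{1}=(1,\dots,1)$ lies in the real row span $\operatorname{Row}(A)$. $\mathbb{C}^A$ is the space of exponential sums $f(\mathbf{z})=\sum_{j=1}^N c_j e^{\langle\mathbf{z},\alpha(j)\rangle}$, $c_j\in\mathbb{C}$, in $\mathbf{z}\in\mathbb{C}^{1+n}$. The amoeba of $f$ is $\mathcal{A}(f)=\overline{\operatorname{Re}(V(f))}\subset\mathbb{R}^{1+n}$, where $V(f)\subset\mathbb{C}^{1+n}$ is the zero set of $f$; the same definitions are used for other supports. $B$ is a real $(1+m)\times N$ matrix with columns $\beta(1),\dots,\beta(N)$, also pseudo-homogeneous, and $A=TB$ with $T$ a real $(1+n)\times(1+m)$ matrix. The isomorphism $\Phi\colon\mathbb{C}^A\to\mathbb{C}^B$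 sends $\sum_j c_j e^{\langle\mathbf{z},\alpha(j)\rangle}$ to $\sum_j c_j e^{\langle\mathbf{y},\beta(j)\rangle}$ ($\mathbf{y}\in\mathbb{C}^{1+m}$). The map $\iota\colon\mathbb{R}^{1+n}\to\mathbb{R}^{1+m}$ is $\mathbf{x}\mapsto\mathbf{x}T$ (row vectors), with image $H_T$; subsets of $H_T$ are regarded as subsets of $\mathbb{R}^{1+n}$ by taking inverse images under $\iota$. Orders: let $\mathbb{Z}[A]$ be the abelian group generated by $A$, let $\mathcal{N}=\operatorname{Conv}(A)$, and let $S=\operatorname{Hom}_{\mathbb{Z}}(\mathbb{Z}[A],\mathbb{S}^1)$ with (normalized) Haar measure $\eta$. For $\chi\in S$ put $f_\chi(\mathbf{x})=\sum_{\alpha\in A}c_\alpha\chi(\alpha)e^{\langle\mathbf{x},\alpha\rangle}$. The Ronkin function is $N_f(\mathbf{x})=\int_S\log|f_\chi(\mathbf{x})|\,d\eta(\chi)$, $\mathbf{x}\in\mathbb{R}^{1+n}$. It is known that its gradient is constant on each connected component $E$ of $\mathbb{R}^{1+n}\setminus\mathcal{A}(f)$; its value there, the order $\operatorname{ord}_f(E)$, lies in $\mathbb{Z}[A]\cap\mathcal{N}$, and distinct components have distinct orders. $E_\alpha(f)$ denotes the component of order $\alpha$ (empty if there is none); $E_\beta(g)$ is defined in the same way for $g$, with $\beta\in\mathbb{Z}[B]\cap\operatorname{Conv}(B)$. *)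

(* Defs.v *)
From HB Require Import structures.
From mathcomp Require Import all_boot all_order all_algebra.
From mathcomp Require Import complex.
From mathcomp Require Import all_classical all_reals all_analysis.

Set Implicit Arguments.
Unset Strict Implicit.
Unset Printing Implicit Defensive.

Import Order.TTheory GRing.Theory Num.Theory.
Import numFieldNormedType.Exports.

Local Open Scope classical_set_scope.
Local Open Scope complex_scope.
Local Open Scope ring_scope.

(* Exponents are column vectors and points are row vectors. *)
Definition pairing (K : pzRingType) (d : nat) (x : 'rV[K]_d) (a : 'cV[K]_d) : K :=
  (x *m a) 0 0.

(* A support of cardinality N is the d x N matrix of its N distinct columns. *)
Definition distinct_columns (R : realType) (d N : nat) (A : 'M[R]_(d, N)) : Prop :=
  injective (fun j : 'I_N => col j A).

Definition pseudo_homogeneous (R : realType) (d N : nat) (A : 'M[R]_(d, N)) : Prop :=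
  ((const_mx 1 : 'rV[R]_N) <= A)%MS.

Definition cexp (R : realType) (z : R[i]) : R[i] :=
  (expR (complex.Re z) * cos (complex.Im z))
    +i* (expR (complex.Re z) * sin (complex.Im z)).

(* The exponential sum with support A and coefficients c.  For a support with
   distinct columns, c is determined by the function [expsum A c], and the
   isomorphism Phi from C^A to C^B maps [expsum A c] to [expsum B c]. *)
Definition expsum (R : realType) (d N : nat) (A : 'M[R]_(d, N)) (c : 'I_N -> R[i])
    (z : 'rV[R[i]]_d) : R[i] :=
  \sum_(j < N) c j * cexp (pairing z (map_mx (fun r : R => r%:C) (col j A))).

Definition zero_set (R : realType) (d : nat) (f : 'rV[R[i]]_d -> R[i]) :
    set 'rV[R[i]]_d :=
  [set z | f z = 0].

Definition amoeba (R : realType) (d : nat) (f : 'rV[R[i]]_d -> R[i]) : set 'rV[R]_d :=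
  closure (map_mx (@complex.Re R) @` zero_set f).

Definition is_component (T : topologicalType) (U E : set T) : Prop :=
  exists2 x, U x & E = connected_component U x.

Definition conv_hull (R : realType) (d N : nat) (A : 'M[R]_(d, N)) : set 'cV[R]_d :=
  [set x | exists t : 'I_N -> R,
     [/\ forall j, 0 <= t j, \sum_(j < N) t j = 1
       & x = \sum_(j < N) t j *: col j A]].

Definition zspan (R : realType) (d N : nat) (A : 'M[R]_(d, N)) : {pred 'cV[R]_d} :=
  fun x => `[< exists k : 'I_N -> int, x = \sum_(j < N) col j A *~ k j >].

Section ZspanGroup.
Variables (R : realType) (d N : nat) (A : 'M[R]_(d, N)).

Fact zspan_zmod_closed : zmod_closed (zspan A).
Proof.
split=> [|x y /asboolP[k ->] /asboolP[l ->]]; apply/asboolP.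
  by exists (fun=> 0); rewrite big1// => j _; rewrite mulr0z.
exists (fun j => k j - l j); rewrite -sumrB.
by apply: eq_bigr => j _; rewrite mulrzBr.
Qed.

HB.instance Definition _ := GRing.isZmodClosed.Build _ (zspan A) zspan_zmod_closed.

Record zspan_group := ZspanGroup {
  zspan_val : 'cV[R]_d;
  zspan_valP : zspan_val \in zspan A }.

HB.instance Definition _ := [isSub for zspan_val].
HB.instance Definition _ := [Choice of zspan_group by <:].
HB.instance Definition _ := [SubChoice_isSubZmodule of zspan_group by <:].

Fact zspan_col (j : 'I_N) : col j A \in zspan A.
Proof.
apply/asboolP; exists (fun i => (i == j)%:Z).
rewrite (bigD1 j)//= eqxx mulr1z big1 ?addr0// => i /negPf ->.
by rewrite mulr0z.
Qed.

Definition zspan_gen (j : 'I_N) : zspan_group := ZspanGroup (zspan_col j).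

End ZspanGroup.

Section Characters.
Variables (R : realType) (V : zmodType).

Record character := Character {
  char_fun :> V -> R[i];
  char_norm : forall v, `|char_fun v| = 1;
  charD : forall v w, char_fun (v + w) = char_fun v * char_fun w }.

Definition char_one : character.
Proof. by exists (fun=> 1) => *; rewrite ?normr1 ?mulr1. Defined.

Definition char_mul (chi psi : character) : character.
Proof.
exists (fun v => chi v * psi v) => [v|v w].
- by rewrite normrM !char_norm mulr1.
- by rewrite !charD mulrACA.
Defined.

HB.instance Definition _ := gen_eqMixin character.
HB.instance Definition _ := gen_choiceMixin character.
HB.instance Definition _ := isPointed.Build character char_one.

(* The sigma-algebra generated by the evaluations; for a countable V it is the
   Borel sigma-algebra of the compact group Hom(V, S^1). *)
Definition char_cylinders : set (set character) :=
  [set U | exists v : V, exists2 D : set R, measurable D &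
     U = [set chi : character | D (complex.Re (chi v))]
     \/ U = [set chi : character | D (complex.Im (chi v))]].

Definition dual_group := g_sigma_algebraType char_cylinders.

Definition is_haar (eta : probability dual_group R) : Prop :=
  forall (psi : character) (U : set dual_group), measurable U ->
    eta [set chi : character | U (char_mul psi chi)] = eta U.

End Characters.

Definition gradient (R : realType) (n : nat) (h : 'rV[R]_n.+1 -> R) (x : 'rV[R]_n.+1) :
    'cV[R]_n.+1 :=
  \col_i 'D_(delta_mx 0 i) h x.

Section Orders.
Variables (R : realType) (n N : nat) (A : 'M[R]_(n.+1, N)) (c : 'I_N -> R[i]).

Definition twist (chi : character R (zspan_group A)) (x : 'rV[R]_n.+1) : R[i] :=
  \sum_(j < N) c j * chi (zspan_gen A j) * (expR (pairing x (col j A)))%:C.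

Variable eta : probability (dual_group R (zspan_group A)) R.

Definition ronkin (x : 'rV[R]_n.+1) : R :=
  fine (\int[eta]_chi lne (Normc.normc (twist chi x))%:E).

Definition has_order (E : set 'rV[R]_n.+1) (alpha : 'cV[R]_n.+1) : Prop :=
  forall x, E x -> differentiable ronkin x /\ gradient ronkin x = alpha.

(* The component of order alpha, or the empty set if there is none. *)
Definition order_component (alpha : 'cV[R]_n.+1) : set 'rV[R]_n.+1 :=
  \bigcup_(E in [set E | is_component (~` amoeba (expsum A c)) E /\ has_order E alpha]) E.

End Orders.

(* Main.v *)
(* A point x lies off the amoeba of f exactly when |f_chi(x)| >= k > 0 uniformly in
   the character chi: Kronecker's theorem makes the characters v |-> exp(i <y, v>)
   dense, and a zero of a limit f_chi persists nearby by Hurwitz's theorem applied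
   along a line separating the exponents.  On such a uniform bound the Ronkin function
   is computed with log max(k, |.|); the four-point estimate
   log|h(d)| + log|h(-d)| + log|h(id)| + log|h(-id)| - 4 log|h(0)| = O(|d|^3), where
   only >= survives after truncation, and the invariance of the Haar average under
   imaginary translations turn (pluri)harmonicity into affinity and
   subharmonicity into convexity without any integration in the plane.
   For u = xT off the amoeba of g, averaging log|g_chi| over the translates of chi by
   the characters pulled back from Z[A] to Z[B] gives a function of chi whose increment
   from x to x + v does not depend on chi; by Fubini, N_g(xT) and N_f(x) have the same
   local increments, so the slope of N_f at x is T beta.  Finally two points of the
   complement of the amoeba of f with the same slope lie in one component, since N_f is
   convex on the segment between them, hence affine there. *)
Require Import Defs.
From HB Require Import structures.
From mathcomp Require Import all_boot all_order all_algebra.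
From mathcomp Require Import complex.
From mathcomp Require Import all_classical all_reals all_analysis.
From mathcomp Require Import measurable_realfun.
From mathcomp Require Import ring lra.

Set Implicit Arguments.
Unset Strict Implicit.
Unset Printing Implicit Defensive.

Import Order.TTheory GRing.Theory Num.Theory.
Import numFieldNormedType.Exports.

Local Open Scope classical_set_scope.
Local Open Scope complex_scope.
Local Open Scope ring_scope.

(** The values N_g(xT) and N_f(x) differ in general. T maps Z[B] onto Z[A]; when this map has a
    kernel, the characters pulled back from Z[A] form a proper subgroup of the dual of Z[B], and N_f
    sees a single coset of it. A mean over one coset may depend on the coset, so only increments can
    be compared. The obstacle is that passing to another coset is a displacement in imaginary
    directions along which the mean over the dual of Z[A] is not invariant; harmonicity in a complex
    plane, with invariance in one real direction, is still enough for increments. Truncation makes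
    all integrands bounded, so integrability and Fubini need no study of logarithmic singularities,
    and it is invisible where the sums are bounded below. The four points d, -d, id, -id are chosen
    because the terms of order one and two cancel in their sum. An error of order three suffices:
    cutting the unit square into 4^k squares of side 2^-k makes any error o(h^2) per square vanish
    in the limit. *)

Local Notation nc := Normc.normc.

(** * Moduli and complex exponentials *)

Section ComplexModulus.
Variable R : realType.
Implicit Types (z w : R[i]) (x y : R).

Lemma normE z : `|z| = (nc z)%:C. Proof. by []. Qed.

Lemma nc_norm z x : `|z| = x%:C -> nc z = x.
Proof. by rewrite normE => -[]. Qed.

Lemma nc_ge0 z : 0 <= nc z.
Proof. by case: z => a b; exact: sqrtr_ge0. Qed.

Lemma nc0 : nc (0 : R[i]) = 0.
Proof. exact: Normc.normc0. Qed.

Lemma nc1 : nc (1 : R[i]) = 1.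
Proof. exact: Normc.normc1. Qed.

Lemma ncM z w : nc (z * w) = nc z * nc w.
Proof. exact: Normc.normcM. Qed.

Lemma ncV z : nc z^-1 = (nc z)^-1.
Proof. exact: Normc.normcV. Qed.

Lemma ncN z : nc (- z) = nc z.
Proof. by apply: nc_norm; rewrite normrN. Qed.

Lemma ncD z w : nc (z + w) <= nc z + nc w.
Proof. by have := ler_normD z w; rewrite !normE -rmorphD lecR. Qed.

Lemma ncB z w : nc (z - w) <= nc z + nc w.
Proof. by rewrite -(ncN w); exact: ncD. Qed.

Lemma nc_distC z w : nc (z - w) = nc (w - z).
Proof. by rewrite -ncN opprB. Qed.

Lemma ncX z n : nc (z ^+ n) = nc z ^+ n.
Proof.
by elim: n => [|n IH]; rewrite ?expr0 ?nc1// !exprS ncM IH.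
Qed.

Lemma nc_eq0 z : (nc z == 0) = (z == 0).
Proof.
by apply/eqP/eqP => [/Normc.eq0_normc //|->]; rewrite nc0.
Qed.

Lemma nc_gt0 z : (0 < nc z) = (z != 0).
Proof. by rewrite lt_def nc_ge0 andbT nc_eq0. Qed.

Lemma nc_real x : nc x%:C = `|x|.
Proof. by rewrite /= expr0n/= addr0 sqrtr_sqr. Qed.

Lemma nc_i : nc ('i : R[i]) = 1.
Proof. by rewrite /= expr0n expr1n/= add0r sqrtr1. Qed.

Lemma nc_sum (I : Type) (r : seq I) (P : pred I) (F : I -> R[i]) :
  nc (\sum_(i <- r | P i) F i) <= \sum_(i <- r | P i) nc (F i).
Proof.
elim/big_rec2: _ => [|i y z _ h]; first by rewrite nc0.
by rewrite (le_trans (ncD _ _))// lerD2l.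
Qed.

Lemma Re_le_nc z : `|complex.Re z| <= nc z.
Proof.
case: z => a b /=; rewrite -sqrtr_sqr ler_sqrt ?addr_ge0 ?sqr_ge0//.
by rewrite lerDl sqr_ge0.
Qed.

Lemma Im_le_nc z : `|complex.Im z| <= nc z.
Proof.
case: z => a b /=; rewrite -sqrtr_sqr ler_sqrt ?addr_ge0 ?sqr_ge0//.
by rewrite lerDr sqr_ge0.
Qed.

Lemma nc_le_ReIm z : nc z <= `|complex.Re z| + `|complex.Im z|.
Proof.
rewrite [in leLHS](complexE z) (le_trans (ncD _ _))//.
by rewrite ncM nc_i mul1r !nc_real.
Qed.

Lemma nc_dist z w : `|nc z - nc w| <= nc (z - w).
Proof.
rewrite ler_norml; apply/andP; split.
  by have := ncD (w - z) z; rewrite subrK -(nc_distC z w); lra.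
by have := ncD (z - w) w; rewrite subrK; lra.
Qed.

Lemma ReD z w : complex.Re (z + w) = complex.Re z + complex.Re w.
Proof. by case: z; case: w. Qed.

Lemma ImD z w : complex.Im (z + w) = complex.Im z + complex.Im w.
Proof. by case: z; case: w. Qed.

Lemma Re_sum (I : Type) (r : seq I) (P : pred I) (F : I -> R[i]) :
  complex.Re (\sum_(i <- r | P i) F i) = \sum_(i <- r | P i) complex.Re (F i).
Proof. by elim/big_rec2: _ => // i y z _ <-; rewrite ReD. Qed.

Lemma Im_sum (I : Type) (r : seq I) (P : pred I) (F : I -> R[i]) :
  complex.Im (\sum_(i <- r | P i) F i) = \sum_(i <- r | P i) complex.Im (F i).
Proof. by elim/big_rec2: _ => // i y z _ <-; rewrite ImD. Qed.

Lemma ReN z : complex.Re (- z) = - complex.Re z.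
Proof. by case: z. Qed.

Lemma ImN z : complex.Im (- z) = - complex.Im z.
Proof. by case: z. Qed.

Lemma ReM z w : complex.Re (z * w) =
  complex.Re z * complex.Re w - complex.Im z * complex.Im w.
Proof. by case: z; case: w. Qed.

Lemma ImM z w : complex.Im (z * w) =
  complex.Re z * complex.Im w + complex.Im z * complex.Re w.
Proof. by case: z => a b; case: w => c d /=. Qed.

Lemma nc_ext z w : complex.Re z = complex.Re w -> complex.Im z = complex.Im w -> z = w.
Proof. by case: z => a b; case: w => c d /= -> ->. Qed.

Lemma cexp0 : cexp (0 : R[i]) = 1.
Proof. by rewrite /cexp /= expR0 cos0 sin0 mul1r mul1r. Qed.

Lemma cexpD z w : cexp (z + w) = cexp z * cexp w.
Proof.
apply: nc_ext; rewrite /= ReD ImD expRD ?cosD ?sinD; ring.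
Qed.

Lemma cexp_real x : cexp x%:C = (expR x)%:C.
Proof. by rewrite /cexp /= cos0 sin0 mulr1 mulr0. Qed.

Lemma nc_cexp z : nc (cexp z) = expR (complex.Re z).
Proof.
rewrite /cexp /= !exprMn -mulrDr cos2Dsin2 mulr1 sqrtr_sqr.
by rewrite ger0_norm// expR_ge0.
Qed.

End ComplexModulus.

(** * Taylor remainders of the complex exponential *)

Section Taylor.
Variable R : realType.
Implicit Types (z w : R[i]) (x y t : R).

Definition is_cderive (f : R -> R[i]) t (d : R[i]) :=
  is_derive t (1 : R) (fun s => complex.Re (f s)) (complex.Re d) /\
  is_derive t (1 : R) (fun s => complex.Im (f s)) (complex.Im d).

Lemma is_cderive_cexp z t :
  is_cderive (fun s => cexp (s%:C * z)) t (z * cexp (t%:C * z)).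
Proof.
case: z => a b; rewrite /is_cderive /cexp /=.
have dl (c : R) : is_derive t (1 : R) ( *%R^~ c) c.
  have -> : ( *%R^~ c) = c \*: (@id R).
    by apply/funext => s /=; rewrite mulrC.
  by apply: is_derive_eq; rewrite /GRing.scale /= mulr1.
have de : is_derive t (1 : R) (expR \o ( *%R^~ a)) (expR (t * a) * a).
  exact: is_derive1_comp.
have dc : is_derive t (1 : R) (cos \o ( *%R^~ b)) (- sin (t * b) * b).
  exact: is_derive1_comp.
have ds : is_derive t (1 : R) (sin \o ( *%R^~ b)) (cos (t * b) * b).
  exact: is_derive1_comp.
split.
  have -> : (fun s : R => expR (s * a - 0 * b) * cos (s * b + 0 * a)) =
      (expR \o ( *%R^~ a)) * (cos \o ( *%R^~ b)).
    by apply/funext => s /=; rewrite !mul0r subr0 addr0.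
  apply: is_derive_eq; rewrite /= !mul0r subr0 addr0 /GRing.scale /=; ring.
have -> : (fun s : R => expR (s * a - 0 * b) * sin (s * b + 0 * a)) =
    (expR \o ( *%R^~ a)) * (sin \o ( *%R^~ b)).
  by apply/funext => s /=; rewrite !mul0r subr0 addr0.
apply: is_derive_eq; rewrite /= !mul0r subr0 addr0 /GRing.scale /=; ring.
Qed.

Lemma is_cderiveB f g t d e : is_cderive f t d -> is_cderive g t e ->
  is_cderive (fun s => f s - g s) t (d - e).
Proof.
move=> [fr fi] [gr gi]; split.
  have -> : (fun s => complex.Re (f s - g s)) =
      (fun s => complex.Re (f s)) \- (fun s => complex.Re (g s)).
    by apply/funext => s /=; rewrite ReD ReN.
  by apply: is_derive_eq; rewrite ReD ReN.
have -> : (fun s => complex.Im (f s - g s)) =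
    (fun s => complex.Im (f s)) \- (fun s => complex.Im (g s)).
  by apply/funext => s /=; rewrite ImD ImN.
by apply: is_derive_eq; rewrite ImD ImN.
Qed.

Lemma is_cderive_monomial n z t :
  is_cderive (fun s => s%:C ^+ n * z) t (n%:R * (t%:C ^+ n.-1 * z)).
Proof.
have h (c : R) : is_derive t (1 : R) (fun s : R => s ^+ n * c) (n%:R * (t ^+ n.-1 * c)).
  have -> : (fun s : R => s ^+ n * c) = c \*: ((@id R) ^+ n).
    by apply/funext => s; rewrite [in RHS]fctE mulrC.
  apply: is_derive_eq.
  rewrite /GRing.scale /=; ring.
have e (s : R) m : s%:C ^+ m = (s ^+ m)%:C by rewrite rmorphXn.
have en : n%:R = (n%:R : R)%:C :> R[i] by rewrite rmorph_nat.
split.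
  under eq_fun do rewrite e ReM /= mul0r subr0.
  by rewrite en e !ReM !ImM /= !mul0r !subr0; exact: h.
under eq_fun do rewrite e ImM /= mul0r addr0.
by rewrite en e !ImM !ReM /= !mul0r !addr0; exact: h.
Qed.

(** The factor 2 appears because the real and the imaginary part have different intermediate
    points. *)
Lemma nc_MVT (f df : R -> R[i]) (B : R) :
    (forall t, is_cderive f t (df t)) ->
    (forall t, 0 <= t <= 1 -> nc (df t) <= B) ->
  nc (f 1 - f 0) <= 2 * B.
Proof.
move=> fdf dfB; rewrite (le_trans (nc_le_ReIm _))// mulr_natl mulr2n.
have cont (g dg : R -> R) : (forall t, is_derive t (1 : R) g (dg t)) ->
    {within `[0, 1], continuous g}.
  move=> gd; apply: derivable_within_continuous => x _.
  by have [] := gd x.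
apply: lerD.
  have [||c c01] := @MVT_segment R (fun s => complex.Re (f s)) (fun s => complex.Re (df s)) 0 1 ler01.
    by move=> s _; have [] := fdf s.
    by apply: cont => s; have [] := fdf s.
  rewrite subr0 mulr1 ReD ReN => ->.
  rewrite (le_trans (Re_le_nc _))// dfB//.
have [||c c01] := @MVT_segment R (fun s => complex.Im (f s)) (fun s => complex.Im (df s)) 0 1 ler01.
  by move=> s _; have [] := fdf s.
  by apply: cont => s; have [] := fdf s.
rewrite subr0 mulr1 ImD ImN => ->.
rewrite (le_trans (Im_le_nc _))// dfB//.
Qed.

Definition exp_taylor (k : nat) z := \sum_(i < k) (i`!)%:R^-1 * z ^+ i.

Lemma exp_taylor_derive k z t :
  is_cderive (fun s => cexp (s%:C * z) - exp_taylor k.+1 (s%:C * z)) t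
    (z * (cexp (t%:C * z) - exp_taylor k (t%:C * z))).
Proof.
rewrite /exp_taylor.
elim: k => [|k IH].
  have := is_cderiveB (is_cderive_cexp z t) (is_cderive_monomial 0 1 t).
  rewrite mul0r big_ord0 !subr0; congr is_cderive; apply/funext => s.
  by rewrite big_ord1 !expr0 fact0 invr1.
have -> : (fun s : R => cexp (s%:C * z) - \sum_(i < k.+2) (i`!)%:R^-1 * (s%:C * z) ^+ i) =
   (fun s : R => (cexp (s%:C * z) - \sum_(i < k.+1) (i`!)%:R^-1 * (s%:C * z) ^+ i)
     - s%:C ^+ k.+1 * (((k.+1)`!)%:R^-1 * z ^+ k.+1)).
  apply/funext => s; rewrite big_ord_recr /= opprD addrA.
  by rewrite exprMn mulrCA.
have -> : z * (cexp (t%:C * z) - \sum_(i < k.+1) (i`!)%:R^-1 * (t%:C * z) ^+ i) =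
  z * (cexp (t%:C * z) - \sum_(i < k) (i`!)%:R^-1 * (t%:C * z) ^+ i) -
  k.+1%:R * (t%:C ^+ k * (((k.+1)`!)%:R^-1 * z ^+ k.+1)).
  rewrite big_ord_recr /= opprD addrA mulrDr mulrN; congr (_ - _).
  rewrite factS natrM invfM exprMn exprS.
  have h : k.+1%:R != 0 :> R[i] by rewrite pnatr_eq0.
  set f := (k`!%:R)^-1.
  rewrite !mulrA; congr (_ * _); rewrite mulrC !mulrA.
  rewrite -(mulrA k.+1%:R) (mulrC k.+1%:R) -mulrA mulrAC.
  by rewrite divfK// mulrA.
exact: is_cderiveB IH (is_cderive_monomial _ _ _).
Qed.

(** Induction on the order: by [exp_taylor_derive] the remainder on the ray from 0 to z has as
    derivative z times the previous remainder, and it vanishes at 0. Each use of [nc_MVT] doubles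
    the constant, which becomes e 2^k. *)
Lemma exp_taylor_bound k : exists2 C : R, 0 <= C &
  forall z, nc z <= 1 -> nc (cexp z - exp_taylor k z) <= C * nc z ^+ k.
Proof.
elim: k => [|k [C C0 IH]].
  exists (expR 1); first exact: expR_ge0.
  move=> z z1; rewrite /exp_taylor big_ord0 subr0 expr0 mulr1 nc_cexp ler_expR.
  by rewrite (le_trans (ler_norm _))// (le_trans (Re_le_nc _)).
exists (2 * C); first by rewrite mulr_ge0.
move=> z z1.
have := @nc_MVT (fun s => cexp (s%:C * z) - exp_taylor k.+1 (s%:C * z)) _
   (C * nc z ^+ k.+1) (exp_taylor_derive k z).
rewrite !mul0r !mul1r cexp0.
have -> : exp_taylor k.+1 (0 : R[i]) = 1.
  rewrite /exp_taylor big_ord_recl expr0 fact0 invr1 mulr1 big1 ?addr0// => i _.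
  by rewrite expr0n /= mulr0.
rewrite subrr subr0 mulrA; apply.
move=> t /andP[t0 t1]; rewrite ncM exprS mulrCA ler_wpM2l ?nc_ge0//.
have h : nc (t%:C * z) <= nc z.
  by rewrite ncM nc_real ger0_norm// ler_piMl ?nc_ge0.
rewrite (le_trans (IH _ (le_trans h z1)))// ler_wpM2l//.
by rewrite lerXn2r ?nnegrE ?nc_ge0.
Qed.

End Taylor.

(** * The four-point estimate *)

Section FourPoint.
Variable R : realType.
Implicit Types (z w : R[i]) (x y t : R).

Lemma ln_lipschitz (m x y : R) : 0 < m -> m <= x -> m <= y ->
  `|ln x - ln y| <= `|x - y| / m.
Proof.
move=> m0; wlog xy : x y / x <= y => [hw mx my|mx my].
  have [xy|/ltW yx] := leP x y; first exact: hw.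
  by rewrite distrC (distrC x); exact: hw.
have x0 : 0 < x by exact: lt_le_trans mx.
have y0 : 0 < y by exact: lt_le_trans my.
rewrite distrC ger0_norm; last by rewrite subr_ge0 ler_ln ?posrE.
rewrite distrC ger0_norm ?subr_ge0//.
rewrite -lnV ?posrE// -lnM ?posrE ?invr_gt0//.
have -> : y * x^-1 = 1 + (y - x) / x by field; rewrite gt_eqF.
rewrite (le_trans (le_ln1Dx _))//.
  by rewrite (lt_le_trans (ltrN10 _))// divr_ge0 ?subr_ge0// ltW.
by rewrite ler_wpM2l ?subr_ge0// lef_pV2 ?posrE.
Qed.

Lemma nc_triangle w z v : nc (z - v) <= nc (z - w) + nc (w - v).
Proof. by rewrite -{1}(subrK w z) -addrA ncD. Qed.

(** An exponential sum seen from a base point: [b] lists its terms there, [d] the increments of the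
    exponents. Estimates through the total modulus of [b] and the size of [d] do not see the
    support, the point or the character. *)
Definition texp N (b d : 'I_N -> R[i]) : R[i] := \sum_j b j * cexp (d j).

Lemma texp_nc_le N (b d : 'I_N -> R[i]) (K c : R) :
  \sum_j nc (b j) <= K -> 0 <= c -> (forall j, nc (d j) <= c) ->
  nc (\sum_j b j * d j) <= K * c.
Proof.
move=> bK c0 dc; rewrite (le_trans (nc_sum _ _ _))//.
rewrite (@le_trans _ _ (\sum_j nc (b j) * c))//.
  by apply: ler_sum => j _; rewrite ncM ler_wpM2l ?nc_ge0.
by rewrite -mulr_suml ler_wpM2r.
Qed.

Lemma exp_taylor3 z : exp_taylor 3 z = 1 + z + z ^+ 2 / 2.
Proof.
rewrite /exp_taylor !big_ord_recl big_ord0 /= /bump /= expr0 expr1 addr0.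
by rewrite fact0 invr1 !mulr1 mul1r [_ * z ^+ 2]mulrC addrA.
Qed.

Lemma nc_M4 (a b c d : R[i]) (A B C D : R) : nc a <= A -> nc b <= B -> nc c <= C -> nc d <= D ->
  nc (a * b * c * d) <= A * B * C * D.
Proof.
move=> aA bB cC dD; rewrite !ncM.
by rewrite !ler_pM ?mulr_ge0 ?nc_ge0.
Qed.

(** Telescoping: the factors are replaced one at a time, each at a cost of at most M^3 e. *)
Lemma prod4_perturb (a0 a1 a2 a3 r0 r1 r2 r3 : R[i]) (M e : R) :
  nc a0 <= M -> nc a1 <= M -> nc a2 <= M ->
  nc (a1 + r1) <= M -> nc (a2 + r2) <= M -> nc (a3 + r3) <= M ->
  nc r0 <= e -> nc r1 <= e -> nc r2 <= e -> nc r3 <= e ->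
  nc ((a0 + r0) * (a1 + r1) * (a2 + r2) * (a3 + r3) - a0 * a1 * a2 * a3) <= 4 * M ^+ 3 * e.
Proof.
move=> A0 A1 A2 B1 B2 B3 R0 R1 R2 R3.
have -> : (a0 + r0) * (a1 + r1) * (a2 + r2) * (a3 + r3) - a0 * a1 * a2 * a3 =
  r0 * (a1 + r1) * (a2 + r2) * (a3 + r3) + a0 * r1 * (a2 + r2) * (a3 + r3)
  + a0 * a1 * r2 * (a3 + r3) + a0 * a1 * a2 * r3 by ring.
have -> : 4 * M ^+ 3 * e = e * M * M * M + M * e * M * M + M * M * e * M + M * M * M * e by ring.
rewrite (le_trans (ncD _ _))// lerD ?nc_M4//.
rewrite (le_trans (ncD _ _))// lerD ?nc_M4//.
by rewrite (le_trans (ncD _ _))// lerD ?nc_M4//.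
Qed.

(* The product is ((G + S)^2 - P^2) ((G - S)^2 + P^2), where the terms of order c^2,
   multiples of G^3 S and G^2 P^2, cancel. *)
Lemma quadratic_prod4 (K c : R) (G P S : R[i]) : 0 <= c -> c <= 1 ->
  nc G <= K -> nc P <= K * c -> nc S <= K * c ^+ 2 ->
  nc ((G + P + S) * (G - P + S) * (G + 'i * P - S) * (G - 'i * P - S) - G ^+ 4)
    <= 8 * K ^+ 4 * c ^+ 3.
Proof.
move=> c0 c1 hG hP hS.
have i2 : 'i * 'i = -1 :> R[i] by rewrite -expr2 sqr_i.
have -> : (G + P + S) * (G - P + S) * (G + 'i * P - S) * (G - 'i * P - S) - G ^+ 4 =
  - (G * G * S * S) - (G * G * S * S) + S * S * S * S + G * S * P * P + G * S * P * P
  + G * S * P * P + G * S * P * P - P * P * P * P.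
  have -> : (G + P + S) * (G - P + S) * (G + 'i * P - S) * (G - 'i * P - S) =
   (G + P + S) * (G - P + S) * ((G - S) ^+ 2 - ('i * 'i) * P ^+ 2) by ring.
  rewrite i2; ring.
have K0 : 0 <= K by rewrite (le_trans (nc_ge0 G)).
have h1 : nc (G * G * S * S) <= K ^+ 4 * c ^+ 3.
  rewrite (le_trans (nc_M4 hG hG hS hS))//.
  have -> : K * K * (K * c ^+ 2) * (K * c ^+ 2) = K ^+ 4 * c ^+ 4 by ring.
  by rewrite ler_wpM2l ?exprn_ge0// ler_wiXn2l.
have h2 : nc (S * S * S * S) <= K ^+ 4 * c ^+ 3.
  rewrite (le_trans (nc_M4 hS hS hS hS))//.
  have -> : K * c ^+ 2 * (K * c ^+ 2) * (K * c ^+ 2) * (K * c ^+ 2) = K ^+ 4 * c ^+ 8 by ring.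
  by rewrite ler_wpM2l ?exprn_ge0// ler_wiXn2l.
have h3 : nc (G * S * P * P) <= K ^+ 4 * c ^+ 3.
  rewrite (le_trans (nc_M4 hG hS hP hP))//.
  have -> : K * (K * c ^+ 2) * (K * c) * (K * c) = K ^+ 4 * c ^+ 4 by ring.
  by rewrite ler_wpM2l ?exprn_ge0// ler_wiXn2l.
have h4 : nc (P * P * P * P) <= K ^+ 4 * c ^+ 3.
  rewrite (le_trans (nc_M4 hP hP hP hP))//.
  have -> : K * c * (K * c) * (K * c) * (K * c) = K ^+ 4 * c ^+ 4 by ring.
  by rewrite ler_wpM2l ?exprn_ge0// ler_wiXn2l.
have -> : 8 * K ^+ 4 * c ^+ 3 = K ^+ 4 * c ^+ 3 + K ^+ 4 * c ^+ 3 + K ^+ 4 * c ^+ 3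
 + K ^+ 4 * c ^+ 3 + K ^+ 4 * c ^+ 3 + K ^+ 4 * c ^+ 3 + K ^+ 4 * c ^+ 3 + K ^+ 4 * c ^+ 3 by ring.
rewrite (le_trans (ncB _ _))// lerD//.
do 5! rewrite (le_trans (ncD _ _))// lerD//.
by rewrite (le_trans (ncB _ _))// lerD// ncN.
Qed.

(** Each factor is its second-order Taylor polynomial up to O(c^3), and [quadratic_prod4] treats the
    product of these polynomials. Working with the product postpones the logarithm until the factors
    are known not to vanish. *)
Lemma texp_prod4 (K : R) : 0 <= K -> exists2 D : R, 0 <= D &
  forall N (b d : 'I_N -> R[i]) (c : R), 0 <= c -> c <= 1 -> \sum_j nc (b j) <= K ->
    (forall j, nc (d j) <= c) ->
  nc (texp b d * texp b (fun j => - d j) * texp b (fun j => 'i * d j)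
      * texp b (fun j => - ('i * d j)) - (\sum_j b j) ^+ 4) <= D * c ^+ 3.
Proof.
move=> K0; have [C C0 hC] := exp_taylor_bound R 3.
(* The three terms of the quadratic part are at most K each, and K C bounds the remainder. *)
pose M := K * 3 + K * C.
exists (4 * M ^+ 3 * (K * C) + 8 * K ^+ 4).
  by rewrite addr_ge0// !mulr_ge0// ?exprn_ge0 ?addr_ge0 ?mulr_ge0.
move=> N b d c c0 c1 bK dc.
pose G := \sum_j b j; pose P := \sum_j b j * d j; pose S := \sum_j b j * (d j ^+ 2 / 2).
pose r (e : 'I_N -> R[i]) := \sum_j b j * (cexp (e j) - exp_taylor 3 (e j)).
have texpE e : texp b e = G + (\sum_j b j * e j) + (\sum_j b j * (e j ^+ 2 / 2)) + r e.
  rewrite /texp /G /r -!big_split /=; apply: eq_bigr => j _.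
  rewrite exp_taylor3; ring.
have hG : nc G <= K by rewrite (le_trans (nc_sum _ _ _)).
have hP : nc P <= K * c by exact: texp_nc_le.
have hS : nc S <= K * c ^+ 2.
  apply: texp_nc_le => //; first exact: exprn_ge0.
  move=> j; rewrite ncM ncX ncV -[2]/(2%:R) -(rmorph_nat (real_complex R)) nc_real ger0_norm//.
  apply: (@le_trans _ _ (nc (d j) ^+ 2)).
    by rewrite ler_piMr ?exprn_ge0 ?nc_ge0// invf_le1//; lra.
  by rewrite lerXn2r ?nnegrE ?nc_ge0.
have hr e : (forall j, nc (e j) <= c) -> nc (r e) <= K * C * c ^+ 3.
  move=> ec; rewrite -mulrA; apply: texp_nc_le => //; first by rewrite mulr_ge0 ?exprn_ge0.
  move=> j; rewrite (le_trans (hC _ (le_trans (ec j) c1)))// ler_wpM2l//.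
  by rewrite lerXn2r ?nnegrE ?nc_ge0.
have i2 : 'i * 'i = -1 :> R[i] by rewrite -expr2 sqr_i.
have e1 : texp b d = (G + P + S) + r d by rewrite texpE.
have e2 : texp b (fun j => - d j) = (G - P + S) + r (fun j => - d j).
  rewrite texpE; congr (_ + _ + _ + _).
    by rewrite -sumrN; apply: eq_bigr => j _; rewrite mulrN.
  by apply: eq_bigr => j _; rewrite sqrrN.
have e3 : texp b (fun j => 'i * d j) = (G + 'i * P - S) + r (fun j => 'i * d j).
  rewrite texpE; congr (_ + _ + _ + _).
    by rewrite mulr_sumr; apply: eq_bigr => j _; rewrite mulrCA.
  by rewrite -sumrN; apply: eq_bigr => j _; rewrite exprMn expr2 i2; ring.
have e4 : texp b (fun j => - ('i * d j)) = (G - 'i * P - S) + r (fun j => - ('i * d j)).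
  rewrite texpE; congr (_ + _ + _ + _).
    by rewrite mulr_sumr -sumrN; apply: eq_bigr => j _; rewrite mulrN mulrCA.
  by rewrite -sumrN; apply: eq_bigr => j _; rewrite sqrrN exprMn expr2 i2; ring.
rewrite e1 e2 e3 e4 -/G.
set R0 := r d; set R1 := r (fun j => - d j); set R2 := r (fun j => 'i * d j).
set R3 := r (fun j => - ('i * d j)).
have cM : K * c ^+ 2 <= K.
  by rewrite ler_piMr// exprn_ile1.
have cM1 : K * c <= K by rewrite ler_piMr.
have cM3 : K * C * c ^+ 3 <= K * C.
  by rewrite ler_piMr ?mulr_ge0// exprn_ile1.
have B3 (p q s : R[i]) : nc p <= K -> nc q <= K * c -> nc s <= K * c ^+ 2 ->
    nc (p + q + s) <= K * 3.
  move=> h1 h2 h3; rewrite (le_trans (ncD _ _))//.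
  have := ncD p q; lra.
have KC0 : 0 <= K * C by rewrite mulr_ge0.
have BM (p : R[i]) : nc p <= K * 3 -> nc p <= M by move=> h; rewrite /M; lra.
have BM' (p s : R[i]) : nc p <= K * 3 -> nc s <= K * C * c ^+ 3 -> nc (p + s) <= M.
  by move=> h h'; have := ncD p s; rewrite /M; lra.
have hiP : nc ('i * P) <= K * c by rewrite ncM nc_i mul1r.
have A0 : nc (G + P + S) <= K * 3 by exact: B3.
have A1 : nc (G - P + S) <= K * 3 by rewrite B3 ?ncN.
have A2 : nc (G + 'i * P - S) <= K * 3 by apply: B3; rewrite // ncN.
have A3 : nc (G - 'i * P - S) <= K * 3 by apply: B3; rewrite // ncN.
have S0 : nc R0 <= K * C * c ^+ 3 by exact: hr.
have S1 : nc R1 <= K * C * c ^+ 3 by apply: hr => j; rewrite ncN.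
have S2 : nc R2 <= K * C * c ^+ 3 by apply: hr => j; rewrite ncM nc_i mul1r.
have S3 : nc R3 <= K * C * c ^+ 3 by apply: hr => j; rewrite ncN ncM nc_i mul1r.
rewrite (le_trans (nc_triangle
  ((G + P + S) * (G - P + S) * (G + 'i * P - S) * (G - 'i * P - S)) _ _))// [leRHS]mulrDl lerD//.
  by rewrite -[leRHS]mulrA; apply: prod4_perturb => //; first [by apply: BM | by apply: BM'].
exact: quadratic_prod4.
Qed.

(** For small c the product of the four values stays above m^4 / 2 in modulus. Hence no factor
    vanishes, and the logarithm is Lipschitz there with constant 2 / m^4, which turns the estimate
    on products into one on sums of logarithms. *)
Lemma four_point (K m : R) : 0 <= K -> 0 < m -> exists C c0 : R, [/\ 0 <= C, 0 < c0 <= 1 &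
  forall N (b d : 'I_N -> R[i]) (c : R), 0 <= c -> c <= c0 -> \sum_j nc (b j) <= K ->
    m <= nc (\sum_j b j) -> (forall j, nc (d j) <= c) ->
  [/\ 0 < nc (texp b d), 0 < nc (texp b (fun j => - d j)),
      0 < nc (texp b (fun j => 'i * d j)), 0 < nc (texp b (fun j => - ('i * d j)))
   & `|ln (nc (texp b d)) + ln (nc (texp b (fun j => - d j)))
     + ln (nc (texp b (fun j => 'i * d j))) + ln (nc (texp b (fun j => - ('i * d j))))
     - 4 * ln (nc (\sum_j b j))| <= C * c ^+ 3]].
Proof.
move=> K0 m0; have [D D0 hD] := texp_prod4 K0.
have m40 : 0 < m ^+ 4 / 2 by rewrite divr_gt0 ?exprn_gt0.
pose c0 := Num.min 1 (m ^+ 4 / 2 / (D + 1)).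
have D1 : 0 < D + 1 by lra.
exists (D / (m ^+ 4 / 2)), c0; split.
- by rewrite divr_ge0// ltW.
- by rewrite /c0 lt_min ltr01 divr_gt0//= ge_min lexx.
move=> N b d c cge0 cc0 bK mG dc.
have c1 : c <= 1 by rewrite (le_trans cc0)// ge_min lexx.
have := hD _ _ _ _ cge0 c1 bK dc.
set E0 := texp b d; set E1 := texp b (fun j => - d j).
set E2 := texp b (fun j => 'i * d j); set E3 := texp b (fun j => - ('i * d j)).
set G := \sum_j b j => hE.
have c3 : D * c ^+ 3 <= m ^+ 4 / 2.
  have : c ^+ 3 <= c by rewrite exprS ler_piMr// exprn_ile1.
  have : c <= m ^+ 4 / 2 / (D + 1) by rewrite (le_trans cc0)// ge_min lexx orbT.
  rewrite ler_pdivlMr// => h1 h2.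
  by rewrite (le_trans _ h1)// mulrC ler_pM// ?exprn_ge0// lerDl.
have mG4 : m ^+ 4 <= nc G ^+ 4.
  by rewrite lerXn2r ?nnegrE ?nc_ge0// ltW.
have hX : `|nc (E0 * E1 * E2 * E3) - nc (G ^+ 4)| <= D * c ^+ 3.
  by rewrite (le_trans (nc_dist _ _)).
have Xm : m ^+ 4 / 2 <= nc (E0 * E1 * E2 * E3).
  by move: hX; rewrite ncX ler_norml; lra.
have Ym : m ^+ 4 / 2 <= nc (G ^+ 4) by rewrite ncX; lra.
have X0 : E0 * E1 * E2 * E3 != 0 by rewrite -nc_gt0; lra.
have [h0 h1 h2 h3] : [/\ E0 != 0, E1 != 0, E2 != 0 & E3 != 0].
  by move: X0; rewrite !mulf_eq0 !negb_or -!andbA => /and4P[].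
split; rewrite ?nc_gt0//.
have := ln_lipschitz m40 Xm Ym.
have G0 : 0 < nc G by exact: lt_le_trans mG.
rewrite ncX lnXn// !ncM !lnM ?posrE ?mulr_gt0 ?nc_gt0// mulr_natl => /le_trans; apply.
rewrite [leRHS]mulrAC; apply: ler_wpM2r; first by rewrite invr_ge0 ltW.
by rewrite -!ncM -ncX.
Qed.

(** Truncation keeps the logarithm bounded near zeros, at the price of harmonicity: the maximum of
    log|z| and a constant is only subharmonic. *)
Definition lnmax (m : R) z := ln (Num.max m (nc z)).

Lemma lnmax_lipschitz (m : R) z w : 0 < m -> `|lnmax m z - lnmax m w| <= nc (z - w) / m.
Proof.
move=> m0; rewrite /lnmax (le_trans (ln_lipschitz m0 _ _))// ?le_max ?lexx//.
apply: ler_wpM2r; first by rewrite invr_ge0 ltW.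
apply: (@le_trans _ _ `|nc z - nc w|); last exact: nc_dist.
have h (a b : R) : a <= b -> `|Num.max m a - Num.max m b| <= `|a - b|.
  move=> ab; have ba : 0 <= b - a by rewrite subr_ge0.
  rewrite (distrC a) (ger0_norm ba) distrC.
  have ma : m <= Num.max m a by rewrite le_max lexx.
  have aa : a <= Num.max m a by rewrite le_max lexx orbT.
  have mab : Num.max m a <= Num.max m b.
    by rewrite ge_max !le_max lexx ab orbT.
  rewrite ger0_norm ?subr_ge0// lerBlDr ge_max; apply/andP; split; lra.
by have [/h//|/ltW/h] := leP (nc z) (nc w); rewrite distrC (distrC (nc w)).
Qed.

Lemma texp_near (K : R) : 0 <= K -> exists2 D : R, 0 <= D &
  forall N (b d : 'I_N -> R[i]) (c : R), 0 <= c -> c <= 1 -> \sum_j nc (b j) <= K ->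
    (forall j, nc (d j) <= c) -> nc (texp b d - \sum_j b j) <= D * c.
Proof.
move=> K0; have [C C0 hC] := exp_taylor_bound R 1.
exists (K * C); first exact: mulr_ge0.
move=> N b d c c0 c1 bK dc.
have -> : texp b d - \sum_j b j = \sum_j b j * (cexp (d j) - exp_taylor 1 (d j)).
  rewrite /texp -sumrB; apply: eq_bigr => j _.
  by rewrite /exp_taylor big_ord1 fact0 invr1 expr0 mulr1 mulrBr mulr1.
rewrite -mulrA; apply: texp_nc_le => //; first exact: mulr_ge0.
by move=> j; rewrite (le_trans (hC _ (le_trans (dc j) c1)))// ler_wpM2l// expr1.
Qed.

Definition lnmax4 m N (b d : 'I_N -> R[i]) : R :=
  lnmax m (texp b d) + lnmax m (texp b (fun j => - d j))
  + lnmax m (texp b (fun j => 'i * d j)) + lnmax m (texp b (fun j => - ('i * d j)))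
  - 4 * lnmax m (\sum_j b j).

(** Lower bound: if the centre is at least m in modulus, truncation leaves it unchanged and can only
    raise its neighbours; otherwise the centre takes the minimal value ln m. Upper bound: the second
    condition on c moves the neighbours by at most m, so with a centre above 2 m no value is
    truncated. *)
Lemma lnmax_four_point (K m : R) : 0 <= K -> 0 < m -> exists C c0 : R,
  [/\ 0 <= C, 0 < c0 <= 1 &
  forall N (b d : 'I_N -> R[i]) (c : R), 0 <= c -> c <= c0 -> \sum_j nc (b j) <= K ->
    (forall j, nc (d j) <= c) ->
    - (C * c ^+ 3) <= lnmax4 m b d /\
    (2 * m <= nc (\sum_j b j) -> lnmax4 m b d <= C * c ^+ 3)].
Proof.
move=> K0 m0; have [C [c0 [C0 /andP[c0_gt0 c01] hC]]] := four_point K0 m0.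
have [D D0 hD] := texp_near K0.
pose c' := Num.min c0 (m / (D + 1)).
have D1 : 0 < D + 1 by lra.
exists C, c'; split => //.
  by rewrite /c' lt_min c0_gt0 divr_gt0//= ge_min c01.
move=> N b d c cge0 cc' bK dc.
have cc0 : c <= c0 by rewrite (le_trans cc')// ge_min lexx.
have cD : D * c <= m.
  have : c <= m / (D + 1) by rewrite (le_trans cc')// ge_min lexx orbT.
  by rewrite ler_pdivlMr// => h; rewrite (le_trans _ h)// mulrC ler_wpM2l// lerDl.
split.
  have [mG|Gm] := leP m (nc (\sum_j b j)).
    have [e0 e1 e2 e3] := hC _ _ _ _ cge0 cc0 bK mG dc.
    rewrite ler_norml => /andP[h _]; rewrite (le_trans h)// /lnmax4 /lnmax.
    rewrite (max_idPr mG) lerD2r !lerD// ler_ln ?posrE ?lt_max ?m0// le_max lexx orbT//.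
  rewrite (@le_trans _ _ 0)//; first by rewrite oppr_le0 mulr_ge0// exprn_ge0.
  have mL z : ln m <= lnmax m z by rewrite /lnmax ler_ln ?posrE ?lt_max ?m0// le_max lexx.
  rewrite /lnmax4 {5}/lnmax (max_idPl (ltW Gm)).
  have := mL (texp b d). have := mL (texp b (fun j => - d j)).
  have := mL (texp b (fun j => 'i * d j)). have := mL (texp b (fun j => - ('i * d j))).
  lra.
move=> mG.
have mG' : m <= nc (\sum_j b j) by lra.
have [e0 e1 e2 e3] := hC _ _ _ _ cge0 cc0 bK mG' dc.
rewrite ler_norml => /andP[_ h]; rewrite (le_trans _ h)// /lnmax4 /lnmax.
have c1 : c <= 1 by exact: le_trans c01.
have E e : (forall j, nc (e j) <= c) -> m <= nc (texp b e).
  move=> ec; have := hD _ _ _ _ cge0 c1 bK ec; have := nc_dist (texp b e) (\sum_j b j).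
  rewrite ler_norml; lra.
rewrite !(max_idPr _)//; apply: E => // j; rewrite ?ncN// ncM nc_i mul1r//.
Qed.

End FourPoint.

(** * Hurwitz's theorem for exponential sums *)

Section Hurwitz.
Variable R : realType.
Implicit Types (z w : R[i]) (x y t : R).

(** The sum on a complex line through the base point, with real frequencies [l]. *)
Definition lsum N (l : 'I_N -> R) (b : 'I_N -> R[i]) w :=
  texp b (fun j => (l j)%:C * w).

Lemma lsum_shift N (l : 'I_N -> R) (b : 'I_N -> R[i]) w v :
  lsum l b (w + v) = texp (fun j => b j * cexp ((l j)%:C * w)) (fun j => (l j)%:C * v).
Proof.
by apply: eq_bigr => j _; rewrite mulrDr cexpD mulrA.
Qed.

Lemma lsum0 N (l : 'I_N -> R) (b : 'I_N -> R[i]) : lsum l b 0 = \sum_j b j.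
Proof. by apply: eq_bigr => j _; rewrite mulr0 cexp0 mulr1. Qed.

Lemma lsum_sum N (l : 'I_N -> R) (b : 'I_N -> R[i]) w :
  lsum l b w = \sum_j b j * cexp ((l j)%:C * w).
Proof. by []. Qed.

(** The summand 1 makes it a positive divisor. *)
Definition lbound N (l : 'I_N -> R) := 1 + \sum_j `|l j|.

Lemma lbound_ge1 N (l : 'I_N -> R) : 1 <= lbound l.
Proof. by rewrite lerDl sumr_ge0. Qed.

Lemma lbound_ge N (l : 'I_N -> R) j : `|l j| <= lbound l.
Proof.
rewrite /lbound (bigD1 j)//= addrCA lerDl.
by rewrite addr_ge0// sumr_ge0.
Qed.

Lemma nc_lmul N (l : 'I_N -> R) j w : nc ((l j)%:C * w) <= lbound l * nc w.
Proof. by rewrite ncM nc_real ler_wpM2r ?nc_ge0 ?lbound_ge. Qed.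

Lemma nc_cexp_le w : nc (cexp w) <= expR (nc w).
Proof. by rewrite nc_cexp ler_expR (le_trans (ler_norm _)) ?Re_le_nc. Qed.

Lemma nc_weights N (l : 'I_N -> R) (b : 'I_N -> R[i]) w s : nc w <= s ->
  \sum_j nc (b j * cexp ((l j)%:C * w)) <= (\sum_j nc (b j)) * expR (lbound l * s).
Proof.
move=> ws; rewrite mulr_suml; apply: ler_sum => j _.
rewrite ncM ler_wpM2l ?nc_ge0// (le_trans (nc_cexp_le _))// ler_expR.
rewrite (le_trans (nc_lmul _ _ _))// ler_wpM2l//.
by rewrite (le_trans _ (lbound_ge1 l)).
Qed.

(** Vandermonde: if all these moments vanished, testing against the polynomial whose roots are the
    other frequencies would give b j0 = 0. Up to factorials the moments are the Taylor coefficients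
    of [lsum l b] at 0. *)
Lemma power_sum_neq0 N (l : 'I_N -> R) (b : 'I_N -> R[i]) j0 : injective l ->
  b j0 != 0 -> exists k, \sum_j b j * (l j)%:C ^+ k != 0.
Proof.
move=> linj bj0; apply: contrapT => /forallNP h.
have h0 k : \sum_j b j * (l j)%:C ^+ k = 0 by apply/eqP/negPn/negP/h.
pose p : {poly R[i]} := \prod_(j | j != j0) ('X - ((l j)%:C)%:P).
have : \sum_j b j * p.[(l j)%:C] = 0.
  under eq_bigr do rewrite horner_coef mulr_sumr.
  rewrite exchange_big big1//= => i _.
  under eq_bigr do rewrite mulrCA.
  by rewrite -mulr_sumr h0 mulr0.
rewrite (bigD1 j0)//= big1 ?addr0 => [/eqP|j jj0].
  rewrite mulf_eq0 (negbTE bj0)/= /p horner_prod => /prodf_eq0[j jj0].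
  rewrite hornerXsubC subr_eq0 => /eqP[/linj ej].
  by rewrite ej eqxx in jj0.
rewrite /p horner_prod (bigD1 j)//= hornerXsubC subrr mul0r mulr0//.
Qed.

(* Take s to be small compared with the first nonvanishing Taylor coefficient. *)
Lemma lsum_annulus N (l : 'I_N -> R) (b : 'I_N -> R[i]) j0 (r : R) : injective l ->
  b j0 != 0 -> 0 < r -> exists s m : R, [/\ 0 < s < r, 0 < m &
    forall w, s <= nc w <= 2 * s -> m <= nc (lsum l b w)].
Proof.
move=> linj bj0 r0.
have [k0 hk0] := power_sum_neq0 linj bj0.
pose a k := \sum_j b j * (l j)%:C ^+ k.
have /ex_minnP[k ak kmin] : exists k, a k != 0 by exists k0.
have a0 i : (i < k)%N -> a i = 0.
  by move=> ik; apply/eqP/negPn/negP => /kmin; rewrite leqNgt ik.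
have [C C0 hC] := exp_taylor_bound R k.+1.
pose A := nc (a k) / k`!%:R.
have A0 : 0 < A by rewrite divr_gt0 ?nc_gt0// ltr0n fact_gt0.
pose L := lbound l; have L1 : 1 <= L := lbound_ge1 l.
have L0 : 0 < L by exact: lt_le_trans L1.
pose D := (\sum_j nc (b j)) * (C * L ^+ k.+1).
have D0 : 0 <= D by rewrite mulr_ge0 ?sumr_ge0 ?mulr_ge0 ?exprn_ge0 ?(ltW L0)// => j _; rewrite nc_ge0.
(* The three bounds give s < r, exponents of modulus at most 1 on |w| <= 2s, as [exp_taylor_bound]
   requires, and a remainder of at most half the leading term. *)
pose s := Num.min (r / 2) (Num.min (L^-1 / 2) (A / (4 * (D + 1)))).
have s0 : 0 < s.
  by rewrite !lt_min; apply/and3P; split; rewrite divr_gt0 ?invr_gt0//; lra.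
have sr : s < r by apply: (@le_lt_trans _ _ (r / 2)); [rewrite ge_min lexx | lra].
have sL : 2 * s <= L^-1.
  have : s <= L^-1 / 2 by rewrite !ge_min lexx orbT.
  by rewrite ler_pdivlMr// mulrC.
have sD : D * (2 * s) <= A / 2.
  have : s <= A / (4 * (D + 1)) by rewrite !ge_min lexx !orbT.
  rewrite ler_pdivlMr; last by lra.
  have := mulr_ge0 D0 (ltW s0); lra.
exists s, (s ^+ k * (A / 2)); split; first by rewrite s0.
  by apply: mulr_gt0; [exact: exprn_gt0|lra].
move=> w /andP[sw ws].
have w0 : 0 < nc w by exact: lt_le_trans sw.
pose rem := \sum_j b j * (cexp ((l j)%:C * w) - exp_taylor k.+1 ((l j)%:C * w)).
have hE : lsum l b w = a k * w ^+ k / k`!%:R + rem.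
  apply/eqP; rewrite -subr_eq /rem -sumrB /=; apply/eqP.
  transitivity (\sum_j b j * exp_taylor k.+1 ((l j)%:C * w)).
    by apply: eq_bigr => j _; rewrite -mulrBr opprB addrC subrK.
  rewrite /exp_taylor; under eq_bigr do rewrite mulr_sumr.
  rewrite exchange_big big_ord_recr big1 /= => [|i _].
    rewrite add0r /a !mulr_suml; apply: eq_bigr => j _; rewrite exprMn.
    by rewrite mulrCA mulrC !mulrA.
  transitivity (a i * w ^+ i / i`!%:R); last by rewrite a0// !mul0r.
  rewrite /a !mulr_suml; apply: eq_bigr => j _; rewrite exprMn.
  by rewrite mulrCA mulrC !mulrA.
have lw1 j : nc ((l j)%:C * w) <= 1.
  by rewrite (le_trans (nc_lmul _ _ _))// -/L -ler_pdivlMl// mulr1 (le_trans ws).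
have hrem : nc rem <= nc w ^+ k * (A / 2).
  apply: (@le_trans _ _ (nc w ^+ k * (D * nc w))); last first.
    rewrite ler_wpM2l ?exprn_ge0 ?nc_ge0// (le_trans _ sD)// ler_wpM2l//.
  have -> : nc w ^+ k * (D * nc w) = (\sum_j nc (b j)) * (C * (L * nc w) ^+ k.+1).
    by rewrite /D exprMn !exprS; ring.
  have Lw0 : 0 <= L * nc w by rewrite mulr_ge0 ?ltW.
  apply: texp_nc_le => //; first by rewrite mulr_ge0 ?exprn_ge0.
  move=> j; rewrite (le_trans (hC _ (lw1 j)))// ler_wpM2l// lerXn2r ?nnegrE ?nc_ge0//.
  exact: nc_lmul.
have h1 : nc (a k * w ^+ k / k`!%:R) = nc w ^+ k * A.
  rewrite !ncM ncX ncV -(rmorph_nat (real_complex R)) nc_real ger0_norm//.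
  by rewrite /A; ring.
have h2 : s ^+ k * (A / 2) <= nc w ^+ k * (A / 2).
  apply: ler_wpM2r; first by lra.
  by rewrite lerXn2r ?nnegrE ?nc_ge0// ltW.
have := ncB (lsum l b w) rem; rewrite hE addrK h1; move: hrem h2.
rewrite mulrA; lra.
Qed.

Definition cplx (p : 'rV[R]_2) : R[i] := p 0 0 +i* p 0 1.
Definition box (s : R) : set 'rV[R]_2 := [set p | forall i, p 0 i \in `[- s, s]].

Lemma box_compact s : compact (box s).
Proof.
have := @rV_compact R 2 (fun=> `[- s, s]%classic) (fun=> @segment_compact _ _ _).
by congr compact; apply/seteqP; split.
Qed.

Lemma boxP s p : box s p -> [/\ `|p 0 0| <= s, `|p 0 1| <= s & nc (cplx p) <= 2 * s].
Proof.
move=> h; have /[!in_itv] h0 := h 0; have /[!in_itv] h1 := h 1.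
have a0 : `|p 0 0| <= s by rewrite ler_norml.
have a1 : `|p 0 1| <= s by rewrite ler_norml.
split => //; rewrite (le_trans (nc_le_ReIm _))//= mulr_natl mulr2n lerD//.
Qed.

Lemma lsum_continuous N (l : 'I_N -> R) (b : 'I_N -> R[i]) :
  continuous (fun p => nc (lsum l b (cplx p))).
Proof.
move=> p; apply/(@cvgrPdist_lt _ _ _ (nbhs p)) => e e0.
pose K := (\sum_j nc (b j)) * expR (lbound l * nc (cplx p)).
have K0 : 0 <= K.
  by rewrite mulr_ge0 ?sumr_ge0 ?expR_ge0// => j _; rewrite nc_ge0.
have [D D0 hD] := texp_near K0.
pose L := lbound l; have L1 : 1 <= L := lbound_ge1 l.
have L0 : 0 < L by exact: lt_le_trans L1.
have D1 : 0 < D + 1 by lra.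
pose t := Num.min 1 (e / (D + 1)) / L / 2.
have t0 : 0 < t by rewrite !divr_gt0// lt_min ltr01 divr_gt0.
apply: (filterS _ (@nbhsx_ballx R 'rV[R]_2 p t t0)) => q [_ pq].
have pqi i : `|p 0 i - q 0 i| < t by exact: pq.
rewrite distrC (le_lt_trans (nc_dist _ _))//.
have -> : cplx q = cplx p + (cplx q - cplx p) by rewrite addrC subrK.
set v := cplx q - cplx p.
have vt : nc v < 2 * t.
  rewrite (le_lt_trans (nc_le_ReIm _))// mulr_natl mulr2n /v /= !(distrC (q 0 _)).
  by rewrite ltrD.
have c1 : 2 * t * L = Num.min 1 (e / (D + 1)).
  by rewrite /t; set M := Num.min _ _; field; rewrite gt_eqF.
have := hD _ (fun j => b j * cexp ((l j)%:C * cplx p)) (fun j => (l j)%:C * v) (L * nc v).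
rewrite -lsum_shift -lsum_sum.
have Lv : L * nc v <= Num.min 1 (e / (D + 1)).
  by rewrite -c1 mulrC ler_wpM2r ?ltW.
move: Lv; rewrite le_min => /andP[Lv1 Lve].
move=> h; apply: (le_lt_trans (h _ _ _ _)) => //.
- by rewrite mulr_ge0 ?nc_ge0 ?ltW.
- exact: nc_weights.
- by move=> j; exact: nc_lmul.
have : D * (e / (D + 1)) < e.
  by rewrite mulrA ltr_pdivrMr// mulrC mulrDr mulr1 ltrDl.
by apply: le_lt_trans; rewrite ler_wpM2l.
Qed.

(* Otherwise -log|f| + e |w|^2 attains its maximum over the box at an interior point,
   where the four-point estimate makes the sum of the four neighbours too large. *)
Lemma lsum_min_modulus N (l : 'I_N -> R) (b : 'I_N -> R[i]) (s m : R) :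
  0 < s -> 0 < m ->
  (forall p, box s p -> lsum l b (cplx p) != 0) ->
  (forall p, box s p -> `|p 0 0| = s \/ `|p 0 1| = s -> m <= nc (lsum l b (cplx p))) ->
  m <= nc (lsum l b 0).
Proof.
move=> s0 m0 hne hbd; rewrite leNgt; apply/negP => h0m.
have box0 : box s 0 by move=> i; rewrite mxE in_itv /= oppr_le0 (ltW s0).
have cplx0 : cplx 0 = 0 by rewrite /cplx !mxE.
have h00 : 0 < nc (lsum l b 0) by rewrite nc_gt0; have := hne _ box0; rewrite cplx0.
pose d := ln m - ln (nc (lsum l b 0)).
have d0 : 0 < d by rewrite subr_gt0 ltr_ln ?posrE.
(* On the box |w|^2 <= 2 s^2, so the quadratic term gains at most d / 2, less than the gap d between
   the centre and the boundary; the maximum is therefore interior. *)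
pose e := d / (4 * s ^+ 2).
have s2 : 0 < s ^+ 2 by rewrite exprn_gt0.
have e0 : 0 < e by rewrite divr_gt0// mulr_gt0.
pose u (p : 'rV[R]_2) := - ln (nc (lsum l b (cplx p))) + e * (p 0 0 ^+ 2 + p 0 1 ^+ 2).
have ucont : {within box s, continuous u}.
  apply: continuous_in_subspaceT => p; rewrite inE => bp.
  have hp : 0 < nc (lsum l b (cplx p)) by rewrite nc_gt0 hne.
  apply: (@continuousD R R 'rV[R]_2); last first.
    apply: continuousM; first exact: cst_continuous.
    have sq i : {for p, continuous (fun q : 'rV[R]_2 => q 0 i ^+ 2)}.
      apply: (@continuousM R 'rV[R]_2 (fun q => q 0 i) (fun q => q 0 i)); exact: coord_continuous.
    exact: (@continuousD R R 'rV[R]_2).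
  apply: (@continuousN R R 'rV[R]_2); apply: (@continuous_comp _ _ _ _ (@ln R)).
    exact: lsum_continuous.
  exact: continuous_ln.
have [p bp pmax] := @EVT_max_rV R 2 u (box s) (ex_intro _ 0 box0) (@box_compact s) ucont.
rewrite inE in bp.
have pmax' q : box s q -> u q <= u p by move=> bq; apply: pmax; rewrite inE.
have [p0s p1s pn] := boxP bp.
have u0 : d - ln m <= u p.
  have := pmax' _ box0; rewrite {1}/u cplx0 !mxE expr0n /= addr0 mulr0 addr0 /d; lra.
have int : `|p 0 0| < s /\ `|p 0 1| < s.
  apply: contrapT => h.
  have hb : `|p 0 0| = s \/ `|p 0 1| = s.
    have [a|a] := ltP `|p 0 0| s; last by left; apply/eqP; rewrite eq_le p0s a.
    have [c|c] := ltP `|p 0 1| s; last by right; apply/eqP; rewrite eq_le p1s c.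
    by exfalso; apply: h.
  have := hbd _ bp hb => hm.
  have : ln m <= ln (nc (lsum l b (cplx p))).
    by rewrite ler_ln ?posrE// (lt_le_trans m0).
  have q0 : p 0 0 ^+ 2 <= s ^+ 2.
    by rewrite -real_normK ?num_real// lerXn2r ?nnegrE// ltW.
  have q1 : p 0 1 ^+ 2 <= s ^+ 2.
    by rewrite -real_normK ?num_real// lerXn2r ?nnegrE// ltW.
  have : e * (p 0 0 ^+ 2 + p 0 1 ^+ 2) <= d / 2.
    apply: (@le_trans _ _ (e * (2 * s ^+ 2))).
      by apply: ler_wpM2l; [exact: ltW|lra].
    by rewrite (_ : e * _ = d / 2)// /e; field; rewrite gt_eqF.
  move: u0; rewrite /u; lra.
case: int => int0 int1.
pose L := lbound l; have L1 : 1 <= L := lbound_ge1 l.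
have L0 : 0 < L by exact: lt_le_trans L1.
pose w := cplx p.
pose b' j := b j * cexp ((l j)%:C * w).
have K0 : 0 <= \sum_j nc (b' j) by rewrite sumr_ge0// => j _; rewrite nc_ge0.
have hw0 : 0 < nc (lsum l b w) by rewrite nc_gt0 hne.
have [C [c0 [C0 /andP[c00 c01] hC]]] := four_point K0 hw0.
have CL : 0 <= C * L ^+ 3 by rewrite mulr_ge0// exprn_ge0// ltW.
pose t := Num.min (Num.min (c0 / L) (e / (C * L ^+ 3 + 1)))
  (Num.min (s - `|p 0 0|) (s - `|p 0 1|)).
have t0 : 0 < t.
  by rewrite !lt_min !subr_gt0 int0 int1 !divr_gt0//; lra.
have tc0 : L * t <= c0.
  have : t <= c0 / L by rewrite !ge_min lexx.
  by rewrite ler_pdivlMr// mulrC.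
have te : C * L ^+ 3 * t < 4 * e.
  have : t <= e / (C * L ^+ 3 + 1) by rewrite !ge_min lexx !orbT.
  rewrite ler_pdivlMr; last by lra. lra.
have ts0 : t <= s - `|p 0 0| by rewrite !ge_min lexx !orbT.
have ts1 : t <= s - `|p 0 1| by rewrite !ge_min lexx !orbT.
have Kb : \sum_j nc (b' j) <= \sum_j nc (b' j) by [].
have dj j : nc ((l j)%:C * t%:C) <= L * t.
  by rewrite (le_trans (nc_lmul _ _ _))// nc_real ger0_norm// ltW.
have Lt0 : 0 <= L * t by rewrite ltW// mulr_gt0.
have := hC _ b' (fun j => (l j)%:C * t%:C) (L * t) Lt0 tc0 Kb (lexx _) dj.
have hE v d' : (forall j, d' j = (l j)%:C * v) -> texp b' d' = lsum l b (w + v).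
  move=> hd; rewrite lsum_shift; apply: eq_bigr => j _; by rewrite hd.
rewrite (hE t%:C)// (hE (- t%:C)); last by move=> j; rewrite mulrN.
rewrite (hE ('i * t%:C)); last by move=> j; rewrite mulrCA.
rewrite (hE (- ('i * t%:C))); last by move=> j; rewrite mulrN mulrCA.
rewrite -lsum_sum -/w => -[_ _ _ _].
pose sh (x y : R) : 'rV[R]_2 := \row_i (p 0 i + if i == 0 then x else y).
have sh0 x y : sh x y 0 0 = p 0 0 + x by rewrite mxE.
have sh1 x y : sh x y 0 1 = p 0 1 + y by rewrite mxE.
have shb x y : `|x| <= t -> `|y| <= t -> box s (sh x y).
  move=> xt yt i; rewrite in_itv /= -ler_norml mxE.
  apply: (le_trans (ler_normD _ _)).
  have [->|i0] := eqVneq i 0; first by lra.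
  have i1 : i = 1 by apply/val_inj; case: i i0 => -[|[|]].
  by rewrite i1; lra. 
have shE x y : u (sh x y) = - ln (nc (lsum l b (w + (x +i* y)))) +
    e * ((p 0 0 + x) ^+ 2 + (p 0 1 + y) ^+ 2).
  by rewrite /u sh0 sh1 /cplx sh0 sh1.
have nt : `|t| <= t by rewrite ger0_norm// ltW.
have nt' : `|- t| <= t by rewrite normrN.
have n0 : `|0 : R| <= t by rewrite normr0 ltW.
have := pmax' _ (shb t 0 nt n0); have := pmax' _ (shb (- t) 0 nt' n0).
have := pmax' _ (shb 0 t n0 nt); have := pmax' _ (shb 0 (- t) n0 nt').
rewrite !shE /u -/w.
have -> : 0 +i* t = 'i * t%:C by rewrite /= ; apply: nc_ext => /=; ring.
have -> : 0 +i* - t = - ('i * t%:C) by apply: nc_ext => /=; ring.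
have -> : - t +i* 0 = - t%:C by apply: nc_ext => /=; ring.
have -> : t +i* 0 = t%:C by [].
move=> h1 h2 h3 h4; rewrite ler_norml => /andP[_ h5].
(* The quadratic terms of the four neighbours exceed four times that of the centre by 4 e t^2;
   maximality bounds this excess by the four-point error, which [te] makes smaller. *)
have : 4 * (e * t ^+ 2) <= C * (L * t) ^+ 3 by lra.
rewrite leNgt; apply/negP; rewrite negbK.
rewrite (_ : C * (L * t) ^+ 3 = C * L ^+ 3 * t * t ^+ 2); last by ring.
by rewrite mulrA ltr_pM2r ?exprn_gt0.
Qed.

(** If the perturbed sum had no zero in the disc, [lsum_min_modulus] would carry its boundary bound
    3m/4 to the centre, where the modulus is at most m/4. The annulus s <= |w| <= 2s contains the
    boundary of the square of half-side s; the square must fit in the disc, so [lsum_annulus] is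
    applied with r / 2. *)
Lemma hurwitz N (l : 'I_N -> R) (b : 'I_N -> R[i]) j0 (r : R) : injective l ->
  b j0 != 0 -> \sum_j b j = 0 -> 0 < r -> exists2 e : R, 0 < e &
  forall b', (forall j, nc (b' j - b j) < e) ->
    exists2 w, nc w < r & lsum l b' w = 0.
Proof.
move=> linj bj0 b0 r0.
have r20 : 0 < r / 2 by rewrite divr_gt0.
have [s [m [/andP[s0 sr] m0 hm]]] := lsum_annulus linj bj0 r20.
pose X := expR (lbound l * (2 * s)).
have X0 : 0 < X by exact: expR_gt0.
have n0 : 0 < N.+1%:R * X * 4 by rewrite !mulr_gt0.
(* X bounds every exponential on |w| <= 2s, so the N terms together change by at most m / 4
   there. *)
exists (m / (N.+1%:R * X * 4)); first by rewrite divr_gt0.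
move=> b' bb'; apply: contrapT => /forall2NP hno.
have close w : nc w <= 2 * s -> nc (lsum l b' w - lsum l b w) <= m / 4.
  move=> ws; rewrite -sumrB (le_trans (nc_sum _ _ _))//.
  apply: (@le_trans _ _ (\sum_(j < N) m / (N.+1%:R * X * 4) * X)).
    apply: ler_sum => j _; rewrite -mulrBl ncM ler_pM ?nc_ge0// ?(ltW (bb' _))//.
    rewrite (le_trans (nc_cexp_le _))// ler_expR (le_trans (nc_lmul _ _ _))//.
    by rewrite ler_wpM2l// (le_trans _ (lbound_ge1 l)).
  rewrite sumr_const card_ord -[leLHS]mulr_natl.
  have -> : N%:R * (m / (N.+1%:R * X * 4) * X) = m / 4 * (N%:R / N.+1%:R).
    have fa (n n1 x y : R) : 0 < n1 -> 0 < x -> n * (y / (n1 * x * 4) * x) = y / 4 * (n / n1).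
      by move=> n10 x0; field; rewrite !gt_eqF.
    exact: fa.
  by apply: ler_piMr; [lra|rewrite ler_pdivrMr// mul1r ler_nat].
have m40 : 0 < 3 * m / 4 by lra.
have : 3 * m / 4 <= nc (lsum l b' 0).
  apply: (lsum_min_modulus s0 m40).
    move=> p /boxP[_ _ h]; apply/negP => /eqP hz.
    have [hn|//] := hno (cplx p); apply: hn; lra.
  move=> p bp hp; have [_ _ h] := boxP bp.
  have sp : s <= nc (cplx p).
    by case: hp => <-; [exact: (Re_le_nc (cplx p))|exact: (Im_le_nc (cplx p))].
  have := hm (cplx p); rewrite sp h => /(_ isT).
  have := close _ h; have := nc_dist (lsum l b' (cplx p)) (lsum l b (cplx p)).
  rewrite ler_norml; lra.
have s20 : 0 <= 2 * s by lra.
have := close 0; rewrite !lsum0 b0 subr0 nc0 => /(_ s20).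
lra.
Qed.

End Hurwitz.

(** * Kronecker's theorem *)

Section Cis.
Variable R : realType.
Implicit Types (s t : R).

Definition cis t : R[i] := cos t +i* sin t.

Lemma cisE t : cis t = cexp (0 +i* t).
Proof. by rewrite /cexp /= expR0 !mul1r. Qed.

Lemma cis0 : cis 0 = 1.
Proof. by rewrite /cis cos0 sin0. Qed.

Lemma cisD s t : cis (s + t) = cis s * cis t.
Proof. by rewrite /cis cosD sinD; apply: nc_ext => /=; ring. Qed.

Lemma nc_cis t : nc (cis t) = 1.
Proof. by rewrite cisE nc_cexp /= expR0. Qed.

Lemma cispi : cis pi = -1.
Proof. by rewrite /cis cospi sinpi; apply: nc_ext; rewrite /= ?oppr0. Qed.

Lemma cexp_split (x y : R) : cexp (x +i* y) = (expR x)%:C * cis y.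
Proof. by apply: nc_ext; rewrite /= ?mul0r ?subr0 ?addr0. Qed.

End Cis.

Section PairingTheory.
Variables (K : pzRingType) (d : nat).
Implicit Types (x y : 'rV[K]_d) (a b : 'cV[K]_d).

Lemma pairingDl x y a : pairing (x + y) a = pairing x a + pairing y a.
Proof. by rewrite /pairing mulmxDl mxE. Qed.

Lemma pairingDr x a b : pairing x (a + b) = pairing x a + pairing x b.
Proof. by rewrite /pairing mulmxDr mxE. Qed.

Lemma pairingNl x a : pairing (- x) a = - pairing x a.
Proof. by rewrite /pairing mulNmx mxE. Qed.

Lemma pairingNr x a : pairing x (- a) = - pairing x a.
Proof. by rewrite /pairing mulmxN mxE. Qed.

Lemma pairing0l a : pairing 0 a = 0.
Proof. by rewrite /pairing mul0mx mxE. Qed.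

Lemma pairing0r x : pairing x 0 = 0.
Proof. by rewrite /pairing mulmx0 mxE. Qed.

Lemma pairingZl (k : K) x a : pairing (k *: x) a = k * pairing x a.
Proof. by rewrite /pairing -scalemxAl mxE. Qed.

Lemma pairing_delta i a : pairing (delta_mx 0 i) a = a i 0.
Proof. by rewrite /pairing -rowE mxE. Qed.

Lemma pairingE x a : pairing x a = \sum_i x 0 i * a i 0.
Proof. by rewrite /pairing mxE. Qed.

End PairingTheory.

Section Kronecker.
Variables (R : realType) (d : nat) (V : zmodType) (phi : V -> 'cV[R]_d).
Hypothesis phi_inj : injective phi.
Hypothesis phiD : forall v w, phi (v + w) = phi v + phi w.

Local Notation e y v := (cis (pairing y (phi v))).

(* Averaging over y and a translate of y by pi along v1 - v0 kills the frequency v1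
   and keeps the coefficient of v0. *)
Lemma trig_coef_head (B : R) (s : seq V) (v0 : V) (C : V -> R[i]) : v0 \notin s ->
  (forall y, nc (\sum_(v <- v0 :: s) C v * e y v) <= B) -> nc (C v0) <= B.
Proof.
elim: s C => [|v1 s IH] C.
  by move=> _ /(_ 0); rewrite big_seq1 pairing0l cis0 mulr1.
rewrite inE negb_or => /andP[v01 v0s] CB.
have [i ui] : exists i, (phi v1 - phi v0) i 0 != 0.
  apply: contrapT => /forallNP h; move/eqP: v01; apply; apply: phi_inj.
  apply/esym/eqP; rewrite -subr_eq0; apply/eqP/matrixP => i j; rewrite ord1 [RHS]mxE.
  by apply/eqP/negPn/negP; exact: h.
pose y1 : 'rV[R]_d := (pi / (phi v1 - phi v0) i 0) *: delta_mx 0 i.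
have y1E : pairing y1 (phi v1 - phi v0) = pi.
  by rewrite pairingZl pairing_delta divfK.
pose C' v := C v * ((1 + cis (pairing y1 (phi v - phi v0))) / 2).
have two : (2 : R[i]) != 0 by rewrite pnatr_eq0.
have C'0 : C' v0 = C v0.
  by rewrite /C' subrr pairing0r cis0 -[1 + 1]/(2%:R) divff// mulr1.
have C'1 : C' v1 = 0 by rewrite /C' y1E cispi subrr mul0r mulr0.
rewrite -C'0; apply: IH => // y.
have -> : \sum_(v <- v0 :: s) C' v * e y v = \sum_(v <- [:: v0, v1 & s]) C' v * e y v.
  by rewrite !big_cons C'1 mul0r add0r.
have -> : \sum_(v <- [:: v0, v1 & s]) C' v * e y v =
   ((\sum_(v <- [:: v0, v1 & s]) C v * e y v) +
    cis (- pairing y1 (phi v0)) * (\sum_(v <- [:: v0, v1 & s]) C v * e (y + y1) v)) / 2.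
  rewrite mulr_sumr -big_split /= mulr_suml; apply: eq_bigr => v _.
  rewrite /C' pairingDr pairingNr pairingDl !cisD; by field.
rewrite ncM ncV -(rmorph_nat (real_complex R)) nc_real ger0_norm// ler_pdivrMr//.
rewrite (le_trans (ncD _ _))// ncM nc_cis mul1r.
by have := CB y; have := CB (y + y1); lra.
Qed.

Lemma trig_coef_le (B : R) (s : seq V) (v0 : V) (C : V -> R[i]) : uniq s -> v0 \in s ->
  (forall y, nc (\sum_(v <- s) C v * e y v) <= B) -> nc (C v0) <= B.
Proof.
move=> us v0s CB; apply: (@trig_coef_head B (rem v0 s)).
  by rewrite mem_rem_uniq// inE eqxx.
by move=> y; rewrite -(perm_big _ (perm_to_rem v0s)).
Qed.

(** If X / B = e^t with t > 0, then (1 + p a)^(k+1) <= e^(pt) for a = min(1, t / (k+1)), and the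
    left side has higher degree in p than (p+1)^k. Taking a <= 1 gives a (p+1) <= 1 + p a. *)
Lemma poly_vs_exp (X B : R) k : 0 <= B ->
  (forall p, X ^+ p <= (p.+1%:R) ^+ k * B ^+ p) -> X <= B.
Proof.
move=> B0 h; rewrite leNgt; apply/negP => BX.
have X0 : 0 < X by exact: le_lt_trans BX.
have [Be|Bn] := eqVneq B 0.
  by have := h 1%N; rewrite !expr1 Be mulr0 leNgt X0.
have Bp : 0 < B by rewrite lt_def Bn.
pose t := ln (X / B).
have q1 : 1 < X / B by rewrite ltr_pdivlMr// mul1r.
have t0 : 0 < t by rewrite ln_gt0.
pose a := Num.min 1 (t / k.+1%:R).
have a0 : 0 < a by rewrite lt_min ltr01 divr_gt0.
have a1 : a <= 1 by rewrite ge_min lexx.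
have at' : a * k.+1%:R <= t.
  have : a <= t / k.+1%:R by rewrite ge_min lexx orbT.
  by rewrite ler_pdivlMr.
have key p : a ^+ k.+1 * p.+1%:R <= 1.
  have h1 : (X / B) ^+ p <= p.+1%:R ^+ k.
    by rewrite expr_div_n ler_pdivrMr ?exprn_gt0.
  have h2 : (a * p.+1%:R) ^+ k.+1 <= (X / B) ^+ p.
    rewrite -(@lnK _ (X / B)) ?posrE ?divr_gt0// -/t -expRM_natl.
    apply: (@le_trans _ _ (expR (p%:R * (a * k.+1%:R)))); last first.
      by rewrite ler_expR ler_wpM2l.
    have -> : p%:R * (a * k.+1%:R) = k.+1%:R * (p%:R * a) by ring.
    rewrite expRM_natl lerXn2r ?nnegrE ?expR_ge0//; first by rewrite mulr_ge0// ltW.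
    have := expR_ge1Dx (p%:R * a); rewrite -natr1 mulrDr mulr1 => /(le_trans _); apply.
    by rewrite addrC lerD// mulrC.
  have := le_trans h2 h1; rewrite exprMn [_%:R ^+ k.+1]exprS mulrA.
  by rewrite -ler_pdivlMr ?exprn_gt0// divff// gt_eqF// exprn_gt0.
have ak0 : 0 < a ^+ k.+1 by rewrite exprn_gt0.
have := truncnS_gt (a ^+ k.+1)^-1; set p := Num.truncn _.
by rewrite -[a ^- _]mulr1 ltr_pdivrMl// ltNge key.
Qed.

(* The p-th power of the left-hand side has at most (p + 1)^#|I| distinct frequencies,
   each with coefficient at most B^p; let p tend to infinity. *)
Lemma trig_char_le (I : finType) (a : I -> R[i]) (g : I -> V) (chi : character R V) (B : R) :
  (forall y, nc (\sum_i a i * e y (g i)) <= B) -> nc (\sum_i a i * chi (g i)) <= B.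
Proof.
move=> aB; have B0 : 0 <= B by rewrite (le_trans (nc_ge0 _) (aB 0)).
have chi0 : chi 0 = 1.
  have h : chi 0 * chi 0 = chi 0 by rewrite -charD addr0.
  have n0 : chi 0 != 0 by rewrite -normr_eq0 char_norm oner_eq0.
  by apply: (mulfI n0); rewrite h mulr1.
have phi0 : phi 0 = 0.
  by have := phiD 0 0; rewrite addr0 => /esym/eqP; rewrite -subr_eq0 addrK => /eqP.
have powE (w : V -> R[i]) p : w 0 = 1 -> (forall u v, w (u + v) = w u * w v) ->
    (\sum_i a i * w (g i)) ^+ p =
    \sum_(f : {ffun 'I_p -> I}) (\prod_k a (f k)) * w (\sum_k g (f k)).
  move=> w0 wD; rewrite -[p in LHS]card_ord -prodr_const bigA_distr_bigA /=.
  apply: eq_bigr => f _; rewrite big_split /=; congr (_ * _).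
  by elim/big_rec2: _ => [|k u v _ ->]; rewrite ?w0 ?wD.
apply: (@poly_vs_exp _ _ #|I|) => // p.
pose S (f : {ffun 'I_p -> I}) := \sum_k g (f k).
pose W := undup [seq S f | f : {ffun 'I_p -> I}].
have Wsize : (size W <= p.+1 ^ #|I|)%N.
  (* A frequency depends only on how often each index of I is used, a number between 0 and p. *)
  pose T := [seq \sum_i g i *+ (c i) | c : {ffun I -> 'I_p.+1}].
  have -> : (p.+1 ^ #|I|)%N = size T by rewrite size_map -cardE card_ffun card_ord.
  apply: uniq_leq_size; first exact: undup_uniq.
  move=> v; rewrite mem_undup => /mapP[f _ ->].
  have hc (i : I) : (#|[pred k | f k == i]| < p.+1)%N.
    by rewrite ltnS -[X in (_ <= X)%N]card_ord max_card.
  apply/mapP; exists [ffun i => Ordinal (hc i)]; first by rewrite mem_enum.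
  rewrite /S (partition_big f xpredT)//=; apply: eq_bigr => i _.
  by rewrite ffunE /= -sumr_const; apply: eq_big => [k|k /eqP ->].
pose C v := \sum_(f | S f == v) \prod_k a (f k).
have SE (w : V -> R[i]) : \sum_(f : {ffun 'I_p -> I}) (\prod_k a (f k)) * w (S f) =
    \sum_(v <- W) C v * w v.
  rewrite /C; under [RHS]eq_bigr do rewrite mulr_suml.
  rewrite (exchange_big_dep xpredT)//=; apply: eq_bigr => f _.
  have fW : S f \in W by rewrite mem_undup; apply: map_f; rewrite mem_enum.
  rewrite [RHS]big_mkcond (bigD1_seq (S f)) ?undup_uniq//=.
  by rewrite eqxx [X in _ + X]big1 ?addr0// => v; rewrite eq_sym => /negPf ->.
rewrite -ncX powE//; last exact: charD.
rewrite SE (le_trans (nc_sum _ _ _))//.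
have CB v : v \in W -> nc (C v * chi v) <= B ^+ p.
  move=> vW; rewrite ncM (nc_norm (char_norm chi v)) mulr1.
  apply: (trig_coef_le _ vW); first exact: undup_uniq.
  move=> y; rewrite -(SE (fun v => e y v)) -(powE (fun v => e y v));
    first by rewrite ncX lerXn2r ?nnegrE ?nc_ge0.
    by rewrite phi0 pairing0r cis0.
  by move=> u w; rewrite phiD pairingDr cisD.
apply: (@le_trans _ _ (\sum_(v <- W) B ^+ p));
  first by rewrite [leLHS]big_seq [leRHS]big_seq; apply: ler_sum => v; exact: CB.
rewrite big_const_seq count_predT iter_addr addr0 -[leLHS]mulr_natl -natrX.
by rewrite ler_wpM2r ?exprn_ge0// ler_nat.
Qed.

(** By the parallelogram law |1 + w|^2 = 4 - |w - 1|^2 <= 4 - eps^2 <= (2 - eps^2 / 4)^2. *)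
Lemma nc1D_unit (w : R[i]) (eps : R) : nc w = 1 -> 0 <= eps -> eps <= nc (w - 1) ->
  nc (1 + w) <= 2 - eps ^+ 2 / 4.
Proof.
move=> w1 e0 we.
have e2 : eps <= 2 by have := ncB w 1; rewrite nc1 w1; lra.
have sq (z : R[i]) : nc z ^+ 2 = complex.Re z ^+ 2 + complex.Im z ^+ 2.
  by case: z => x y /=; rewrite sqr_sqrtr// addr_ge0 ?sqr_ge0.
have h1 := sq w; rewrite w1 in h1.
have h2 := sq (w - 1); have h3 := sq (1 + w).
rewrite ReD ImD ReN ImN /= in h2; rewrite ReD ImD /= in h3.
have h4 : eps ^+ 2 <= nc (w - 1) ^+ 2 by rewrite lerXn2r ?nnegrE ?nc_ge0.
have e4 : eps ^+ 2 <= 2 ^+ 2 by rewrite lerXn2r ?nnegrE.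
have B0 : 0 <= 2 - eps ^+ 2 / 4 by lra.
rewrite -(@ler_pXn2r _ 2) ?nnegrE ?nc_ge0//.
have : 0 <= (eps ^+ 2) ^+ 2 by rewrite exprn_ge0 ?exprn_ge0.
move: h1 h2 h3 h4; rewrite !expr2; move: (complex.Re w) (complex.Im w) => x y.
set n1 := nc (w - 1); set n2 := nc (1 + w); move=> h1 h2 h3 h4 h5.
have -> : n2 * n2 = 2 + 2 * x by rewrite h3; lra.
have : n1 * n1 = 2 - 2 * x by rewrite h2; lra.
lra.
Qed.

(* Apply the bound to 1 + sum_j chi(g_j)^-1 e(g_j), which equals N + 1 at chi and stays
   away from N + 1 when every e_y is far from chi at some g_j. *)
Lemma kronecker N (g : 'I_N -> V) (chi : character R V) (eps : R) : 0 < eps ->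
  exists y, forall j, nc (chi (g j) - e y (g j)) < eps.
Proof.
move=> e0; apply: contrapT => /forallNP h.
have far y : exists j, eps <= nc (chi (g j) - e y (g j)).
  apply: contrapT => /forallNP h'; apply: (h y) => j; rewrite ltNge; apply/negP.
  exact: h'.
pose g' (o : option 'I_N) := if o is Some j then g j else 0.
pose a (o : option 'I_N) := if o is Some j then (chi (g j))^-1 else 1.
have nchi v : nc (chi v) = 1 by rewrite (nc_norm (char_norm chi v)).
have chin0 v : chi v != 0 by rewrite -nc_gt0 nchi.
have bigo (F : option 'I_N -> R[i]) : \sum_o F o = F None + \sum_j F (Some j).
  by rewrite (bigD1 None)//=; congr (_ + _); rewrite (reindex_omap Some id) => [|[]//];
    apply: eq_bigl => j; rewrite eqxx.
pose B := N%:R + 1 - eps ^+ 2 / 4.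
have : nc (\sum_o a o * chi (g' o)) <= B.
  apply: trig_char_le => y; have [j0 hj0] := far y.
  rewrite bigo /= (bigD1 j0)//= mul1r addrA.
  have phi0 : phi 0 = 0.
    by have := phiD 0 0; rewrite addr0 => /esym/eqP; rewrite -subr_eq0 addrK => /eqP.
  rewrite phi0 pairing0r cis0 (le_trans (ncD _ _))//.
  have hw j : nc ((chi (g j))^-1 * e y (g j)) = 1.
    by rewrite ncM ncV nchi invr1 nc_cis mul1r.
  have h1 : nc (1 + (chi (g j0))^-1 * e y (g j0)) <= 2 - eps ^+ 2 / 4.
    apply: nc1D_unit; [exact: hw|exact: ltW|].
    rewrite (le_trans hj0)// nc_distC -[leLHS]mul1r -invr1 -(nchi (g j0)) -ncV -ncM.
    by rewrite mulrBr mulVf// le_refl.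
  have h2 : nc (\sum_(j < N | j != j0) (chi (g j))^-1 * e y (g j)) <= N%:R - 1.
    rewrite (le_trans (nc_sum _ _ _))// (eq_bigr (fun=> 1)) => [|j _]; last exact: hw.
    have : \sum_(j < N) (1 : R) = N%:R by rewrite sumr_const card_ord.
    by rewrite (bigD1 j0)//= => <-; rewrite addrAC subrr add0r.
  rewrite /B; lra.
have -> : \sum_o a o * chi (g' o) = (N%:R + 1)%:C.
  have chi0 : chi 0 = 1.
    have hh : chi 0 * chi 0 = chi 0 by rewrite -charD addr0.
    by apply: (mulfI (chin0 0)); rewrite hh mulr1.
  rewrite bigo /= mul1r chi0 (eq_bigr (fun=> 1)) => [|j _]; last by rewrite mulVf.
  by rewrite sumr_const card_ord rmorphD rmorph_nat addrC.
rewrite nc_real ger0_norm ?addr_ge0// /B.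
have : 0 < eps ^+ 2 by rewrite exprn_gt0.
lra.
Qed.

End Kronecker.

(** * Uniform lower bounds off the amoeba *)

Section Separation.
Variable R : realType.

Lemma poly_nonroot (p : {poly R}) : p != 0 -> exists t : R, p.[t] != 0.
Proof.
move=> p0; apply: contrapT => /forallNP h.
have := @max_poly_roots _ p [seq i%:R | i <- iota 0 (size p)] p0.
rewrite size_map size_iota ltnn => H; suff : false by [].
apply: H; first by apply/allP => t _; apply/negPn/negP; exact: h.
rewrite map_inj_uniq ?iota_uniq// => i j /eqP; rewrite eqr_nat => /eqP//.
Qed.

(** A point (1, t, t^2, ...) of the moment curve works: two distinct columns have equal pairings
    with it only if t is a root of a nonzero polynomial, and some t avoids the roots of the product
    of these polynomials. *)
Lemma separating_direction (d N : nat) (A : 'M[R]_(d, N)) : distinct_columns A ->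
  exists v : 'rV[R]_d, injective (fun j => pairing v (col j A)).
Proof.
move=> Ainj.
pose p (jk : 'I_N * 'I_N) : {poly R} := \sum_(i < d) (A i jk.1 - A i jk.2) *: 'X^i.
have p0 jk : jk.1 != jk.2 -> p jk != 0.
  move=> jk12; apply/eqP => h; move/eqP: jk12; apply; apply: Ainj.
  apply/matrixP => i j; rewrite !mxE; apply/eqP; rewrite -subr_eq0; apply/eqP.
  have := congr1 (fun q : {poly R} => q`_i) h; rewrite coef0 coef_sum (bigD1 i)//=.
  rewrite coefZ coefXn eqxx mulr1 big1 ?addr0// => k ki.
  by rewrite coefZ coefXn eq_sym (negbTE ki : (k == i :> nat) = false) mulr0.
have /poly_nonroot[t] : \prod_(jk | jk.1 != jk.2) p jk != 0 by apply/prodf_neq0.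
rewrite horner_prod => /prodf_neq0 ht.
exists (\row_i t ^+ i) => j k; rewrite !pairingE => /eqP e.
apply/eqP; apply: contraT => jk; have := ht (j, k) jk.
rewrite /p horner_sum; suff -> : \sum_(i < d) ((A i j - A i k) *: 'X^i).[t] = 0 by rewrite eqxx.
move: e; rewrite -subr_eq0 -sumrB => /eqP e; rewrite -[RHS]e; apply: eq_bigr => i _.
by rewrite hornerZ hornerXn !mxE; ring.
Qed.

Lemma coord_le_norm m (v : 'rV[R]_m) i : `|v 0 i| <= `|v|.
Proof.
rewrite [leRHS]/Num.norm /= mx_normrE.
exact: (le_bigmax _ (fun ij : 'I_1 * 'I_m => `|v ij.1 ij.2|) (0, i)).
Qed.

Definition mxbound (d N : nat) (A : 'M[R]_(d, N)) := 1 + \sum_i \sum_j `|A i j|.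

Lemma mxbound_ge1 (d N : nat) (A : 'M[R]_(d, N)) : 1 <= mxbound A.
Proof. by rewrite lerDl; apply: sumr_ge0 => i _; apply: sumr_ge0. Qed.

Lemma pairing_le (d N : nat) (A : 'M[R]_(d, N)) (v : 'rV[R]_d) j :
  `|pairing v (col j A)| <= mxbound A * `|v|.
Proof.
rewrite pairingE (le_trans (ler_norm_sum _ _ _))// /mxbound mulrDl mul1r mulr_suml.
rewrite (le_trans _ (_ : \sum_i (\sum_j `|A i j|) * `|v| <= _)) ?lerDr//.
apply: ler_sum => i _; rewrite normrM mulrC ler_pM ?coord_le_norm//.
by rewrite mxE (bigD1 j)//= lerDl sumr_ge0.
Qed.

Lemma lipschitz_continuous m (f : 'rV[R]_m -> R) (L : R) : 0 <= L ->
  (forall (p q : 'rV[R]_m) (e : R), 0 < e -> (forall i, `|p 0 i - q 0 i| < e) -> `|f p - f q| <= L * e) ->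
  continuous f.
Proof.
move=> L0 h p; apply/(@cvgrPdist_lt _ _ _ (nbhs p)) => e e0.
have L1 : 0 < L + 1 by lra.
have t0 : 0 < e / (L + 1) by rewrite divr_gt0.
apply: (filterS _ (@nbhsx_ballx R 'rV[R]_m p _ t0)) => q [_ pq].
apply: (le_lt_trans (h _ _ _ t0 _)); first by move=> i; exact: pq.
by rewrite mulrA ltr_pdivrMr// mulrC mulrDr mulr1 ltrDl.
Qed.

Lemma closure_coord m (S : set 'rV[R]_m) p : closure S p -> forall e, 0 < e ->
  exists2 q, S q & forall i, `|p 0 i - q 0 i| < e.
Proof.
move=> h e e0; have [q [Sq [_ pq]]] := h _ (@nbhsx_ballx R 'rV[R]_m p _ e0).
by exists q => // i; exact: pq.
Qed.

End Separation.

Section Tube.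
Variables (R : realType) (n N : nat) (A : 'M[R]_(n.+1, N)).
Implicit Types (c : 'I_N -> R[i]) (x y v : 'rV[R]_n.+1).

Lemma zspan_val_inj : injective (@zspan_val R n.+1 N A).
Proof. exact: val_inj. Qed.

Lemma zspan_valD (v w : zspan_group A) : zspan_val (v + w) = zspan_val v + zspan_val w.
Proof. exact: (raddfD (val : zspan_group A -> 'cV[R]_n.+1)). Qed.

(** Twisting by this character is the translation by the imaginary vector i y ([expsum_cvec]). *)
Definition flow y : character R (zspan_group A).
Proof.
exists (fun v : zspan_group A => cis (pairing y (zspan_val v))) => [v|v w].
- by rewrite normE nc_cis.
- by rewrite zspan_valD pairingDr cisD.
Defined.

Lemma nc_char (chi : character R (zspan_group A)) (v : zspan_group A) : nc (chi v) = 1.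
Proof. by rewrite (nc_norm (char_norm chi v)). Qed.

Lemma pairing_complex (z : 'rV[R[i]]_n.+1) (a : 'cV[R]_n.+1) :
  pairing z (map_mx (fun r : R => r%:C) a) =
  pairing (map_mx (@complex.Re R) z) a +i* pairing (map_mx (@complex.Im R) z) a.
Proof.
rewrite !pairingE; apply: nc_ext => /=.
  by rewrite Re_sum; apply: eq_bigr => i _; rewrite !mxE ReM /= mulr0 subr0.
by rewrite Im_sum; apply: eq_bigr => i _; rewrite !mxE ImM /= mulr0 add0r.
Qed.

Lemma expsum_flow c z :
  expsum A c z = twist c (flow (map_mx (@complex.Im R) z)) (map_mx (@complex.Re R) z).
Proof.
apply: eq_bigr => j _; rewrite pairing_complex cexp_split /=.
by rewrite -mulrA [_%:C * _]mulrC.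
Qed.

Definition cvec x y : 'rV[R[i]]_n.+1 := \row_i (x 0 i +i* y 0 i).

Lemma expsum_cvec c x y : expsum A c (cvec x y) = twist c (flow y) x.
Proof.
rewrite expsum_flow; congr (twist c (flow _) _).
  by apply/rowP => i; rewrite !mxE.
by apply/rowP => i; rewrite !mxE.
Qed.

Definition weight c (chi : character R (zspan_group A)) x (j : 'I_N) : R[i] :=
  c j * chi (zspan_gen A j) * (expR (pairing x (col j A)))%:C.

Definition weight_bound c x := \sum_j nc (c j) * expR (pairing x (col j A)).

(** The total modulus does not depend on chi, which makes the estimates from [texp] uniform over the
    dual group. *)
Lemma sum_weight c chi x : \sum_j nc (weight c chi x j) = weight_bound c x.
Proof.
apply: eq_bigr => j _.
by rewrite !ncM nc_char mulr1 nc_real ger0_norm ?expR_ge0.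
Qed.

Lemma weight_bound_ge0 c x : 0 <= weight_bound c x.
Proof. by apply: sumr_ge0 => j _; rewrite mulr_ge0 ?nc_ge0 ?expR_ge0. Qed.

Lemma twist_shift c chi x v :
  twist c chi (x + v) = texp (weight c chi x) (fun j => (pairing v (col j A))%:C).
Proof.
apply: eq_bigr => j _.
by rewrite pairingDl expRD rmorphM /= cexp_real mulrA.
Qed.

Lemma twist_near c x (e : R) : 0 < e -> exists2 t : R, 0 < t &
  forall v, `|v| < t -> forall chi : character R (zspan_group A),
    nc (twist c chi (x + v) - twist c chi x) <= e.
Proof.
move=> e0; have [D D0 hD] := texp_near (weight_bound_ge0 c x).
have M1 := mxbound_ge1 A; set M := mxbound A in M1.
have M0 : 0 < M by lra.
have D1 : 0 < D + 1 by lra.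
exists (Num.min 1 (e / (D + 1)) / M).
  by rewrite divr_gt0// lt_min ltr01 divr_gt0.
move=> v; rewrite ltr_pdivlMr// lt_min => /andP[v1 ve] chi.
have v0 : 0 <= `|v| * M by rewrite mulr_ge0// ltW.
have h := hD _ (weight c chi x) (fun j => (pairing v (col j A))%:C) _ v0 (ltW v1).
rewrite twist_shift (le_trans (h _ _))//.
- by rewrite sum_weight.
- by move=> j; rewrite nc_real mulrC pairing_le.
apply: (@le_trans _ _ (D * (e / (D + 1)))); first by rewrite ler_wpM2l// ltW.
by rewrite mulrA ler_pdivrMr// mulrC ler_wpM2l ?ltW//; lra.
Qed.

Definition bounded_below c x (m : R) := forall chi : character R (zspan_group A),
  m <= nc (twist c chi x).

Lemma bounded_below_near c x m : 0 < m -> bounded_below c x m -> exists2 t : R, 0 < t &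
  forall v, `|v| < t -> bounded_below c (x + v) (m / 2).
Proof.
move=> m0 hm; have m20 : 0 < m / 2 by lra.
have [t t0 ht] := twist_near c x m20; exists t => // v vt chi.
have := ht _ vt chi; have := hm chi.
have := nc_dist (twist c chi (x + v)) (twist c chi x); rewrite ler_norml; lra.
Qed.

(** The amoeba is a closure, so its points are only close to real parts of zeros; the bound is first
    carried to a neighbourhood of x. *)
Lemma bounded_below_notin_amoeba c x m : 0 < m -> bounded_below c x m ->
  (~` amoeba (expsum A c)) x.
Proof.
move=> m0 hm hx; have [t t0 ht] := bounded_below_near m0 hm.
have [q [z hz <-] pq] := closure_coord hx (divr_gt0 t0 (ltr0Sn R 1)).
have hv : `|map_mx (@complex.Re R) z - x| < t.
  apply: (@le_lt_trans _ _ (t / 2)); last by lra.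
  rewrite [leLHS]/Num.norm /= mx_normrE; apply: bigmax_le; first by lra.
  by move=> [i j] _; rewrite !mxE /= ord1 distrC ltW//; have := pq j; rewrite mxE.
have := ht _ hv (flow (map_mx (@complex.Im R) z)).
rewrite addrC subrK -expsum_flow (hz : expsum A c z = 0) nc0; lra.
Qed.

Lemma kronecker_flow (chi : character R (zspan_group A)) (e : R) : 0 < e ->
  exists y, forall j, nc (chi (zspan_gen A j) - flow y (zspan_gen A j)) < e.
Proof.
move=> e0; exact: (kronecker zspan_val_inj zspan_valD (zspan_gen A) chi e0).
Qed.

Lemma twist_char_near c x (e : R) : 0 < e -> exists2 t : R, 0 < t &
  forall chi psi : character R (zspan_group A),
    (forall j, nc (chi (zspan_gen A j) - psi (zspan_gen A j)) < t) ->
  nc (twist c chi x - twist c psi x) <= e.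
Proof.
move=> e0; have K0 := weight_bound_ge0 c x; set K := weight_bound c x in K0.
have K1 : 0 < K + 1 by lra.
exists (e / (K + 1)); first by rewrite divr_gt0.
move=> chi psi h; rewrite -sumrB (le_trans (nc_sum _ _ _))//.
apply: (@le_trans _ _ (K * (e / (K + 1)))); last first.
  by rewrite mulrA ler_pdivrMr// mulrC ler_wpM2l ?ltW//; lra.
rewrite /K /weight_bound mulr_suml; apply: ler_sum => j _.
rewrite -mulrBl -mulrBr !ncM nc_real [X in _ * X <= _]ger0_norm ?expR_ge0//.
by rewrite mulrAC ler_wpM2l ?mulr_ge0 ?nc_ge0 ?expR_ge0// ltW.
Qed.

Section TorusClosure.
Variables (c : 'I_N -> R[i]) (x : 'rV[R]_n.+1).

Definition tcoord (p : 'rV[R]_(N + N)) (j : 'I_N) : R[i] :=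
  p 0 (lshift N j) +i* p 0 (rshift N j).

(** The orbit of the flow in the torus of generator values, with the real parts listed before the
    imaginary parts. Its closure in real 2N-space supplies the compactness for which a topology on
    the dual group would otherwise be used. *)
Definition torbit : set 'rV[R]_(N + N) :=
  [set p | exists y, forall j, tcoord p j = flow y (zspan_gen A j)].

Definition tpoint y : 'rV[R]_(N + N) :=
  row_mx (\row_j complex.Re (flow y (zspan_gen A j)))
         (\row_j complex.Im (flow y (zspan_gen A j))).

Lemma tcoord_tpoint y j : tcoord (tpoint y) j = flow y (zspan_gen A j).
Proof. by rewrite /tcoord row_mxEl row_mxEr !mxE. Qed.

Lemma torbit_tpoint y : torbit (tpoint y).
Proof. by exists y => j; exact: tcoord_tpoint. Qed.

Lemma tcoord_near (p q : 'rV[R]_(N + N)) (e : R) : (forall i, `|p 0 i - q 0 i| < e) ->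
  forall j, nc (tcoord p j - tcoord q j) <= 2 * e.
Proof.
move=> h j; rewrite (le_trans (nc_le_ReIm _))// mulr_natl mulr2n /=.
by rewrite lerD// ltW// h.
Qed.

Lemma torbit_compact : compact (closure torbit).
Proof.
pose D : set 'rV[R]_(N + N) := [set p | forall i, `[-1, 1]%classic (p ord0 i)].
have cD : compact D.
  by apply: (@rV_compact R (N + N) (fun=> `[-1, 1]%classic)) => i; exact: segment_compact.
apply: (subclosed_compact (@closed_closure _ _) cD) => p hp i.
rewrite /= in_itv /= -ler_norml; apply/ler_addgt0Pr => e e0.
have [q [y qy] pq] := closure_coord hp e0.
have q1 : `|q 0 i| <= 1.
  have nq j : nc (tcoord q j) = 1 by rewrite qy nc_char.
  rewrite -(fintype.splitK i) /unsplit; case: (fintype.split i) => j; rewrite -(nq j).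
    exact: (Re_le_nc (tcoord q j)).
  exact: (Im_le_nc (tcoord q j)).
rewrite -(subrK (q 0 i) (p 0 i)) (le_trans (ler_normD _ _))// addrC lerD//.
by rewrite ltW// pq.
Qed.

Definition tvalue (p : 'rV[R]_(N + N)) : R :=
  nc (\sum_j c j * tcoord p j * (expR (pairing x (col j A)))%:C).

Lemma tvalue_continuous : continuous tvalue.
Proof.
apply: (@lipschitz_continuous _ _ _ (weight_bound c x * 2)).
  by rewrite mulr_ge0 ?weight_bound_ge0.
move=> p q e e0 h; rewrite (le_trans (nc_dist _ _))// -sumrB (le_trans (nc_sum _ _ _))//.
rewrite -mulrA mulr_suml; apply: ler_sum => j _.
rewrite -mulrBl -mulrBr !ncM nc_real [X in _ * X <= _]ger0_norm ?expR_ge0//.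
by rewrite mulrAC ler_wpM2l ?mulr_ge0 ?nc_ge0 ?expR_ge0// tcoord_near.
Qed.

Lemma bounded_below_closure (m : R) : (forall p, closure torbit p -> m <= tvalue p) ->
  bounded_below c x m.
Proof.
move=> h chi; apply/ler_addgt0Pr => e e0.
have [t t0 ht] := twist_char_near c x e0.
have [y hy] := kronecker_flow chi t0.
have := ht _ _ hy; have := h _ (subset_closure (torbit_tpoint y)).
have -> : tvalue (tpoint y) = nc (twist c (flow y) x).
  by congr nc; apply: eq_bigr => j _; rewrite tcoord_tpoint.
by have := nc_dist (twist c chi x) (twist c (flow y) x); rewrite ler_norml; lra.
Qed.

(* If the modulus vanished at a point of the compact closure of the orbit, the restriction
   of the limit to a complex line with separated exponents would have a zero, and so
   would the sums e_y.f with e_y close to the limit, at points of small real part. *)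
Lemma notin_amoeba_bounded_below : distinct_columns A ->
  (~` amoeba (expsum A c)) x -> exists2 m : R, 0 < m & bounded_below c x m.
Proof.
move=> Ainj hx.
have [r r0 hr] : exists2 r : R, 0 < r & forall v y, `|v| < r -> twist c (flow y) (x + v) != 0.
  apply: contrapT => h; apply: hx => B /nbhs_ballP[r /= r0 hB].
  apply: contrapT => h'; apply: h; exists r => // v y vr; apply/negP => /eqP z0; apply: h'.
  exists (x + v); split.
    exists (cvec (x + v) y); first by rewrite /zero_set /= expsum_cvec.
    by apply/rowP => i; rewrite !mxE.
  by apply: hB; rewrite mx_norm_ball /ball_ /= opprD addrA subrr sub0r normrN.
have [j0 cj0] : exists j0, c j0 != 0.
  apply: contrapT => /forallNP h; have := hr 0 0; rewrite normr0 => /(_ r0) /eqP; apply.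
  rewrite /twist big1// => j _; have /negP := h j.
  by rewrite negbK => /eqP ->; rewrite !mul0r.
have [v vinj] := separating_direction Ainj.
have [p Kp pmin] := @EVT_min_rV R (N + N) tvalue (closure torbit)
  (ex_intro _ _ (subset_closure (torbit_tpoint 0))) torbit_compact
  (continuous_subspaceT tvalue_continuous).
rewrite inE in Kp.
have [p0|pn0] := eqVneq (tvalue p) 0; last first.
  exists (tvalue p); first by rewrite lt_def pn0 nc_ge0.
  by apply: bounded_below_closure => q Kq; apply: pmin; rewrite inE.
exfalso; pose b j := c j * tcoord p j * (expR (pairing x (col j A)))%:C.
have b0 : \sum_j b j = 0 by apply/eqP; rewrite -nc_eq0; apply/eqP.
have bj0 : b j0 != 0.
  rewrite /b !mulf_neq0//; last by rewrite -nc_eq0 nc_real normr_eq0 gt_eqF ?expR_gt0.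
  (* With tolerance 1/4 per real coordinate, [tcoord p j0] is within 1/2 of the unit circle, hence
     nonzero. *)
  have q0 : 0 < 1 / 4 :> R by lra.
  have [q [y qy] pq] := closure_coord Kp q0.
  rewrite -nc_gt0.
  have := tcoord_near pq j0; rewrite qy; have := nc_dist (tcoord p j0) (flow y (zspan_gen A j0)).
  rewrite nc_char ler_norml; lra.
have V0 : 0 < `|v| + 1 by rewrite ltr_wpDl.
(* A parameter w of modulus below r / (|v| + 1) displaces the real part by less than r. *)
have [e e0 he] := hurwitz vinj bj0 b0 (divr_gt0 r0 V0).
have K0 := weight_bound_ge0 c x; set K := weight_bound c x in K0.
have t0 : 0 < e / (2 * (K + 1)) by rewrite divr_gt0//; lra.
have [q [y qy] pq] := closure_coord Kp t0.
have [|w wr hw] := he (weight c (flow y) x).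
  move=> j; rewrite /b /weight -mulrBl -mulrBr !ncM nc_real ger0_norm ?expR_ge0//.
  rewrite nc_distC -qy mulrAC.
  have cK : nc (c j) * expR (pairing x (col j A)) <= K.
    rewrite /K /weight_bound (bigD1 j)//= lerDl sumr_ge0// => i _.
    by rewrite mulr_ge0 ?nc_ge0 ?expR_ge0.
  apply: (@le_lt_trans _ _ (K * (2 * (e / (2 * (K + 1)))))).
    by rewrite ler_pM ?mulr_ge0 ?nc_ge0 ?expR_ge0// tcoord_near.
  have -> : K * (2 * (e / (2 * (K + 1)))) = e * (K / (K + 1)) by field; lra.
  by rewrite gtr_pMr// ltr_pdivrMr; lra.
(* The zero at w on the complex line is the zero of f at x + Re(w) v + i (y + Im(w) v). *)
have := hr (complex.Re w *: v) (y + complex.Im w *: v).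
rewrite normrZ => /(_ _)/eqP; apply.
  rewrite (@le_lt_trans _ _ (nc w * (`|v| + 1)))//; last by rewrite -ltr_pdivlMr.
  by rewrite ler_pM ?Re_le_nc// lerDl.
rewrite -hw; apply: eq_bigr => j _; rewrite /weight /=.
rewrite pairingDl pairingDl !pairingZl expRD cisD rmorphM /=.
have -> : (pairing v (col j A))%:C * w =
   (complex.Re w * pairing v (col j A)) +i* (complex.Im w * pairing v (col j A)).
  by apply: nc_ext => /=; rewrite ?ReM ?ImM /=; ring.
rewrite cexp_split; ring.
Qed.

End TorusClosure.
End Tube.

(** * Averages of truncated logarithms *)

Section Average.
Context (d : measure_display) (T : measurableType d) (R : realType).
Variable P : probability T R.
Implicit Types (f g : T -> R).

Definition bmeas f := measurable_fun setT f /\ exists M, forall w, `|f w| <= M.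

Definition avg f : R := Rintegral P setT f.

Lemma bmeas_integrable f : bmeas f -> P.-integrable setT (EFin \o f).
Proof.
move=> [mf [M fM]]; apply: measurable_bounded_integrable => //.
  by rewrite (le_lt_trans (probability_le1 _ _))// ltry.
exists M; split; first exact: num_real.
by move=> x Mx w _; rewrite /= (le_trans (fM w))// ltW.
Qed.

Lemma bmeas_cst (r : R) : bmeas (fun=> r).
Proof. by split; [exact: measurable_cst|exists `|r|]. Qed.

Lemma bmeasD f g : bmeas f -> bmeas g -> bmeas (fun w => f w + g w).
Proof.
move=> [mf [M fM]] [mg [M' gM]]; split; first exact: measurable_funD.
by exists (M + M') => w; rewrite (le_trans (ler_normD _ _))// lerD.
Qed.

Lemma bmeasB f g : bmeas f -> bmeas g -> bmeas (fun w => f w - g w).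
Proof.
move=> [mf [M fM]] [mg [M' gM]]; split; first exact: measurable_funB.
by exists (M + M') => w; rewrite (le_trans (ler_normB _ _))// lerD.
Qed.

Lemma bmeasZ (r : R) f : bmeas f -> bmeas (fun w => r * f w).
Proof.
move=> [mf [M fM]]; split; first by apply: measurable_funM => //; exact: measurable_cst.
by exists (`|r| * M) => w; rewrite normrM ler_wpM2l.
Qed.

Lemma avgD f g : bmeas f -> bmeas g -> avg (fun w => f w + g w) = avg f + avg g.
Proof. by move=> /bmeas_integrable fi /bmeas_integrable gi; rewrite /avg RintegralD. Qed.

Lemma avgB f g : bmeas f -> bmeas g -> avg (fun w => f w - g w) = avg f - avg g.
Proof. by move=> /bmeas_integrable fi /bmeas_integrable gi; rewrite /avg RintegralB. Qed.

Lemma avgZ (r : R) f : bmeas f -> avg (fun w => r * f w) = r * avg f.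
Proof. by move=> /bmeas_integrable fi; rewrite /avg RintegralZl. Qed.

Lemma avg_cst (r : R) : avg (fun=> r) = r.
Proof. rewrite /avg Rintegral_cst// [X in fine X](_ : _ = 1%E) ?mulr1//.
exact: probability_setT. Qed.

Lemma avg_le f g : bmeas f -> bmeas g -> (forall w, f w <= g w) -> avg f <= avg g.
Proof.
by move=> /bmeas_integrable fi /bmeas_integrable gi fg; apply: le_Rintegral.
Qed.

Lemma avg_norm_le f (M : R) : bmeas f -> (forall w, `|f w| <= M) -> `|avg f| <= M.
Proof.
move=> bf fM; have fM' w : - M <= f w <= M by rewrite -ler_norml.
rewrite ler_norml; apply/andP; split.
  by rewrite -(avg_cst (- M)); apply: avg_le => //; [exact: bmeas_cst|move=> w; have /andP[] := fM' w].
by rewrite -[leRHS]avg_cst; apply: avg_le => //; [exact: bmeas_cst|move=> w; have /andP[] := fM' w].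
Qed.

(** Markov's inequality: e P(B) is at most the mean of f. *)
Lemma avg_eq0_negligible f (e : R) (B : set T) : bmeas f -> (forall w, 0 <= f w) ->
  avg f = 0 -> measurable B -> 0 < e -> (forall w, B w -> e <= f w) -> P B = 0%E.
Proof.
move=> bf f0 af mB e0 Be.
have bi : bmeas (\1_B : T -> R).
  split; first exact: measurable_indic.
  by exists 1 => w; rewrite indicE; case: (w \in B); rewrite ?normr1 ?normr0.
have ai : avg (\1_B) = fine (P B) by rewrite /avg /Rintegral integral_indic// setIT.
have : avg (fun w => e * \1_B w) <= avg f.
  apply: avg_le => //; first exact: bmeasZ.
  move=> w; rewrite indicE; have [wB|] := boolP (w \in B); last by rewrite mulr0.
  by rewrite mulr1 Be// -inE.
rewrite avgZ// ai af => h.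
have PB : P B \is a fin_num by exact: fin_num_measure.
rewrite -(fineK PB); congr EFin; apply/eqP; rewrite eq_le fine_ge0// andbT.
by rewrite -(pmulr_rle0 _ e0).
Qed.

End Average.

Section ComplexMeasurable.
Context (d : measure_display) (T : measurableType d) (R : realType).
Implicit Types (u v : T -> R[i]).

Definition cmeas u := measurable_fun setT (fun w => complex.Re (u w)) /\
  measurable_fun setT (fun w => complex.Im (u w)).

Lemma cmeas_cst (z : R[i]) : cmeas (fun=> z).
Proof. by split; exact: measurable_cst. Qed.

Lemma cmeasM u v : cmeas u -> cmeas v -> cmeas (fun w => u w * v w).
Proof.
move=> [ur ui] [vr vi]; split.
  rewrite (_ : (fun _ => _) = (fun w => complex.Re (u w) * complex.Re (v w) -
      complex.Im (u w) * complex.Im (v w))); last by apply/funext => w; rewrite ReM.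
  by apply: measurable_funB; exact: measurable_funM.
rewrite (_ : (fun _ => _) = (fun w => complex.Re (u w) * complex.Im (v w) +
    complex.Im (u w) * complex.Re (v w))); last by apply/funext => w; rewrite ImM.
by apply: measurable_funD; exact: measurable_funM.
Qed.

Lemma cmeas_sum N (u : 'I_N -> T -> R[i]) : (forall j, cmeas (u j)) ->
  cmeas (fun w => \sum_j u j w).
Proof.
move=> h; split.
  rewrite (_ : (fun _ => _) = (fun w => \sum_j complex.Re (u j w))).
    by apply: measurable_sum => j; have [] := h j.
  by apply/funext => w; rewrite Re_sum.
rewrite (_ : (fun _ => _) = (fun w => \sum_j complex.Im (u j w))).
  by apply: measurable_sum => j; have [] := h j.
by apply/funext => w; rewrite Im_sum.
Qed.

Lemma cmeas_nc u : cmeas u -> measurable_fun setT (fun w => nc (u w)).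
Proof.
move=> [ur ui].
rewrite (_ : (fun _ => _) =
  Num.sqrt \o (fun w => complex.Re (u w) ^+ 2 + complex.Im (u w) ^+ 2)).
  apply: measurableT_comp; first by apply: continuous_measurable_fun; exact: sqrt_continuous.
  by apply: measurable_funD; exact: measurable_funX.
by apply/funext => w /=; case: (u w).
Qed.

Lemma lnmax_le (m K : R) (z : R[i]) : 0 < m -> nc z <= K ->
  `|lnmax m z| <= `|ln m| + `|ln (Num.max m K)|.
Proof.
move=> m0 zK; rewrite /lnmax ler_norml.
have h1 : ln m <= ln (Num.max m (nc z)) by rewrite ler_ln ?posrE ?lt_max ?m0// le_max lexx.
have h2 : ln (Num.max m (nc z)) <= ln (Num.max m K).
  by rewrite ler_ln ?posrE ?lt_max ?m0// ge_max !le_max lexx zK orbT.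
have := ler_norm (ln (Num.max m K)); have := ler_norm (- ln m); rewrite normrN.
have := normr_ge0 (ln m); have := normr_ge0 (ln (Num.max m K)).
by move=> *; apply/andP; split; lra.
Qed.

Lemma bmeas_lnmax u (m K : R) : 0 < m -> cmeas u -> (forall w, nc (u w) <= K) ->
  bmeas (fun w => lnmax m (u w)).
Proof.
move=> m0 cu uK; split.
  apply: (measurableT_comp (@measurable_ln R)).
  by apply: measurable_maxr; [exact: measurable_cst|exact: cmeas_nc].
by exists (`|ln m| + `|ln (Num.max m K)|) => w; exact: lnmax_le.
Qed.

End ComplexMeasurable.

Section DualGroup.
Context (R : realType) (V : zmodType).

Lemma cmeas_char (v : V) : cmeas (fun chi : dual_group R V => (chi : character R V) v).
Proof.
split => _ D mD; rewrite setTI; apply: sub_sigma_algebra; exists v; exists D => //.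
  by left.
by right.
Qed.

Definition translate (psi : character R V) : dual_group R V -> dual_group R V :=
  char_mul psi.

Lemma measurable_translate (psi : character R V) : measurable_fun setT (translate psi).
Proof.
apply: (@measurability _ _ (dual_group R V) (dual_group R V) setT (translate psi)
  (@char_cylinders R V) erefl).
move=> _ [_ [v [D mD [->|->]] <-]].
  have [h _] := cmeasM (cmeas_cst _ (psi v)) (cmeas_char v).
  exact: h.
have [_ h] := cmeasM (cmeas_cst _ (psi v)) (cmeas_char v).
exact: h.
Qed.

Lemma haar_avg (eta : probability (dual_group R V) R) (psi : character R V)
    (f : dual_group R V -> R) : is_haar eta -> bmeas f ->
  avg eta (fun chi => f (translate psi chi)) = avg eta f.
Proof.
move=> haar bf; rewrite /avg /Rintegral; congr fine.
have mpsi := measurable_translate psi.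
transitivity (\int[pushforward eta (translate psi)]_x (f x)%:E)%E; last first.
  by apply: eq_measure_integral => U mU _; exact: haar.
rewrite integral_pushforward//.
  by apply/measurable_EFinP; exact: bf.1.
apply: bmeas_integrable; split; first exact: measurableT_comp (bf.1) mpsi.
by have [_ [M fM]] := bf; exists M => w; exact: fM.
Qed.

End DualGroup.

(** * Mixed second differences and dyadic subdivision *)

Section Dyadic.
Variable R : realType.
Implicit Types (s t h C : R) (F : R -> R -> R).

(** The mass that F gives to a square as a distribution function: it is additive under subdivision,
    so local errors add up. *)
Definition mixdiff F s t h := F (s + h) (t + h) - F (s + h) t - F s (t + h) + F s t.

Lemma mixdiff_half F s t h : mixdiff F s t h =
  mixdiff F s t (h / 2) + mixdiff F (s + h / 2) t (h / 2) +
  mixdiff F s (t + h / 2) (h / 2) + mixdiff F (s + h / 2) (t + h / 2) (h / 2).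
Proof.
have e u : u + h / 2 + h / 2 = u + h by field.
by rewrite /mixdiff !e; ring.
Qed.

Definition in_unit_square s t h := [/\ 0 <= s, s + h <= 1, 0 <= t & t + h <= 1].

Lemma in_unit_square_half s t h : 0 < h -> in_unit_square s t h ->
  [/\ in_unit_square s t (h / 2), in_unit_square (s + h / 2) t (h / 2),
      in_unit_square s (t + h / 2) (h / 2) &
      in_unit_square (s + h / 2) (t + h / 2) (h / 2)].
Proof. by move=> h0 [s0 s1 t0 t1]; split; split; lra. Qed.

Lemma le0_geometric (x C : R) : (forall k : nat, - (C / 2 ^+ k) <= x) -> 0 <= x.
Proof.
move=> h; rewrite leNgt; apply/negP => x0.
have C0 : 0 < C by have := h 0%N; rewrite expr0 divr1; lra.
have := @upper_nthrootP R (C / - x) _ (leqnn _); set k := Num.bound _.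
rewrite ltr_pdivrMr ?oppr_gt0// => hk.
have := h k; have p0 : 0 < 2 ^+ k :> R by rewrite exprn_gt0.
by rewrite lerNl ler_pdivlMr// mulrC leNgt hk.
Qed.

(* Subdividing a square into 4^k squares of side h/2^k turns an error C h^3 per
   square into a total error C h^3 / 2^k. *)
Lemma mixdiff_ge0 F C (h0 : R) : 0 < h0 ->
  (forall s t h, in_unit_square s t h -> 0 < h -> h <= h0 ->
     - (C * h ^+ 3) <= mixdiff F s t h) ->
  0 <= mixdiff F 0 0 1.
Proof.
move=> h00 hF.
have small k s t h : in_unit_square s t h -> 0 < h -> h <= h0 ->
    - (C * h ^+ 3 / 2 ^+ k) <= mixdiff F s t h.
  elim: k s t h => [|k IH] s t h hst hp hh0.
    by rewrite expr0 divr1; exact: hF.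
  rewrite mixdiff_half.
  have -> : C * h ^+ 3 / 2 ^+ k.+1 = 4 * (C * (h / 2) ^+ 3 / 2 ^+ k).
    by rewrite [2 ^+ _]exprS; field; rewrite expf_neq0.
  have h20 : 0 < h / 2 by rewrite divr_gt0.
  have h2h : h / 2 <= h0 by rewrite (le_trans _ hh0)// ler_pdivrMr// ler_peMr ?ltW// ltr1n.
  have [a1 a2 a3 a4] := in_unit_square_half hp hst.
  move: (IH _ _ _ a1 h20 h2h) (IH _ _ _ a2 h20 h2h) (IH _ _ _ a3 h20 h2h) (IH _ _ _ a4 h20 h2h).
  clear; lra.
(* The error hypothesis is available only up to side h0; larger squares are assembled from small
   ones whose differences are already known to be nonnegative. *)
have big k s t h : in_unit_square s t h -> 0 < h -> h <= 2 ^+ k * h0 ->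
    0 <= mixdiff F s t h.
  elim: k s t h => [|k IH] s t h hst hp hh0.
    rewrite expr0 mul1r in hh0.
    by apply: (@le0_geometric _ (C * h ^+ 3)) => k; exact: small.
  rewrite mixdiff_half.
  have h2h : h / 2 <= 2 ^+ k * h0 by rewrite ler_pdivrMr// mulrC mulrA -exprS.
  have h20 : 0 < h / 2 by rewrite divr_gt0.
  have [a1 a2 a3 a4] := in_unit_square_half hp hst.
  by do 3 (apply: addr_ge0; last exact: IH); exact: IH.
have := @upper_nthrootP R (h0^-1) _ (leqnn _); set k := Num.bound _ => hk.
apply: (big k); [by split; rewrite ?add0r|exact: ltr01|].
by rewrite -ler_pdivrMr// mul1r ltW.
Qed.

Lemma mixdiff_eq0 F C (h0 : R) : 0 < h0 ->
  (forall s t h, in_unit_square s t h -> 0 < h -> h <= h0 ->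
     `|mixdiff F s t h| <= C * h ^+ 3) ->
  mixdiff F 0 0 1 = 0.
Proof.
move=> h00 hF; apply/eqP; rewrite eq_le; apply/andP; split; last first.
  apply: (@mixdiff_ge0 _ C _ h00) => s t h a1 a2 a3.
  by have := hF s t h a1 a2 a3; rewrite ler_norml => /andP[].
rewrite -oppr_ge0.
have -> : - mixdiff F 0 0 1 = mixdiff (fun s t => - F s t) 0 0 1 by rewrite /mixdiff; ring.
apply: (@mixdiff_ge0 _ C _ h00) => s t h a1 a2 a3.
have := hF s t h a1 a2 a3; rewrite ler_norml => /andP[_].
by rewrite /mixdiff; lra.
Qed.

End Dyadic.

(** * Means of truncated logarithms along real lines *)

Section MeanLog.
Context (disp : measure_display) (T : measurableType disp) (R : realType).
Variables (P : probability T R) (N : nat) (w : T -> 'I_N -> R[i]) (K : R).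
Hypothesis w_meas : forall j, cmeas (fun o => w o j).
Hypothesis w_le : forall o, \sum_j nc (w o j) <= K.
Implicit Types (z d : 'rV[R[i]]_N) (a b : 'rV[R]_N) (m : R).

(** The exponents z range over all of C^N, not only over pairings of points with the columns:
    [increment_flow] displaces them along rows y *m B that need not lie in the row span of A. *)
Definition rsum o z := texp (w o) (fun j => z 0 j).

Definition mlog m z : R := avg P (fun o => lnmax m (rsum o z)).

Definition rvec a : 'rV[R[i]]_N := \row_j (a 0 j)%:C.

Lemma K_ge0 : 0 <= K.
Proof.
have o : T := point.
by rewrite (le_trans _ (w_le o))// sumr_ge0// => j _; rewrite nc_ge0.
Qed.

Lemma shifted_weights (X : R) z : (forall j, complex.Re (z 0 j) <= X) -> forall o,
  \sum_j nc (w o j * cexp (z 0 j)) <= K * expR X.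
Proof.
move=> zX o; rewrite (le_trans _ (_ : (\sum_j nc (w o j)) * expR X <= _))//.
  rewrite mulr_suml; apply: ler_sum => j _.
  by rewrite ncM nc_cexp ler_wpM2l ?nc_ge0// ler_expR.
by rewrite ler_wpM2r ?expR_ge0.
Qed.

Lemma Re_bounded z : exists X, forall j, complex.Re (z 0 j) <= X.
Proof.
exists (\sum_j `|complex.Re (z 0 j)|) => j.
by rewrite (le_trans (ler_norm _))// (bigD1 j)//= lerDl sumr_ge0.
Qed.

Lemma rsum_bmeas m z : 0 < m -> bmeas (fun o => lnmax m (rsum o z)).
Proof.
move=> m0; have [X zX] := Re_bounded z.
apply: (@bmeas_lnmax _ _ _ _ _ (K * expR X)) => //.
  by apply: cmeas_sum => j; apply: cmeasM => //; exact: cmeas_cst.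
move=> o; rewrite (le_trans _ (shifted_weights zX o))//; exact: nc_sum.
Qed.

Lemma rsumD o z d : rsum o (z + d) = texp (fun j => w o j * cexp (z 0 j)) (fun j => d 0 j).
Proof. by apply: eq_bigr => j _; rewrite mxE cexpD mulrA. Qed.

Definition mlog4 m z d := mlog m (z + d) + mlog m (z - d) + mlog m (z + 'i *: d)
  + mlog m (z - 'i *: d) - 4 * mlog m z.

Lemma mlog_four_point (X m : R) : 0 < m -> exists C c0 : R, [/\ 0 <= C, 0 < c0 &
  forall z d c, (forall j, complex.Re (z 0 j) <= X) -> 0 <= c -> c <= c0 ->
    (forall j, nc (d 0 j) <= c) ->
    - (C * c ^+ 3) <= mlog4 m z d /\
    ((forall o, 2 * m <= nc (rsum o z)) -> mlog4 m z d <= C * c ^+ 3)].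
Proof.
move=> m0.
have KX : 0 <= K * expR X by rewrite mulr_ge0 ?expR_ge0 ?K_ge0.
have [C [c0 [C0 /andP[c00 c01] hC]]] := lnmax_four_point KX m0.
exists C, c0; split => // z d c zX c_ge0 cc0 dc.
pose b o j := w o j * cexp (z 0 j).
have bm z' := rsum_bmeas z' m0.
have e o : lnmax4 m (b o) (fun j => d 0 j) = lnmax m (rsum o (z + d))
    + lnmax m (rsum o (z - d)) + lnmax m (rsum o (z + 'i *: d))
    + lnmax m (rsum o (z - 'i *: d)) - 4 * lnmax m (rsum o z).
  have h d' (e' : 'I_N -> R[i]) : (forall j, d' 0 j = e' j) -> rsum o (z + d') = texp (b o) e'.
    by move=> de; rewrite rsumD; apply: eq_bigr => j _; rewrite de.
  rewrite (h d (fun j => d 0 j))// (h (- d) (fun j => - d 0 j)); last by move=> j; rewrite mxE.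
  rewrite (h ('i *: d) (fun j => 'i * d 0 j)); last by move=> j; rewrite mxE.
  by rewrite (h (- ('i *: d)) (fun j => - ('i * d 0 j)))// => j; rewrite !mxE.
have e' : (fun o => lnmax4 m (b o) (fun j => d 0 j)) = (fun o => lnmax m (rsum o (z + d))
    + lnmax m (rsum o (z - d)) + lnmax m (rsum o (z + 'i *: d))
    + lnmax m (rsum o (z - 'i *: d)) - 4 * lnmax m (rsum o z)).
  by apply/funext => o; exact: e.
have E : mlog4 m z d = avg P (fun o => lnmax4 m (b o) (fun j => d 0 j)).
  by rewrite e' avgB ?avgD ?avgZ//; repeat (apply: bmeasD || apply: bmeasZ).
have b4 : bmeas (fun o => lnmax4 m (b o) (fun j => d 0 j)).
  by rewrite e'; apply: bmeasB; repeat (apply: bmeasD || apply: bmeasZ).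
rewrite E; split.
  rewrite -(avg_cst P (- _)); apply: avg_le => //; first exact: bmeas_cst.
  by move=> o; have [h _] := hC _ (b o) _ _ c_ge0 cc0 (shifted_weights zX o) dc.
move=> hz; rewrite -[leRHS](avg_cst P); apply: avg_le => //; first exact: bmeas_cst.
move=> o; have [_ h] := hC _ (b o) _ _ c_ge0 cc0 (shifted_weights zX o) dc.
exact: h (hz o).
Qed.

Definition dirbound a := 1 + \sum_j `|a 0 j|.

Lemma dirbound_gt0 a : 0 < dirbound a.
Proof. by rewrite ltr_pwDl// sumr_ge0. Qed.

Lemma dirbound_ge a j : `|a 0 j| <= dirbound a.
Proof. by rewrite /dirbound (bigD1 j)//= addrCA lerDl addr_ge0// sumr_ge0. Qed.

(** For a = y *m A this is Haar invariance ([tw_flow_invariant]). *)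
Definition flow_invariant m a := forall z (t : R), mlog m (z + ('i * t%:C) *: rvec a) = mlog m z.

Lemma mlog4_real m z a (t : R) : flow_invariant m a ->
  mlog4 m z (t%:C *: rvec a) =
  mlog m (z + t%:C *: rvec a) + mlog m (z - t%:C *: rvec a) - 2 * mlog m z.
Proof.
move=> inv; rewrite /mlog4.
have e1 : z + 'i *: (t%:C *: rvec a) = z + ('i * t%:C) *: rvec a by rewrite scalerA.
have e2 : z - 'i *: (t%:C *: rvec a) = z + ('i * (- t)%:C) *: rvec a.
  by rewrite scalerA rmorphN mulrN scaleNr.
have aux (x1 x2 x3 x4 x : R) : x3 = x -> x4 = x ->
    x1 + x2 + x3 + x4 - 4 * x = x1 + x2 - 2 * x by move=> -> ->; ring.
by apply: aux; [rewrite e1; exact: inv|rewrite e2; exact: inv].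
Qed.

Definition on_line m z a (u : R) : R := mlog m (z + u%:C *: rvec a).

Lemma on_lineD m z a (u h : R) : on_line m z a (u + h) = mlog m (z + u%:C *: rvec a + h%:C *: rvec a).
Proof. by rewrite /on_line rmorphD scalerDl addrA. Qed.

(** Evaluating a function G of one variable at s + t - 1 turns a mixed difference into a second
    difference of G centred at s + t + h - 1. The unit square then covers the parameters from -1 to
    1, with centre 0. *)
Lemma on_line_mixdiff m z a (s t h : R) : flow_invariant m a ->
  mixdiff (fun s t => on_line m z a (s + t - 1)) s t h =
  mlog4 m (z + (s + t + h - 1)%:C *: rvec a) (h%:C *: rvec a).
Proof.
move=> inv; rewrite mlog4_real// -on_lineD.
have e : z + (s + t + h - 1)%:C *: rvec a - h%:C *: rvec a =
  z + (s + t + h - 1)%:C *: rvec a + (- h)%:C *: rvec a by rewrite rmorphN scaleNr.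
have aux (F1 F2 F3 F4 p q x : R) : F1 = p -> F2 = x -> F3 = x -> F4 = q ->
    F1 - F2 - F3 + F4 = p + q - 2 * x by move=> -> -> -> ->; ring.
rewrite /mixdiff; apply: aux.
- by congr on_line; ring.
- by rewrite -/(on_line m z a _); congr on_line; ring.
- by rewrite -/(on_line m z a _); congr on_line; ring.
- by rewrite e -on_lineD; congr on_line; ring.
Qed.

Lemma on_line_Re z a (t X : R) : (forall j, complex.Re (z 0 j) <= X) -> `|t| <= 1 ->
  forall j, complex.Re ((z + t%:C *: rvec a) 0 j) <= X + dirbound a.
Proof.
move=> zX t1 j; rewrite !mxE ReD ReM /= mul0r subr0 lerD//.
rewrite (le_trans (ler_norm _))// normrM (le_trans _ (dirbound_ge a j))//.
by rewrite ler_piMl.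
Qed.

Lemma nc_dir a (h : R) : 0 <= h -> forall j, nc ((h%:C *: rvec a) 0 j) <= h * dirbound a.
Proof.
by move=> h0 j; rewrite !mxE ncM !nc_real (ger0_norm h0) ler_wpM2l// dirbound_ge.
Qed.

(** Invariance cancels the two imaginary neighbours against half of the centre term, and
    [mixdiff_ge0] removes the error left by the lower four-point bound. *)
Lemma mlog_midpoint_convex m z a : 0 < m -> flow_invariant m a ->
  2 * mlog m z <= mlog m (z + rvec a) + mlog m (z - rvec a).
Proof.
move=> m0 inv; have [X zX] := Re_bounded z.
have [C [c0 [C0 c00 hC]]] := mlog_four_point (X + dirbound a) m0.
have D0 := dirbound_gt0 a.
have : 0 <= mixdiff (fun s t => on_line m z a (s + t - 1)) 0 0 1.
  apply: (@mixdiff_ge0 _ _ (C * dirbound a ^+ 3) (c0 / dirbound a)); first exact: divr_gt0.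
  move=> s t h [s0 s1 t0 t1] h0 hc; rewrite on_line_mixdiff//.
  have hD : h * dirbound a <= c0 by rewrite -ler_pdivlMr.
  have u1 : `|s + t + h - 1| <= 1 by rewrite ler_norml; apply/andP; split; lra.
  have hD0 : 0 <= h * dirbound a by rewrite ltW// mulr_gt0.
  have [h1 _] := hC _ _ _ (on_line_Re a zX u1) hD0 hD (nc_dir a (ltW h0)).
  have e : C * dirbound a ^+ 3 * h ^+ 3 = C * (h * dirbound a) ^+ 3 by ring.
  by rewrite e.
rewrite on_line_mixdiff// mlog4_real//.
have -> : z + (0 + 0 + 1 - 1)%:C *: rvec a = z by rewrite !add0r subrr scale0r addr0.
rewrite scale1r.
by move: (mlog m _) (mlog m _) (mlog m z) => x1 x2 x3; lra.
Qed.

Lemma mlog_midpoint_affine m z a : 0 < m -> flow_invariant m a ->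
  (forall (t : R) o, `|t| <= 1 -> 2 * m <= nc (rsum o (z + t%:C *: rvec a))) ->
  2 * mlog m z = mlog m (z + rvec a) + mlog m (z - rvec a).
Proof.
move=> m0 inv hz; have [X zX] := Re_bounded z.
have [C [c0 [C0 c00 hC]]] := mlog_four_point (X + dirbound a) m0.
have D0 := dirbound_gt0 a.
have : mixdiff (fun s t => on_line m z a (s + t - 1)) 0 0 1 = 0.
  apply: (@mixdiff_eq0 _ _ (C * dirbound a ^+ 3) (c0 / dirbound a)); first exact: divr_gt0.
  move=> s t h [s0 s1 t0 t1] h0 hc; rewrite on_line_mixdiff//.
  have hD : h * dirbound a <= c0 by rewrite -ler_pdivlMr.
  have u1 : `|s + t + h - 1| <= 1 by rewrite ler_norml; apply/andP; split; lra.
  have hD0 : 0 <= h * dirbound a by rewrite ltW// mulr_gt0.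
  have [h1 h2] := hC _ _ _ (on_line_Re a zX u1) hD0 hD (nc_dir a (ltW h0)).
  have h3 := h2 (fun o => hz _ o u1).
  have e : C * dirbound a ^+ 3 * h ^+ 3 = C * (h * dirbound a) ^+ 3 by ring.
  by rewrite e ler_norml h1 h3.
rewrite on_line_mixdiff// mlog4_real//.
have -> : z + (0 + 0 + 1 - 1)%:C *: rvec a = z by rewrite !add0r subrr scale0r addr0.
rewrite scale1r.
by move: (mlog m _) (mlog m _) (mlog m z) => x1 x2 x3; lra.
Qed.

End MeanLog.

Section MeanLogPlane.
Context (disp : measure_display) (T : measurableType disp) (R : realType).
Variables (P : probability T R) (N : nat) (w : T -> 'I_N -> R[i]) (K : R).
Hypothesis w_meas : forall j, cmeas (fun o => w o j).
Hypothesis w_le : forall o, \sum_j nc (w o j) <= K.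
Implicit Types (z d : 'rV[R[i]]_N) (a b : 'rV[R]_N) (m : R).

Lemma mlog_ext m z1 z2 : (forall j, z1 0 j = z2 0 j) -> mlog P w m z1 = mlog P w m z2.
Proof. by move=> e; congr (mlog _ _ _ _); apply/rowP. Qed.

Lemma mlog_inv_ext m a z1 z2 (t : R) : flow_invariant P w m a ->
  (forall j, z1 0 j = z2 0 j + 'i * t%:C * (a 0 j)%:C) -> mlog P w m z1 = mlog P w m z2.
Proof.
move=> inv e; transitivity (mlog P w m (z2 + ('i * t%:C) *: rvec a)); last exact: inv.
by apply: mlog_ext => j; rewrite e !mxE.
Qed.

Definition on_plane m z a b (s t : R) : R :=
  mlog P w m (z + s%:C *: rvec a + ('i * t%:C) *: rvec b).

(* Harmonicity in the two directions a + ib and a - ib: the invariance under i a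
   identifies the two pairs of rotated neighbours, which cancel. *)
Lemma on_plane_mixdiff m z a b (s t h : R) : flow_invariant P w m a ->
  mixdiff (on_plane m z a b) s t h =
  mlog4 P w m (z + (s + h / 2)%:C *: rvec a + ('i * (t + h / 2)%:C) *: rvec b)
          ((h / 2)%:C *: rvec a + ('i * (h / 2)%:C) *: rvec b) -
  mlog4 P w m (z + (s + h / 2)%:C *: rvec a + ('i * (t + h / 2)%:C) *: rvec b)
          ((h / 2)%:C *: rvec a - ('i * (h / 2)%:C) *: rvec b).
Proof.
move=> inv; set k := h / 2; have hk : h = k + k by rewrite /k; field.
have i2 : 'i * 'i = -1 :> R[i] by rewrite -expr2 sqr_i.
have C2 (u v : R) : (u + v)%:C = u%:C + v%:C by rewrite rmorphD.
set z' := z + _ + _; set d1 := _ + _ *: rvec b; set d2 := _ - _ *: rvec b.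
have z'E j : z' 0 j = z 0 j + (s%:C + k%:C) * (a 0 j)%:C + 'i * (t%:C + k%:C) * (b 0 j)%:C.
  by rewrite /z' !mxE !C2.
have d1E j : d1 0 j = k%:C * (a 0 j)%:C + 'i * k%:C * (b 0 j)%:C by rewrite !mxE.
have d2E j : d2 0 j = k%:C * (a 0 j)%:C - 'i * k%:C * (b 0 j)%:C by rewrite !mxE.
have pE (u v : R) j : (z + u%:C *: rvec a + ('i * v%:C) *: rvec b) 0 j =
    z 0 j + u%:C * (a 0 j)%:C + 'i * v%:C * (b 0 j)%:C by rewrite !mxE.
have mN (x y : 'rV[R[i]]_N) j : (x - y) 0 j = x 0 j - y 0 j by rewrite !mxE.
have mD (x y : 'rV[R[i]]_N) j : (x + y) 0 j = x 0 j + y 0 j by rewrite mxE.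
have mZ u (x : 'rV[R[i]]_N) j : (u *: x) 0 j = u * x 0 j by rewrite mxE.
clearbody z' d1 d2; rewrite hk.
have e1 : on_plane m z a b (s + (k + k)) (t + (k + k)) = mlog P w m (z' + d1).
  apply: mlog_ext => j; rewrite pE mD z'E d1E !C2.
  by move: (s%:C) (t%:C) (k%:C) (z 0 j) ((a 0 j)%:C) ((b 0 j)%:C) => *; ring.
have e2 : on_plane m z a b (s + (k + k)) t = mlog P w m (z' + d2).
  apply: mlog_ext => j; rewrite pE mD z'E d2E !C2.
  by move: (s%:C) (t%:C) (k%:C) (z 0 j) ((a 0 j)%:C) ((b 0 j)%:C) => *; ring.
have e3 : on_plane m z a b s (t + (k + k)) = mlog P w m (z' - d2).
  apply: mlog_ext => j; rewrite pE mN z'E d2E !C2.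
  by move: (s%:C) (t%:C) (k%:C) (z 0 j) ((a 0 j)%:C) ((b 0 j)%:C) => *; ring.
have e4 : on_plane m z a b s t = mlog P w m (z' - d1).
  apply: mlog_ext => j; rewrite pE mN z'E d1E.
  by move: (s%:C) (t%:C) (k%:C) (z 0 j) ((a 0 j)%:C) ((b 0 j)%:C) => *; ring.
have f1 : mlog P w m (z' + 'i *: d1) = mlog P w m (z' - 'i *: d2).
  apply: (mlog_inv_ext (t := k + k) inv) => j; rewrite mD mN !mZ d1E d2E C2.
  by move: (k%:C) (z' 0 j) ((a 0 j)%:C) ((b 0 j)%:C) => *; ring: i2.
have f2 : mlog P w m (z' - 'i *: d1) = mlog P w m (z' + 'i *: d2).
  apply/esym/(mlog_inv_ext (t := k + k) inv) => j; rewrite mD mN !mZ d1E d2E C2.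
  by move: (k%:C) (z' 0 j) ((a 0 j)%:C) ((b 0 j)%:C) => *; ring: i2.
have aux (F1 F2 F3 F4 p1 m1 r1 s1 p2 m2 r2 s2 x : R) :
    F1 = p1 -> F2 = p2 -> F3 = m2 -> F4 = m1 -> r1 = s2 -> s1 = r2 ->
    F1 - F2 - F3 + F4 = p1 + m1 + r1 + s1 - 4 * x - (p2 + m2 + r2 + s2 - 4 * x).
  by move=> -> -> -> -> -> ->; ring.
rewrite /mixdiff /mlog4.
exact (aux _ _ _ _ _ _ _ _ _ _ _ _ (mlog P w m z') e1 e2 e3 e4 f1 f2).
Qed.

(** Under the uniform lower bound both four-point sums of [on_plane_mixdiff] are O(h^3), so the
    mixed difference over the unit square is 0. Invariance is assumed along a but not along b:
    displacing by i b may change the mean, but not its increment along a. *)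
Lemma mlog_plane_affine m z a b : 0 < m -> flow_invariant P w m a ->
  (forall (s t : R) o, 0 <= s <= 1 ->
     2 * m <= nc (rsum w o (z + s%:C *: rvec a + ('i * t%:C) *: rvec b))) ->
  mlog P w m (z + rvec a + 'i *: rvec b) - mlog P w m (z + 'i *: rvec b) =
  mlog P w m (z + rvec a) - mlog P w m z.
Proof.
have aux0 (x1 x2 u v : R) : - u <= x1 -> x1 <= u -> - u <= x2 -> x2 <= u -> u <= v ->
    `|x1 - x2| <= 2 * v by rewrite ler_norml; lra.
move=> m0 inv hz; have [X zX] := Re_bounded z.
have [C [c0 [C0 c00 hC]]] := mlog_four_point P w_meas w_le (X + dirbound a) m0.
pose D := dirbound a + dirbound b.
have D0 : 0 < D by rewrite addr_gt0 ?dirbound_gt0.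
have mN (x y : 'rV[R[i]]_N) j : (x - y) 0 j = x 0 j - y 0 j by rewrite !mxE.
have mD (x y : 'rV[R[i]]_N) j : (x + y) 0 j = x 0 j + y 0 j by rewrite mxE.
have : mixdiff (on_plane m z a b) 0 0 1 = 0.
  apply: (@mixdiff_eq0 _ _ (2 * (C * D ^+ 3)) (c0 / D)); first exact: divr_gt0.
  move=> s t h [s0 s1 t0 t1] h0 hc; rewrite on_plane_mixdiff//.
  set k := h / 2; have k0 : 0 <= k by rewrite /k; lra.
  have kh : k <= h by rewrite /k; lra.
  set z' := z + _ + _.
  have hD : h * D <= c0 by rewrite -ler_pdivlMr.
  have kD : k * D <= c0 by rewrite (le_trans _ hD)// ler_wpM2r// ltW.
  have kD0 : 0 <= k * D by rewrite mulr_ge0// ltW.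
  have u1 : `|s + k| <= 1 by rewrite ler_norml; apply/andP; split; rewrite /k; lra.
  have u2 : 0 <= s + k <= 1 by apply/andP; split; rewrite /k; lra.
  have z'X j : complex.Re (z' 0 j) <= X + dirbound a.
    have -> : z' 0 j = (z + (s + k)%:C *: rvec a) 0 j + (('i * (t + k)%:C) *: rvec b) 0 j.
      exact: mD.
    rewrite ReD.
    rewrite (_ : complex.Re ((('i * (t + k)%:C) *: rvec b) 0 j) = 0) ?addr0.
      exact: (on_line_Re a zX u1 j).
    by rewrite !mxE !ReM !ImM /=; ring.
  have ha j := nc_dir a k0 j.
  have hb j : nc ((('i * k%:C) *: rvec b) 0 j) <= k * dirbound b.
    by rewrite -scalerA mxE ncM nc_i mul1r; exact: nc_dir.
  have d1 j : nc ((k%:C *: rvec a + ('i * k%:C) *: rvec b) 0 j) <= k * D.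
    by rewrite mD (le_trans (ncD _ _))// mulrDr lerD.
  have d2 j : nc ((k%:C *: rvec a - ('i * k%:C) *: rvec b) 0 j) <= k * D.
    by rewrite mN (le_trans (ncB _ _))// mulrDr lerD.
  have hz' o : 2 * m <= nc (rsum w o z') by exact: hz.
  have [p1 p2] := hC _ _ _ z'X kD0 kD d1.
  have [q1 q2] := hC _ _ _ z'X kD0 kD d2.
  have p3 := p2 hz'; have q3 := q2 hz'.
  have e : 2 * (C * D ^+ 3) * h ^+ 3 = 2 * (C * (h * D) ^+ 3) by ring.
  have le3 : C * (k * D) ^+ 3 <= C * (h * D) ^+ 3.
    rewrite ler_wpM2l// lerXn2r ?nnegrE//; first by rewrite mulr_ge0 ?ltW.
    by rewrite ler_wpM2r// ltW.
  rewrite e; exact (aux0 _ _ _ _ p1 p3 q1 q3 le3).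
have aux (F1 F2 F3 F4 x1 x2 x3 x4 : R) : F1 - F2 - F3 + F4 = 0 ->
    F1 = x1 -> F2 = x3 -> F3 = x2 -> F4 = x4 -> x1 - x2 = x3 - x4.
  by move=> + e1 e2 e3 e4; rewrite e1 e2 e3 e4; lra.
have Cz : (0 : R)%:C = 0 :> R[i] by [].
have Co : (1 : R)%:C = 1 :> R[i] by [].
have pE (u v : R) j : (z + u%:C *: rvec a + ('i * v%:C) *: rvec b) 0 j =
    z 0 j + u%:C * (a 0 j)%:C + 'i * v%:C * (b 0 j)%:C by rewrite !mxE.
have ia j : (rvec a) 0 j = (a 0 j)%:C by rewrite mxE.
have ib j : ('i *: rvec b) 0 j = 'i * (b 0 j)%:C by rewrite !mxE.
have e01 : (0 : R) + 1 = 1 := add0r 1.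
have r1 j : (z + rvec a + 'i *: rvec b) 0 j = z 0 j + (a 0 j)%:C + 'i * (b 0 j)%:C.
  by rewrite !mxE.
have r3 j : (z + 'i *: rvec b) 0 j = z 0 j + 'i * (b 0 j)%:C by rewrite !mxE.
have g1 : on_plane m z a b (0 + 1) (0 + 1) = mlog P w m (z + rvec a + 'i *: rvec b).
  rewrite e01; apply: mlog_ext => j.
  apply: (etrans (pE 1 1 j)); apply: (etrans _ (esym (r1 j))).
  by move: ('i : R[i]) ((a 0 j)%:C) ((b 0 j)%:C) => i u v; rewrite Co mul1r mulr1.
have g2 : on_plane m z a b (0 + 1) 0 = mlog P w m (z + rvec a).
  by rewrite e01; apply: mlog_ext => j; rewrite pE mD ia Co Cz mul1r mulr0 mul0r addr0.
have g3 : on_plane m z a b 0 (0 + 1) = mlog P w m (z + 'i *: rvec b).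
  rewrite e01; apply: mlog_ext => j.
  apply: (etrans (pE 0 1 j)); apply: (etrans _ (esym (r3 j))).
  by move: ('i : R[i]) ((a 0 j)%:C) ((b 0 j)%:C) => i u v; rewrite Cz Co mul0r mulr1 addr0.
have g4 : on_plane m z a b 0 0 = mlog P w m z.
  by apply: mlog_ext => j; rewrite pE Cz mul0r mulr0 mul0r !addr0.
move=> h; exact (aux _ _ _ _ _ _ _ _ h g1 g2 g3 g4).
Qed.

Lemma mlog_bound m z (X : R) : 0 < m -> (forall j, complex.Re (z 0 j) <= X) ->
  `|mlog P w m z| <= `|ln m| + `|ln (Num.max m (K * expR X))|.
Proof.
move=> m0 zX; apply: avg_norm_le; first exact: (rsum_bmeas w_meas w_le).
move=> o; apply: lnmax_le => //.
by rewrite (le_trans _ (shifted_weights w_le zX o))//; exact: nc_sum.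
Qed.

End MeanLogPlane.

(** * Affine functions and balls in the dual group *)

Section RealAffine.
Variable R : realType.

(* Increments of G - s t along an arithmetic progression are nondecreasing; they
   vanish near both ends, hence everywhere. *)
Lemma convex_same_slope (G : R -> R) (s e : R) : 0 < e ->
  (forall t h, 2 * G t <= G (t + h) + G (t - h)) ->
  (forall t, `|t| < e -> G t = G 0 + t * s) ->
  (forall t, `|t| < e -> G (1 + t) = G 1 + t * s) ->
  forall t, 0 <= t <= 1 -> G t = G 0 + t * s.
Proof.
move=> e0 conv h0 h1 t /andP[t0 t1].
pose H u := G u - u * s - G 0.
have Hconv u h : 2 * H u <= H (u + h) + H (u - h) by rewrite /H; have := conv u h; lra.
have H0 u : `|u| < e -> H u = 0 by move=> /h0; rewrite /H => ->; ring.
have [h [h_gt0 he]] : exists h, 0 < h /\ h < e / 2 by exists (e / 4); split; lra.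
pose k := Num.truncn (t / h); pose l := Num.truncn ((1 - t) / h).
have kt : 0 <= t / h by rewrite divr_ge0// ltW.
have lt_ : 0 <= (1 - t) / h by apply: divr_ge0; [rewrite subr_ge0|exact: ltW].
have [/andP[k1 k2] /andP[l1 l2]] := (truncn_itv kt, truncn_itv lt_).
rewrite -/k ler_pdivlMr// in k1; rewrite -/k ltr_pdivrMr// -natr1 mulrDl mul1r in k2.
rewrite -/l ler_pdivlMr// in l1; rewrite -/l ltr_pdivrMr// -natr1 mulrDl mul1r in l2.
pose q (i : nat) := H (t + (i%:R - k%:R) * h).
pose D i := q i.+1 - q i.
have Dmono i : D i <= D i.+1.
  rewrite /D /q; have := Hconv (t + (i.+1%:R - k%:R) * h) h.
  have -> : t + (i.+1%:R - k%:R) * h + h = t + (i.+2%:R - k%:R) * h.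
    by rewrite -(natr1 i.+1); ring.
  have -> : t + (i.+1%:R - k%:R) * h - h = t + (i%:R - k%:R) * h.
    by rewrite -(natr1 i); ring.
  lra.
have Dle i j : (i <= j)%N -> D i <= D j.
  move=> /subnK <-; elim: (j - i)%N => [//|p IH]; rewrite addSn.
  exact: le_trans IH (Dmono _).
have D0 : D 0%N = 0.
  rewrite /D /q !H0 ?subrr//.
    by rewrite ltr_norml; apply/andP; split; lra.
  by rewrite mulr1n ltr_norml; apply/andP; split; lra.
pose M := (k + l)%N.
have tM : t + (M%:R - k%:R) * h = t + l%:R * h by rewrite /M natrD; ring.
have tM1 : t + (M.+1%:R - k%:R) * h = t + l%:R * h + h by rewrite -(natr1 M) /M natrD; ring.
have DM : D M = 0.
  rewrite /D /q tM tM1 /H.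
  have -> : t + l%:R * h + h = 1 + (t + l%:R * h + h - 1) by ring.
  have -> : G (t + l%:R * h) = G (1 + (t + l%:R * h - 1)) by congr G; ring.
  rewrite !h1; first by ring.
    by rewrite ltr_norml; apply/andP; split; lra.
  by rewrite ltr_norml; apply/andP; split; lra.
have Dz i : (i <= M)%N -> D i = 0.
  by move=> iM; have := Dle _ _ (leq0n i); have := Dle _ _ iM; rewrite D0 DM; lra.
have qz i : (i <= k)%N -> q i = q 0%N.
  elim: i => [//|i IH] ik; rewrite -IH; last exact: ltnW.
  have := Dz i (leq_trans (ltnW ik) (leq_addr _ _)); rewrite /D; lra.
have := qz k (leqnn _); rewrite /q subrr mul0r addr0.
rewrite [X in _ = X -> _]H0; first by rewrite /H; lra.
by rewrite ltr_norml; apply/andP; split; lra.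
Qed.

(* Doubling and the reflection t -> 1 - t halve the bound on |D| at each step. *)
Lemma midpoint_homogeneous (D : R -> R) (B : R) :
  (forall t, 0 <= t <= 1 -> `|D t| <= B) ->
  (forall t, 0 <= t <= 1 / 2 -> D (2 * t) = 2 * D t) ->
  (forall t, 0 <= t <= 1 -> D t = - D (1 - t)) ->
  forall t, 0 <= t <= 1 -> D t = 0.
Proof.
move=> DB D2 D1 t ht; apply/eqP; rewrite -normr_le0.
have key k : forall t, 0 <= t <= 1 -> `|D t| <= B / 2 ^+ k.
  elim: k => [|k IH] u hu; first by rewrite expr0 divr1 DB.
  have half v : 0 <= v <= 1 / 2 -> `|D v| <= B / 2 ^+ k.+1.
    move=> hv; have -> : D v = D (2 * v) / 2 by rewrite D2//; field.
    rewrite normrM (ger0_norm (_ : 0 <= 2^-1 :> R)) ?invr_ge0// ler_pdivrMr//.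
    have -> : B / 2 ^+ k.+1 * 2 = B / 2 ^+ k by rewrite exprS; field; rewrite expf_neq0.
    by apply: IH; lra.
  have [u2|u2] := leP u (1 / 2); first by apply: half; lra.
  by rewrite D1// normrN; apply: half; lra.
rewrite -oppr_ge0; apply: (@le0_geometric _ _ B) => k.
by rewrite lerN2 key.
Qed.

Lemma delta_norm n (s : R) (i : 'I_n) : `|s *: (delta_mx 0 i : 'rV[R]_n)| <= `|s|.
Proof.
rewrite [leLHS]/Num.norm /= mx_normrE; apply: bigmax_le => //.
move=> [k j] _; rewrite !mxE ord1 /= normrM.
by rewrite ler_piMr//; case: (j == i); rewrite ?normr1 ?normr0.
Qed.

(** Jensen's functional equation on a ball: the midpoint relation gives additivity, boundedness
    excludes the irregular additive solutions and gives homogeneity, and the slope is read off on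
    the coordinate vectors. *)
Lemma jensen_linear n (phi : 'rV[R]_n -> R) (dlt B : R) : 0 < dlt ->
  (forall u v, `|u| + `|v| < dlt -> 2 * phi u = phi (u + v) + phi (u - v)) ->
  (forall u, `|u| < dlt -> `|phi u| <= B) ->
  exists (g : 'cV[R]_n) (r : R), 0 < r /\ forall v, `|v| < r -> phi v = phi 0 + pairing v g.
Proof.
move=> d0 mid bnd.
pose psi v := phi v - phi 0.
have psi0 : psi 0 = 0 by rewrite /psi subrr.
have dbl v : `|v| < dlt / 2 -> psi (v + v) = 2 * psi v.
  move=> vd; have := mid v v; rewrite subrr /psi => /(_ _); lra.
have add a b : `|a| < dlt / 4 -> `|b| < dlt / 4 -> psi (a + b) = psi a + psi b.
  move=> ad bd.
  (* The midpoint relation at u, v reads 2 psi(u) = psi(a) + psi(b), and doubling turns its left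
     side into psi(a + b). *)
  pose u := 2^-1 *: (a + b); pose v := 2^-1 *: (a - b).
  have two : (2 : R)^-1 + 2^-1 = 1 by field.
  have ua : u + v = a.
    by rewrite /u /v -scalerDr addrACA subrr addr0 scalerDr -scalerDl two scale1r.
  have ub : u - v = b.
    by apply/rowP => j; rewrite !mxE; field.
  have uu : u + u = a + b by rewrite /u -scalerDl two scale1r.
  have nh : `|2^-1 : R| = 2^-1 by rewrite ger0_norm// invr_ge0.
  have nu : `|u| <= (`|a| + `|b|) / 2.
    by rewrite /u normrZ nh mulrC ler_wpM2r ?invr_ge0// ler_normD.
  have nv : `|v| <= (`|a| + `|b|) / 2.
    by rewrite /v normrZ nh mulrC ler_wpM2r ?invr_ge0// ler_normB.
  rewrite -uu dbl; last by lra.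
  have := mid u v; rewrite ua ub /psi => /(_ _); lra.
have hom a t : `|a| < dlt / 4 -> 0 <= t <= 1 -> psi (t *: a) = t * psi a.
  move=> ad ht.
  have B0 : 0 <= B by apply: le_trans (bnd 0 _); rewrite ?normr0.
  have nta u : 0 <= u <= 1 -> `|u *: a| < dlt / 4.
    move=> /andP[u0 u1]; rewrite normrZ ger0_norm// (le_lt_trans _ ad)//.
    by rewrite ler_piMl.
  have psiB v : `|v| < dlt / 4 -> `|psi v| <= 2 * B.
    move=> vd; rewrite (le_trans (ler_normB _ _))// mulr_natl mulr2n.
    by rewrite lerD// bnd ?normr0//; lra.
  apply/eqP; rewrite -subr_eq0; apply/eqP.
  apply: (@midpoint_homogeneous (fun t => psi (t *: a) - t * psi a) (4 * B)) ht => u hu.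
  - have /andP[u0 u1] := hu.
    rewrite (le_trans (ler_normB _ _))//.
    have := psiB _ (nta u hu); have := psiB _ ad.
    rewrite normrM (ger0_norm u0) => h1 h2.
    have : u * `|psi a| <= `|psi a| by rewrite ler_piMl.
    lra.
  - have hu2 : 0 <= u <= 1 by lra.
    rewrite [2 * u]mulr_natl mulr2n scalerDl dbl; first by ring.
    by have := nta u hu2; lra.
  have hu2 : 0 <= 1 - u <= 1 by lra.
  have e : a = u *: a + (1 - u) *: a by rewrite -scalerDl addrC subrK scale1r.
  have := add _ _ (nta u hu) (nta _ hu2); rewrite -e => h.
  by rewrite h; ring.
pose r := dlt / 8; have r0 : 0 < r by rewrite /r; lra.
pose g : 'cV[R]_n := \col_i (psi (r *: delta_mx 0 i) / r).
have single i s : `|s| < r -> psi (s *: delta_mx 0 i) = s * g i 0.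
  move=> sr.
  have rd (w : R) : `|w| <= r -> `|w *: (delta_mx 0 i : 'rV[R]_n)| < dlt / 4.
    by move=> wr; have := delta_norm w i; rewrite /r in wr; lra.
  have pos w : 0 <= w <= r -> psi (w *: delta_mx 0 i) = w * g i 0.
    move=> /andP[w0 wr]; have := hom (r *: delta_mx 0 i) (w / r).
    rewrite scalerA divfK ?gt_eqF// => -> //.
    - by rewrite mxE; field; rewrite gt_eqF.
    - by apply: rd; rewrite ger0_norm// ltW.
    by apply/andP; split; [apply: divr_ge0 => //; exact: ltW|rewrite ler_pdivrMr// mul1r].
  have [s0|s0] := leP 0 s; first by rewrite pos//; rewrite ger0_norm// in sr; lra.
  rewrite ltr0_norm// in sr.
  have := add (s *: delta_mx 0 i) ((- s) *: delta_mx 0 i).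
  rewrite -scalerDl subrr scale0r psi0 (pos (- s)); last by lra.
  move=> h; have := h _ _; rewrite !rd ?normrN ?ltr0_norm//; lra.
(* The partial sums of the coordinate decomposition of v have norm at most n |v|; this radius keeps
   them in the ball where psi is additive. *)
exists g, (r / n.+1%:R); split; first by rewrite divr_gt0.
move=> v; rewrite ltr_pdivlMr// => vr.
suff : psi v = pairing v g by rewrite /psi; lra.
have vi i : `|v 0 i| < r.
  rewrite (le_lt_trans (coord_le_norm v i))// (le_lt_trans _ vr)//.
  by rewrite ler_peMr// ler1n.
have key s : (size s <= n.+1)%N ->
    psi (\sum_(i <- s) v 0 i *: delta_mx 0 i) = \sum_(i <- s) v 0 i * g i 0 /\
    `|\sum_(i <- s) v 0 i *: (delta_mx 0 i : 'rV[R]_n)| <= (size s)%:R * `|v|.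
  elim: s => [|i s IH] hs; first by rewrite !big_nil psi0 normr0 mul0r.
  have [IH1 IH2] := IH (ltnW hs).
  have ns : `|\sum_(i <- s) v 0 i *: (delta_mx 0 i : 'rV[R]_n)| < dlt / 4.
    have : (size s)%:R * `|v| <= `|v| * n.+1%:R by rewrite mulrC ler_wpM2l// ler_nat ltnW.
    by move: vr; rewrite /r; lra.
  have ni : `|v 0 i *: (delta_mx 0 i : 'rV[R]_n)| < dlt / 4.
    by have := delta_norm (v 0 i) i; have := vi i; rewrite /r; lra.
  rewrite !big_cons add// IH1 single//; split=> //.
  rewrite (le_trans (ler_normD _ _))//= -natr1 mulrDl mul1r addrC lerD//.
  by rewrite (le_trans (delta_norm _ _))// coord_le_norm.
have sz : (size (index_enum 'I_n) <= n.+1)%N.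
  by rewrite [index_enum _]unlock -enumT size_enum_ord.
have [h _] := key _ sz.
rewrite pairingE -h; congr psi; apply/rowP => j; rewrite summxE (bigD1 j)//=.
rewrite !mxE !eqxx mulr1 big1 ?addr0// => i ij.
by rewrite !mxE eqxx /= eq_sym (negbTE ij) mulr0.
Qed.

End RealAffine.

(** * Balls of characters have positive Haar measure *)

Section FullSupport.
Variables (R : realType) (n N : nat) (A : 'M[R]_(n.+1, N)).
Variable eta : probability (dual_group R (zspan_group A)) R.
Implicit Types chi psi : character R (zspan_group A).

Definition char_dist chi psi : R := \sum_j nc (chi (zspan_gen A j) - psi (zspan_gen A j)).

Definition char_ball psi (r : R) : set (dual_group R (zspan_group A)) :=
  [set chi | char_dist chi psi < r].

Lemma char_dist_gen chi psi j :
  nc (chi (zspan_gen A j) - psi (zspan_gen A j)) <= char_dist chi psi.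
Proof.
by rewrite /char_dist (bigD1 j)//= lerDl sumr_ge0// => i _; exact: nc_ge0.
Qed.

Lemma measurable_char_ball psi (r : R) : measurable (char_ball psi r).
Proof.
have -> : char_ball psi r = [set: dual_group R (zspan_group A)] `&`
    (fun chi : dual_group R (zspan_group A) => char_dist chi psi) @^-1` `]-oo, r[%classic.
  by rewrite setTI; apply/seteqP; split=> chi /=; rewrite in_itv.
have : measurable_fun setT (fun chi : dual_group R (zspan_group A) => char_dist chi psi).
  rewrite /char_dist; apply: measurable_sum => j; apply: cmeas_nc.
  have [h1 h2] := @cmeas_char R _ (zspan_gen A j).
  by split; rewrite /=; under eq_fun do rewrite ?ReD ?ReN ?ImD ?ImN;
     apply: measurable_funB.
by apply; [exact: measurableT|exact: measurable_itv].
Qed.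

Lemma char_ball_haar psi (r : R) : is_haar eta ->
  eta (char_ball psi r) = eta (char_ball (char_one R (zspan_group A)) r).
Proof.
move=> haar; rewrite -(haar psi (char_ball psi r)); last exact: measurable_char_ball.
congr (eta _); apply/seteqP.
have e chi : char_dist (char_mul psi chi) psi = char_dist chi (char_one R (zspan_group A)).
  apply: eq_bigr => j _ /=.
  have -> : psi (zspan_gen A j) * chi (zspan_gen A j) - psi (zspan_gen A j) =
     psi (zspan_gen A j) * (chi (zspan_gen A j) - 1) by ring.
  by rewrite ncM nc_char mul1r.
by split=> chi; rewrite /char_ball /= e.
Qed.

(* The rounded coordinates of the generators take countably many values, and two
   characters with the same values are close; so countably many balls of the same
   radius cover the group. *)
Lemma char_ball_pos psi (r : R) : is_haar eta -> 0 < r -> eta (char_ball psi r) != 0%E.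
Proof.
move=> haar r0; rewrite char_ball_haar//; apply/negP => /eqP eta0.
have [h [h0 hr]] : exists h : R, 0 < h /\ N%:R * (2 * h) < r.
  exists (r / (2 * N.+1%:R)); split; first by rewrite divr_gt0// mulr_gt0.
  have N1 : 0 < N.+1%:R :> R by [].
  have -> : N%:R * (2 * (r / (2 * N.+1%:R))) = r * (N%:R / N.+1%:R).
    by field; rewrite gt_eqF.
  by rewrite gtr_pMr// ltr_pdivrMr// mul1r ltr_nat.
pose code (chi : character R (zspan_group A)) : {ffun 'I_N -> int * int} :=
  [ffun j => (Num.floor (complex.Re (chi (zspan_gen A j)) / h),
              Num.floor (complex.Im (chi (zspan_gen A j)) / h))].
have close chi psi' : code chi = code psi' -> char_dist chi psi' < r.
  move=> e; apply: le_lt_trans hr.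
  have -> : N%:R * (2 * h) = \sum_(j < N) (2 * h) by rewrite sumr_const card_ord mulr_natl.
  apply: ler_sum => j _; move/ffunP : e => /(_ j); rewrite !ffunE => -[e1 e2].
  have fl (a b : R) : Num.floor (a / h) = Num.floor (b / h) -> `|a - b| <= h.
    move=> e; have /andP[a1 a2] := floor_itv (a / h).
    have /andP[b1 b2] := floor_itv (b / h).
    rewrite e in a1 a2; rewrite intrD in a2; rewrite intrD in b2.
    rewrite ler_pdivlMr// in a1; rewrite ltr_pdivrMr// mulrDl mul1r in a2.
    rewrite ler_pdivlMr// in b1; rewrite ltr_pdivrMr// mulrDl mul1r in b2.
    by rewrite ler_norml; apply/andP; split; lra.
  have := nc_le_ReIm (chi (zspan_gen A j) - psi' (zspan_gen A j)).
  rewrite ReD ReN ImD ImN; have := fl _ _ e1; have := fl _ _ e2; lra.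
(* [U k] is a ball around some chosen character whose code has number k, and is empty when no
   character has such a code. *)
pose U (k : nat) : set (dual_group R (zspan_group A)) :=
  if unpickle k is Some f then
    if pselect (exists chi, code chi = f) is left e then char_ball (projT1 (cid e)) r
    else set0
  else set0.
have U0 k : eta (U k) = 0%E.
  rewrite /U; case: unpickle => [f|]; last exact: measure0.
  case: pselect => [e|_]; last exact: measure0.
  by rewrite char_ball_haar.
have Um k : measurable (U k).
  rewrite /U; case: unpickle => [f|//]; case: pselect => [e|//].
  exact: measurable_char_ball.
have : eta.-negligible (\bigcup_k U k).
  by apply: negligible_bigcup => k; exists (U k); split=> //; exact: U0.
have -> : \bigcup_k U k = setT.
  apply/seteqP; split=> // chi _; exists (pickle (code chi)) => //.
  rewrite /U pickleK; case: pselect => [e|ne]; last by exfalso; apply: ne; exists chi.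
  by rewrite /char_ball /=; apply: close; rewrite (projT2 (cid e)).
move=> /(negligibleP _ measurableT) e.
by have := etrans (esym e) (@probability_setT _ _ _ eta) => /esym/eqP; rewrite onee_eq0.
Qed.

End FullSupport.

(** * Local slopes of the Ronkin function *)

Section LocallyAffine.
Variables (R : realType) (n : nat).
Implicit Types (h : 'rV[R]_n.+1 -> R) (x v : 'rV[R]_n.+1) (g : 'cV[R]_n.+1).

(** Exact affinity near x yields differentiability and the gradient at once, and it is an open
    condition, which pointwise equality of gradients is not. *)
Definition locally_affine h x g := exists2 r : R, 0 < r &
  forall v, `|v| < r -> h (x + v) = h x + pairing v g.

Definition linform g (v : 'rV[R]_n.+1) : R^o := pairing v g.

Fact linform_is_linear g : linear (linform g).
Proof. by move=> k u v; rewrite /linform pairingDl pairingZl. Qed.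

HB.instance Definition _ g :=
  GRing.isLinear.Build R 'rV[R]_n.+1 R^o _ (linform g) (linform_is_linear g).

Lemma linform_continuous g : continuous (linform g).
Proof.
apply: (@lipschitz_continuous _ _ _ (mxbound g)) => [|p q e e0 pq].
  by rewrite (le_trans ler01)// mxbound_ge1.
rewrite /linform -pairingNl -pairingDl (_ : pairing _ g = pairing (p - q) (col 0 g)); last first.
  by congr pairing; apply/colP => i; rewrite mxE.
rewrite (le_trans (pairing_le _ _ _))// ler_wpM2l//.
  by rewrite (le_trans ler01)// mxbound_ge1.
rewrite [leLHS]/Num.norm /= mx_normrE; apply: bigmax_le => [|[i j] _]; first exact: ltW.
by rewrite !mxE ord1 ltW.
Qed.

Lemma locally_affine_differentiable h x g : locally_affine h x g ->
  differentiable h x /\ gradient h x = g.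
Proof.
move=> [r r0 hr].
have e : (h \o shift x : 'rV[R]_n.+1 -> R^o) = cst (h x : R^o) + linform g +o_ (0 : 'rV[R]_n.+1) id.
  apply/eqaddoP => eps eps0; near=> v.
  have vr : `|v| < r by near: v; exact: (@nbhs0_lt _ 'rV[R]_n.+1 r r0).
  rewrite /= [X in Num.norm X](_ : _ = 0); first by rewrite normr0 mulr_ge0// ltW.
  rewrite [LHS](_ : _ = h (v + x) - (h x + pairing v g))//.
  by rewrite addrC [v + x]addrC hr// addrC subrr.
have d := diff_unique (@linform_continuous g) e.
have df : differentiable h x.
  by apply/diff_locallyP; rewrite d; split=> //; exact: linform_continuous.
split=> //; apply/colP => i; rewrite mxE deriveE// d /= /linform pairing_delta.
by [].
Unshelve. all: by end_near. Qed.

Lemma locally_affine_uniq h x g1 g2 : locally_affine h x g1 -> locally_affine h x g2 -> g1 = g2.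
Proof.
by move=> /locally_affine_differentiable[_ <-] /locally_affine_differentiable[_ <-].
Qed.

Lemma locally_affine_near h x g : locally_affine h x g -> exists2 r : R, 0 < r &
  forall v, `|v| < r -> locally_affine h (x + v) g.
Proof.
move=> [r r0 hr]; exists (r / 2); first by rewrite divr_gt0.
move=> v vr; exists (r / 2); first by rewrite divr_gt0.
move=> u ur; have uv : `|v + u| < r.
  by rewrite (le_lt_trans (ler_normD _ _))//; lra.
rewrite -addrA (hr _ uv) (hr v); last by lra.
by rewrite pairingDl addrA.
Qed.

End LocallyAffine.

Section RonkinLocal.
Variables (R : realType) (n N : nat) (A : 'M[R]_(n.+1, N)).
Variable eta : probability (dual_group R (zspan_group A)) R.
Hypothesis haar : is_haar eta.
Implicit Types (b c : 'I_N -> R[i]) (x y v : 'rV[R]_n.+1).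

Definition tw b (chi : dual_group R (zspan_group A)) (j : 'I_N) : R[i] :=
  b j * (chi : character R (zspan_group A)) (zspan_gen A j).

Lemma tw_meas b j : cmeas (fun chi => tw b chi j).
Proof. by apply: cmeasM; [exact: cmeas_cst|exact: cmeas_char]. Qed.

Lemma tw_le b chi : \sum_j nc (tw b chi j) <= \sum_j nc (b j).
Proof. by apply: ler_sum => j _; rewrite /tw ncM nc_char mulr1. Qed.

Lemma rowmulE x j : (x *m A) 0 j = pairing x (col j A).
Proof. by rewrite /pairing !mxE; apply: eq_bigr => i _; rewrite !mxE. Qed.

Lemma rsum_twist b (chi : character R (zspan_group A)) x (z : 'rV[R[i]]_N) :
  (forall j, z 0 j = (pairing x (col j A))%:C) ->
  rsum (tw b) (chi : dual_group R (zspan_group A)) z = twist b chi x.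
Proof. by move=> hz; apply: eq_bigr => j _; rewrite hz cexp_real. Qed.

(** Displacing the exponents by i t y A multiplies the j-th term by the value of the character
    [flow A (t *: y)] at the j-th generator, which the Haar measure absorbs. *)
Lemma tw_flow_invariant b (m : R) y : 0 < m -> flow_invariant eta (tw b) m (y *m A).
Proof.
move=> m0 z t; rewrite /mlog.
rewrite -(haar_avg (flow A (t *: y)) haar (rsum_bmeas (@tw_meas b) (@tw_le b) z m0)).
congr avg; apply/funext => chi; congr (lnmax _ _); apply: eq_bigr => j _.
rewrite !mxE cexpD /tw /translate /=.
have -> : 'i * t%:C * ((\sum_j0 y 0 j0 * A j0 j)%:C : R[i]) = 0 +i* (t * pairing y (col j A)).
  rewrite pairingE; apply: nc_ext; rewrite /= !(mul0r, mul1r, mulr0, subr0, addr0, add0r, oppr0)//.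
  by congr (t * _); apply: eq_bigr => i _; rewrite mxE.
rewrite cexp_split expR0 mul1r pairingZl.
by move: (cis _) (char_fun _ _) (cexp _) (b j) => p q s u; ring.
Qed.

Lemma mlog_ronkin c x (m m' : R) (z : 'rV[R[i]]_N) : 0 < m' -> m' <= m ->
  bounded_below A c x m -> (forall j, z 0 j = (pairing x (col j A))%:C) ->
  mlog eta (tw c) m' z = ronkin c eta x.
Proof.
move=> m0 mm hm hz; rewrite /mlog /avg /Rintegral /ronkin; congr fine.
apply: eq_integral => chi _; rewrite (rsum_twist _ _ hz).
have h := hm chi; rewrite /lnmax max_r ?lne_EFin//.
  by rewrite (lt_le_trans m0)// (le_trans mm).
exact: le_trans h.
Qed.

Lemma ronkin_locally_affine c x (m : R) : 0 < m -> bounded_below A c x m ->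
  exists g, locally_affine (ronkin c eta) x g.
Proof.
move=> m0 hm; have [t t0 ht] := bounded_below_near m0 hm.
(* [mlog_midpoint_affine] asks for twice the truncation level, and near x the lower bound that
   survives is m / 2. *)
have m20 : 0 < m / 4 by lra.
have lt : 2 * (m / 4) = m / 2 by lra.
pose Z v : 'rV[R[i]]_N := rvec ((x + v) *m A).
have ZE v j : Z v 0 j = (pairing (x + v) (col j A))%:C by rewrite mxE rowmulE.
pose phi v := mlog eta (tw c) (m / 4) (Z v).
have phiE v : `|v| < t -> phi v = ronkin c eta (x + v).
  move=> vt; apply: (mlog_ronkin m20 _ (ht _ vt)) => //; lra.
pose X := mxbound A * (`|x| + t).
have [g [r [r0 hr]]] : exists (g : 'cV[R]_n.+1) (r : R), 0 < r /\
    forall v, `|v| < r -> phi v = phi 0 + pairing v g.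
  apply: (@jensen_linear _ _ phi t
     (`|ln (m / 4)| + `|ln (Num.max (m / 4) ((\sum_j nc (c j)) * expR X))|) t0).
    move=> u v uv.
    have e := @mlog_midpoint_affine _ _ _ eta _ _ _ (@tw_meas c) (@tw_le c) (m / 4) (Z u) (v *m A)
      m20 (tw_flow_invariant c v m20).
    have ext1 : phi (u + v) = mlog eta (tw c) (m / 4) (Z u + rvec (v *m A)).
      apply: mlog_ext => j; rewrite [RHS]mxE !ZE [rvec _ _ _]mxE rowmulE -rmorphD; congr (_%:C).
      by rewrite !pairingDl; ring.
    have ext2 : phi (u - v) = mlog eta (tw c) (m / 4) (Z u - rvec (v *m A)).
      apply: mlog_ext => j; rewrite [RHS]mxE !ZE [X in _ = _ + X]mxE [rvec _ _ _]mxE rowmulE -rmorphB.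
      by congr (_%:C); rewrite !pairingDl pairingNl; ring.
    rewrite ext1 ext2; apply: e => s o s1.
    rewrite (@rsum_twist _ o (x + (u + s *: v))).
      rewrite lt; apply: ht; rewrite (le_lt_trans (ler_normD _ _))//.
      rewrite (le_lt_trans _ uv)// lerD2l normrZ ler_piMl//.
    move=> j; rewrite mxE ZE mxE [rvec _ _ _]mxE rowmulE -rmorphM -rmorphD; congr (_%:C).
    by rewrite !pairingDl pairingZl; ring.
  move=> u ut; apply: mlog_bound; [exact: tw_meas|exact: tw_le|exact: m20|move=> j].
  rewrite ZE /= /X; apply: le_trans (ler_norm _) _.
  rewrite (le_trans (pairing_le _ _ _))// ler_wpM2l ?(le_trans ler01) ?mxbound_ge1//.
  by rewrite (le_trans (ler_normD _ _))// lerD2l ltW.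
exists g, (Num.min r t); first by rewrite lt_min r0 t0.
move=> v; rewrite lt_min => /andP[vr vt].
have n0 : `|0 : 'rV[R]_n.+1| < t by rewrite normr0.
have p0 : phi 0 = ronkin c eta x := etrans (phiE 0 n0) (congr1 (ronkin c eta) (addr0 x)).
by rewrite -(phiE v vt) -p0; exact: hr.
Qed.

(* The truncated averages of log|f| at levels k and k/2 are convex along the segment
   and affine with the same data near its ends, hence equal; so the set of characters
   with |f| < k/2 is null, and it is open. *)
Lemma same_slope_bounded_below c x0 x1 (m0 m1 : R) g : 0 < m0 -> 0 < m1 ->
  bounded_below A c x0 m0 -> bounded_below A c x1 m1 ->
  locally_affine (ronkin c eta) x0 g -> locally_affine (ronkin c eta) x1 g ->
  exists2 k : R, 0 < k & forall t, 0 <= t <= 1 -> bounded_below A c (x0 + t *: (x1 - x0)) k.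
Proof.
move=> m00 m10 b0 b1 [r0 r00 h0] [r1 r10 h1].
have [t0 t00 ht0] := bounded_below_near m00 b0.
have [t1 t10 ht1] := bounded_below_near m10 b1.
pose a := x1 - x0; pose s := pairing a g.
have [k [k_gt0 [km0 km1]]] : exists k : R, 0 < k /\ k <= m0 / 2 /\ k <= m1 / 2.
  exists (Num.min (m0 / 2) (m1 / 2)); rewrite lt_min !divr_gt0//.
  by rewrite !ge_min !lexx ?orbT.
pose Z t : 'rV[R[i]]_N := rvec ((x0 + t *: a) *m A).
have ZE t j : Z t 0 j = (pairing (x0 + t *: a) (col j A))%:C by rewrite mxE rowmulE.
pose G q t := mlog eta (tw c) q (Z t).
have [e [e0 [er0 [er1 [et0 et1]]]]] : exists e : R, 0 < e /\ e * `|a| < r0 /\ e * `|a| < r1 /\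
    e * `|a| < t0 /\ e * `|a| < t1.
  pose q := Num.min (Num.min r0 r1) (Num.min t0 t1).
  have q0 : 0 < q by rewrite !lt_min r00 r10 t00 t10.
  have lq : q / (`|a| + 1) * `|a| < q.
    by rewrite -mulrA gtr_pMr// mulrC ltr_pdivrMr ?mul1r ?ltrDl// ltr_wpDl.
  exists (q / (`|a| + 1)); split; first by rewrite divr_gt0// ltr_wpDl.
  by move: lq; rewrite {2}/q !lt_min => /andP[/andP[-> ->] /andP[-> ->]].
have na (t : R) : `|t| < e -> `|t *: a| <= e * `|a|.
  by move=> te; rewrite normrZ ler_wpM2r// ltW.
have GE q : 0 < q -> q <= k -> forall t, 0 <= t <= 1 -> G q t = ronkin c eta x0 + t * s.
  move=> q0 qk.
  have E0 t : `|t| < e -> G q t = ronkin c eta x0 + t * s.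
    move=> /na te; rewrite /s -pairingZl -h0; last exact: le_lt_trans er0.
    apply: (mlog_ronkin q0 _ (ht0 _ (le_lt_trans te et0))) => //; exact: le_trans km0.
  have E1 t : `|t| < e -> G q (1 + t) = ronkin c eta x1 + t * s.
    move=> /na te; rewrite /s -pairingZl -h1; last exact: le_lt_trans er1.
    apply: (mlog_ronkin q0 _ (ht1 _ (le_lt_trans te et1))); first exact: le_trans km1.
    by move=> j; rewrite ZE; congr (pairing _ _)%:C;
      rewrite scalerDl scale1r addrA /a (addrC x0 (x1 - x0)) subrK.
  have n0 : `|0 : R| < e by rewrite normr0.
  have zs r : r + 0 * s = r by rewrite mul0r addr0.
  have G0 : G q 0 = ronkin c eta x0 := etrans (E0 0 n0) (zs _).
  have G1 : G q 1 = ronkin c eta x1.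
    exact: etrans (congr1 (G q) (esym (addr0 1))) (etrans (E1 0 n0) (zs _)).
  move=> t ht; rewrite -G0; apply: (convex_same_slope e0 _ _ _ ht) => [u h|u|u].
  - have -> : G q (u + h) = mlog eta (tw c) q (Z u + rvec ((h *: a) *m A)).
      apply: mlog_ext => j; rewrite [RHS]mxE !ZE [rvec _ _ _]mxE rowmulE -rmorphD; congr (_%:C).
      by rewrite !(pairingDl, pairingZl); ring.
    have -> : G q (u - h) = mlog eta (tw c) q (Z u - rvec ((h *: a) *m A)).
      apply: mlog_ext => j; rewrite [RHS]mxE !ZE [X in _ = _ + X]mxE [rvec _ _ _]mxE rowmulE -rmorphB.
      by congr (_%:C); rewrite !(pairingDl, pairingZl); ring.
    apply: mlog_midpoint_convex => //; [exact: tw_meas|exact: tw_le|exact: tw_flow_invariant].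
  - by rewrite G0; exact: E0.
  by rewrite G1; exact: E1.
(* A sum below k / 4 at chi stays below 3k/8 < k / 2 on a ball around chi, where the truncations at
   k and k / 2 differ by the constant ln 2. *)
exists (k / 4); first by rewrite divr_gt0.
move=> t ht chi; rewrite leNgt; apply/negP => lt_k.
have k20 : 0 < k / 2 by rewrite divr_gt0.
have k80 : 0 < k / 8 by rewrite divr_gt0.
have bm q : 0 < q -> bmeas (fun o => lnmax q (rsum (tw c) o (Z t))).
  by move=> q0; apply: rsum_bmeas q0; [exact: tw_meas|exact: tw_le].
have [d d0 hd] := twist_char_near A c (x0 + t *: a) k80.
have eq0 : avg eta (fun o => lnmax k (rsum (tw c) o (Z t)) - lnmax (k / 2) (rsum (tw c) o (Z t))) = 0.
  rewrite avgB; [|exact: bm|exact: bm].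
  have := GE _ k_gt0 (lexx _) t ht; rewrite /G /mlog => ->.
  have := GE _ k20 _ t ht; rewrite /G /mlog => ->; first by rewrite subrr.
  by lra.
have lnk : 0 < ln k - ln (k / 2) by rewrite subr_gt0 ltr_ln ?posrE//; lra.
have : eta (char_ball chi d) = 0%E.
  apply: (avg_eq0_negligible _ _ eq0 (measurable_char_ball chi d) lnk).
  - by apply: bmeasB; exact: bm.
  - move=> o; rewrite subr_ge0 /lnmax ler_ln ?posrE ?lt_max ?k20 ?k_gt0//.
    by rewrite ge_max !le_max lexx orbT andbT; apply/orP; left; lra.
  move=> o od.
  have no : nc (rsum (tw c) o (Z t)) < k / 2.
    rewrite (@rsum_twist _ o (x0 + t *: a)); last exact: ZE.
    have := hd o chi (fun j => le_lt_trans (char_dist_gen o chi j) od).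
    have := ncD (twist c o (x0 + t *: a) - twist c chi (x0 + t *: a)) (twist c chi (x0 + t *: a)).
    by rewrite subrK; lra.
  rewrite /lnmax !max_l//; [exact: ltW|].
  by apply: (le_trans (ltW no)); lra.
by apply/eqP; exact: char_ball_pos.
Qed.

End RonkinLocal.

(** * Comparison of the two Ronkin functions *)

Section AvgSwap.
Context d1 d2 (T1 : measurableType d1) (T2 : measurableType d2) (R : realType).
Variables (P1 : probability T1 R) (P2 : probability T2 R).

Lemma avg_swap (F : T1 * T2 -> R) : bmeas F ->
  (forall x, bmeas (fun y => F (x, y))) -> (forall y, bmeas (fun x => F (x, y))) ->
  avg P1 (fun x => avg P2 (fun y => F (x, y))) = avg P2 (fun y => avg P1 (fun x => F (x, y))).
Proof.
move=> bF b2 b1; rewrite /avg /Rintegral; congr fine.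
under eq_integral => x _.
  rewrite fineK; last by apply: integrable_fin_num => //; exact: bmeas_integrable (b2 x).
  over.
under [RHS]eq_integral => y _.
  rewrite fineK; last by apply: integrable_fin_num => //; exact: bmeas_integrable (b1 y).
  over.
exact: (Fubini (bmeas_integrable (P1 \x P2)%E bF)).
Qed.

Lemma avg_swapB (F G : T1 * T2 -> R) : bmeas F -> bmeas G ->
  (forall x, bmeas (fun y => F (x, y))) -> (forall x, bmeas (fun y => G (x, y))) ->
  (forall y, bmeas (fun x => F (x, y))) -> (forall y, bmeas (fun x => G (x, y))) ->
  avg P1 (fun x => avg P2 (fun y => F (x, y)) - avg P2 (fun y => G (x, y))) =
  avg P2 (fun y => avg P1 (fun x => F (x, y)) - avg P1 (fun x => G (x, y))).
Proof.
move=> bF bG F2 G2 F1 G1.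
have := @avg_swap (fun o => F o - G o) (bmeasB bF bG)
  (fun x => bmeasB (F2 x) (G2 x)) (fun y => bmeasB (F1 y) (G1 y)).
have -> : (fun x => avg P2 (fun y => F (x, y) - G (x, y))) =
    (fun x => avg P2 (fun y => F (x, y)) - avg P2 (fun y => G (x, y))).
  by apply/funext => x; exact: avgB.
move=> ->; congr avg; apply/funext => y; exact: avgB.
Qed.

End AvgSwap.

Section TwistMeasurable.
Context (d : measure_display) (S : measurableType d) (R : realType) (n N : nat).
Variable B : 'M[R]_(n.+1, N).

Lemma bmeas_twist c x (chi : S -> character R (zspan_group B)) (q : R) : 0 < q ->
  (forall v, cmeas (fun o => chi o v)) -> bmeas (fun o => lnmax q (twist c (chi o) x)).
Proof.
move=> q0 hchi; apply: (@bmeas_lnmax _ _ _ _ q (weight_bound B c x)) => // [|o].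
  apply: cmeas_sum => j; apply: cmeasM; last exact: cmeas_cst.
  by apply: cmeasM; [exact: cmeas_cst|exact: hchi].
by rewrite -(sum_weight c (chi o)); exact: nc_sum.
Qed.

End TwistMeasurable.

Section Link.
Variables (R : realType) (n m N : nat) (B : 'M[R]_(m.+1, N)) (T : 'M[R]_(n.+1, m.+1)).
Variable etaA : probability (dual_group R (zspan_group (T *m B))) R.
Variable etaB : probability (dual_group R (zspan_group B)) R.
Hypotheses (haarA : is_haar etaA) (haarB : is_haar etaB).
Variable c : 'I_N -> R[i].
Local Notation A := (T *m B).
Implicit Types (chi : character R (zspan_group B)) (psi : character R (zspan_group A)).
Implicit Types (x v : 'rV[R]_n.+1).

Lemma mulmx_col j : T *m col j B = col j A.
Proof. by apply/colP => i; rewrite !mxE; apply: eq_bigr => l _; rewrite !mxE. Qed.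

Fact zspan_mul (b : zspan_group B) : T *m zspan_val b \in zspan A.
Proof.
have /asboolP[k ->] := zspan_valP b; apply/asboolP; exists k.
rewrite mulmx_sumr; apply: eq_bigr => j _.
exact: etrans (raddfMz (mulmx T) (k j) (col j B)) (congr1 (fun a => a *~ k j) (mulmx_col j)).
Qed.

Definition zspan_map (b : zspan_group B) : zspan_group A := ZspanGroup (zspan_mul b).

Lemma zspan_map_gen j : zspan_map (zspan_gen B j) = zspan_gen A j.
Proof. by apply: zspan_val_inj; exact: mulmx_col. Qed.

Lemma zspan_mapD b1 b2 : zspan_map (b1 + b2) = zspan_map b1 + zspan_map b2.
Proof.
apply: zspan_val_inj; apply: etrans (esym (zspan_valD _ _)).
exact: etrans (congr1 (mulmx T) (zspan_valD b1 b2)) (mulmxDr _ _ _).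
Qed.

Definition pullback psi : character R (zspan_group B).
Proof.
exists (fun b => psi (zspan_map b)) => [b|b1 b2]; first exact: char_norm.
by rewrite zspan_mapD charD.
Defined.

Definition shift_coef chi (j : 'I_N) : R[i] := c j * chi (zspan_gen B j).

Lemma pairing_mulT x j : pairing (x *m T) (col j B) = pairing x (col j A).
Proof. by rewrite /pairing -mulmxA mulmx_col. Qed.

Lemma twist_pullback psi chi x :
  twist (shift_coef chi) psi x = twist c (char_mul (pullback psi) chi) (x *m T).
Proof.
apply: eq_bigr => j _; rewrite pairing_mulT /shift_coef /= zspan_map_gen.
by move: (chi _) (psi _) (c j) => p q s; ring.
Qed.

Lemma twist_pullback1 psi x : twist c psi x = twist c (pullback psi) (x *m T).
Proof. by apply: eq_bigr => j _; rewrite pairing_mulT /= zspan_map_gen. Qed.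

Lemma bounded_below_pullback x (k : R) : bounded_below B c (x *m T) k -> bounded_below A c x k.
Proof. by move=> h psi; rewrite twist_pullback1; exact: h. Qed.

(** The mean of log|g_chi| over the coset of chi modulo the pulled-back characters. Where the sums
    are bounded below it is N_f(x) at chi = 1, and its mean over chi is N_g(xT). *)
Definition slice (q : R) chi x : R :=
  avg etaA (fun psi => lnmax q (twist c (char_mul (pullback psi) chi) (x *m T))).

Lemma slice_mlog (q : R) chi x (z : 'rV[R[i]]_N) (w : 'I_N -> R[i]) :
  (forall (psi : dual_group R (zspan_group A)) j, tw (A := A) w psi j * cexp (z 0 j) =
     shift_coef chi j * (psi : character R (zspan_group A)) (zspan_gen A j) *
       (expR (pairing x (col j A)))%:C) ->
  slice q chi x = mlog etaA (tw w) q z.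
Proof.
move=> h; congr avg; apply/funext => psi; rewrite -twist_pullback; congr lnmax.
by apply: eq_bigr => j _; rewrite h.
Qed.

Definition increment q v chi x := slice q chi (x + v) - slice q chi x.

(** At [flow B y] the slice is the mean for f with exponents displaced by i y B. This is the setting
    of [mlog_plane_affine] with a = v A, along which Haar invariance holds, and b = y B. *)
Lemma increment_flow q x v y : 0 < q ->
  (forall s : R, 0 <= s <= 1 -> bounded_below B c ((x + s *: v) *m T) (2 * q)) ->
  increment q v (flow B y) x = increment q v (char_one R (zspan_group B)) x.
Proof.
move=> q0 hb.
have zA (p : 'rV[R]_n.+1) j : rvec (p *m A) 0 j = (pairing p (col j A))%:C by rewrite mxE rowmulE.
have zB j : rvec (y *m B) 0 j = (pairing y (col j B))%:C by rewrite mxE rowmulE.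
have ecis (r t : R) : cexp (r%:C + 'i * t%:C) = (expR r)%:C * cis t.
  rewrite -cexp_split; congr cexp; apply: nc_ext => /=;
  by rewrite !(mul0r, mul1r, mulr0, subr0, addr0, add0r, oppr0).
have S1 p : slice q (char_one R (zspan_group B)) p = mlog etaA (tw c) q (rvec (p *m A)).
  apply: slice_mlog => psi j; rewrite zA cexp_real /tw /shift_coef /= mulr1.
  by [].
have Sy p : slice q (flow B y) p = mlog etaA (tw c) q (rvec (p *m A) + 'i *: rvec (y *m B)).
  apply: slice_mlog => psi j; rewrite mxE zA mxE zB ecis /tw /shift_coef /=.
  by move: (psi _) (cis _) (expR _)%:C (c j) => a1 a2 a3 a4; ring.
rewrite /increment !Sy !S1.
have e := @mlog_plane_affine _ _ _ etaA _ _ _ (@tw_meas _ _ _ A c) (@tw_le _ _ _ A c) q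
   (rvec (x *m A)) (v *m A) (y *m B) q0 (tw_flow_invariant haarA c v q0).
have -> : rvec ((x + v) *m A) = rvec (x *m A) + rvec (v *m A).
  by apply/rowP => j; rewrite [RHS]mxE !zA -rmorphD -pairingDl.
(* The bound at a real point covers all characters of Z[B], so the imaginary displacement by t y
   costs nothing. *)
apply: e => s t o s01; rewrite (_ : rsum _ _ _ =
  twist c (char_mul (pullback o) (flow B (t *: y))) ((x + s *: v) *m T)); first exact: hb.
rewrite -twist_pullback; apply: eq_bigr => j _.
have gen (U V W : 'rV[R[i]]_N) k l : (U + k *: V + l *: W) 0 j = U 0 j + k * V 0 j + l * W 0 j.
  by rewrite !mxE.
have -> : (rvec (x *m A) + s%:C *: rvec (v *m A) + ('i * t%:C) *: rvec (y *m B)) 0 j =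
    (pairing (x + s *: v) (col j A))%:C + 'i * (t * pairing y (col j B))%:C.
  rewrite gen !zA zB pairingDl pairingZl !rmorphD !rmorphM /=.
  by move: 'i (pairing x _)%:C (pairing v _)%:C (pairing y _)%:C s%:C t%:C => *; ring.
rewrite ecis /tw /shift_coef /= pairingZl.
by move: (char_fun _ _) (cis _) (expR _)%:C (c j) => a1 a2 a3 a4; ring.
Qed.

Lemma slice_near (q e : R) x : 0 < q -> 0 < e -> exists2 t : R, 0 < t &
  forall chi chi' : character R (zspan_group B),
    (forall j, nc (chi (zspan_gen B j) - chi' (zspan_gen B j)) < t) ->
    `|slice q chi x - slice q chi' x| <= e.
Proof.
move=> q0 e0; have [t t0 ht] := twist_char_near B c (x *m T) (mulr_gt0 e0 q0).
exists t => // chi chi' h.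
have bm chi'' : bmeas (fun psi : dual_group R (zspan_group A) =>
    lnmax q (twist c (char_mul (pullback psi) chi'') (x *m T))).
  apply: bmeas_twist => // b; apply: cmeasM; last exact: cmeas_cst.
  exact: cmeas_char.
rewrite /slice -avgB//; apply: avg_norm_le => [|psi]; first exact: bmeasB.
rewrite (le_trans (lnmax_lipschitz _ _ q0))// ler_pdivrMr//; apply: ht => j.
rewrite [char_fun _ _]/(_ * _) /= -mulrBr ncM nc_char mul1r; exact: h.
Qed.

(* For chi in the flow this is [mlog_plane_affine]; the flow is dense. *)
Lemma increment_const q x v chi : 0 < q ->
  (forall s : R, 0 <= s <= 1 -> bounded_below B c ((x + s *: v) *m T) (2 * q)) ->
  increment q v chi x = increment q v (char_one R (zspan_group B)) x.
Proof.
move=> q0 hb; apply/eqP; rewrite -subr_eq0 -normr_le0; apply/ler_addgt0Pl => e e0.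
rewrite addr0.
have e20 : 0 < e / 2 by rewrite divr_gt0.
have [t1 t10 h1] := slice_near (x + v) q0 e20.
have [t2 t20 h2] := slice_near x q0 e20.
have t0 : 0 < Num.min t1 t2 by rewrite lt_min t10.
have [y hy] := kronecker_flow chi t0.
rewrite -(increment_flow y q0 hb) /increment.
have hy1 j : nc (chi (zspan_gen B j) - flow B y (zspan_gen B j)) < t1.
  by have := hy j; rewrite lt_min => /andP[].
have hy2 j : nc (chi (zspan_gen B j) - flow B y (zspan_gen B j)) < t2.
  by have := hy j; rewrite lt_min => /andP[].
have k1 := h1 _ _ hy1; have k2 := h2 _ _ hy2.
move: k1 k2; move: (slice _ _ _) (slice _ _ _) (slice _ _ _) (slice _ _ _) => a1 a2 a3 a4.
rewrite !ler_norml => /andP[? ?] /andP[? ?]; apply/andP; split; lra.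
Qed.

(** The increment is averaged over pairs (psi, chi). For fixed psi the pulled-back character is
    absorbed by the Haar measure of the dual of Z[B], leaving the increment of N_g; for fixed chi
    the mean over psi is the increment of a slice, which by [increment_const] is that of N_f. *)
Lemma ronkin_link q x v : 0 < q ->
  (forall s : R, 0 <= s <= 1 -> bounded_below B c ((x + s *: v) *m T) (2 * q)) ->
  ronkin c etaB ((x + v) *m T) - ronkin c etaB (x *m T) = ronkin c etaA (x + v) - ronkin c etaA x.
Proof.
move=> q0 hb.
have q2 : q <= 2 * q by lra.
have b0 : bounded_below B c (x *m T) (2 * q).
  by have := hb 0; rewrite scale0r addr0; apply; rewrite lexx ler01.
have b1 : bounded_below B c ((x + v) *m T) (2 * q).
  by have := hb 1; rewrite scale1r; apply; rewrite lexx ler01.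
have RA p : bounded_below B c (p *m T) (2 * q) ->
    slice q (char_one R (zspan_group B)) p = ronkin c etaA p.
  move=> hp; rewrite -(@mlog_ronkin _ _ _ _ etaA c p (2 * q) q (rvec (p *m A))) => //.
  - apply: slice_mlog => psi j; rewrite mxE rowmulE cexp_real /tw /shift_coef /= mulr1.
    by [].
  - exact: bounded_below_pullback.
  by move=> j; rewrite mxE rowmulE.
rewrite -!RA// -/(increment q v (char_one R (zspan_group B)) x).
pose F p (o : dual_group R (zspan_group A) * dual_group R (zspan_group B)) : R :=
  lnmax q (twist c (char_mul (pullback o.1) o.2) (p *m T)).
have bF p : bmeas (F p).
  apply: bmeas_twist => // b; apply: cmeasM.
    have [h1 h2] := @cmeas_char R _ (zspan_map b).
    by split; [exact: (measurableT_comp h1 measurable_fst)|exact: (measurableT_comp h2 measurable_fst)].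
  have [h1 h2] := @cmeas_char R _ b.
  by split; [exact: (measurableT_comp h1 measurable_snd)|exact: (measurableT_comp h2 measurable_snd)].
have bF1 p (chi : dual_group R (zspan_group B)) :
    bmeas (fun psi : dual_group R (zspan_group A) => F p (psi, chi)).
  apply: bmeas_twist => // b; apply: cmeasM; last exact: cmeas_cst.
  exact: cmeas_char.
have bF2 p (psi : dual_group R (zspan_group A)) :
    bmeas (fun chi : dual_group R (zspan_group B) => F p (psi, chi)).
  apply: bmeas_twist => // b; apply: cmeasM; first exact: cmeas_cst.
  exact: cmeas_char.
have RB p (psi : dual_group R (zspan_group A)) : bounded_below B c (p *m T) (2 * q) ->
    avg etaB (fun chi => F p (psi, chi)) = ronkin c etaB (p *m T).
  move=> hp; rewrite -(@mlog_ronkin _ _ _ _ etaB c (p *m T) (2 * q) q (rvec (p *m T *m B))) => //; last first.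
    by move=> j; rewrite mxE rowmulE.
  rewrite /mlog.
  have bt : bmeas (fun chi : dual_group R (zspan_group B) => lnmax q (twist c chi (p *m T))).
    by apply: bmeas_twist => // b; exact: cmeas_char.
  rewrite (_ : (fun o => lnmax q (rsum (tw c) o _)) = fun chi => lnmax q (twist c chi (p *m T))).
    exact: (haar_avg (pullback psi) haarB bt).
  apply/funext => chi; congr lnmax; apply: rsum_twist => j; by rewrite mxE rowmulE.
have swap := avg_swapB etaA etaB (bF (x + v)) (bF x)
  (bF2 (x + v)) (bF2 x) (bF1 (x + v)) (bF1 x).
have avg_const d' (S : measurableType d') (P : probability S R) (h : S -> R) (r : R) :
    (forall o, h o = r) -> avg P h = r.
  by move=> hr; rewrite -[RHS](avg_cst P); congr avg; apply/funext.
have lhs psi := congr2 (fun a b => a - b) (RB (x + v) psi b1) (RB x psi b0).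
have rhs (chi : dual_group R (zspan_group B)) := increment_const chi q0 hb.
apply: etrans (esym _) (etrans swap _); first by apply: avg_const => psi; exact: lhs.
by apply: avg_const => chi; exact: rhs.
Qed.

End Link.

(** * Components of the complement of the amoeba *)

Lemma norm_mulmx_le (R : realType) (n m : nat) (v : 'rV[R]_n) (T : 'M[R]_(n, m)) :
  `|v *m T| <= mxbound T * `|v|.
Proof.
rewrite [leLHS]/Num.norm /= mx_normrE; apply: bigmax_le => [|[i j] _].
  by rewrite mulr_ge0// (le_trans ler01)// mxbound_ge1.
rewrite (ord1 i) /= (_ : (v *m T) 0 j = pairing v (col j T)); first exact: pairing_le.
by rewrite /pairing !mxE; apply: eq_bigr => k _; rewrite !mxE.
Qed.

Section Assembly.
Variables (R : realType) (n N : nat) (A : 'M[R]_(n.+1, N)).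
Variable eta : probability (dual_group R (zspan_group A)) R.
Hypothesis haar : is_haar eta.
Hypothesis A_distinct : distinct_columns A.
Variable c : 'I_N -> R[i].
Implicit Types (x v : 'rV[R]_n.+1) (g : 'cV[R]_n.+1).
Local Notation U := (~` amoeba (expsum A c)).

Lemma segment_bounded_below x0 x1 (k : R) : 0 < k ->
  (forall t, 0 <= t <= 1 -> bounded_below A c (x0 + t *: (x1 - x0)) k) ->
  connected_component U x0 x1.
Proof.
move=> k0 h; exists ((fun t : R => x0 + t *: (x1 - x0)) @` `[0, 1]%classic); last first.
  by exists 1; rewrite /= ?in_itv/= ?lexx ?ler01// scale1r addrC subrK.
split.
- by exists 0; rewrite /= ?in_itv/= ?lexx ?ler01// scale0r addr0.
- move=> _ [t ht <-]; apply: bounded_below_notin_amoeba k0 _; apply: h.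
  by move: ht; rewrite /= in_itv.
apply: connected_continuous_connected; first exact: segment_connected.
apply: continuous_subspaceT => t.
by apply: cvgD; [exact: cvg_cst|apply: cvgZr_tmp; exact: cvg_id].
Qed.

(** The points of slope g form an open set. It is also closed in the component: every point there
    has some slope, and those of another slope form an open set too. Connectedness spreads g over
    E. *)
Lemma component_locally_affine E x g : is_component U E -> E x ->
  locally_affine (ronkin c eta) x g -> has_order c eta E g.
Proof.
move=> [x0 Ux0 ->] Ex hx.
pose L := [set y | locally_affine (ronkin c eta) y g].
have CU y : connected_component U x0 y -> exists g', locally_affine (ronkin c eta) y g'.
  move=> /connected_component_sub /(notin_amoeba_bounded_below A_distinct)[k k0 hk].
  exact: ronkin_locally_affine k0 hk.
have op (S : set 'rV[R]_n.+1) :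
    (forall y, S y -> exists2 r : R, 0 < r & forall v, `|v| < r -> S (y + v)) -> open S.
  move=> hS; rewrite openE => y /hS[r r0 hr]; apply/nbhs_ballP; exists r => // z.
  rewrite -ball_normE /= => hz; rewrite -(subrK y z) addrC; apply: hr.
  by rewrite distrC.
have oL : open L by apply: op => y; exact: locally_affine_near.
have oM : open [set y | exists2 g', g' <> g & locally_affine (ronkin c eta) y g'].
  apply: op => y [g' gg /locally_affine_near[r r0 hr]]; exists r => // v vr.
  by exists g' => //; exact: hr.
have LE : connected_component U x0 `&` L = connected_component U x0.
  apply: (component_connected (A := U) (x := x0)).
  - by exists x.
  - by exists L.
  exists (~` [set y | exists2 g', g' <> g & locally_affine (ronkin c eta) y g']).
    exact: open_closedC.
  apply/seteqP; split=> y [Cy].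
    by move=> Ly; split=> // -[g' gg Lg']; apply: gg; exact: locally_affine_uniq Lg' Ly.
  move=> nM; split; first exact: Cy.
  have [g' Lg'] := CU y Cy.
  have [e|ne] := pselect (g' = g); first by rewrite /L /= -e.
  by exfalso; apply: nM; exists g'.
move=> y; rewrite -LE => -[_ Ly]; exact: locally_affine_differentiable.
Qed.

End Assembly.

Theorem theorem4p3 (R : realType) (n m N : nat)
    (A : 'M[R]_(n.+1, N)) (B : 'M[R]_(m.+1, N)) (T : 'M[R]_(n.+1, m.+1))
    (A_distinct : distinct_columns A)
    (A_homog : pseudo_homogeneous A) (B_homog : pseudo_homogeneous B)
    (row_AB : (A <= B)%MS) (A_TB : A = T *m B)
    (etaA : probability (dual_group R (zspan_group A)) R) (haarA : is_haar etaA)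
    (etaB : probability (dual_group R (zspan_group B)) R) (haarB : is_haar etaB)
    (c : 'I_N -> R[i])
    (beta : 'cV[R]_m.+1) (beta_Z : beta \in zspan B) (beta_conv : conv_hull B beta) :
  let iota := fun x : 'rV[R]_n.+1 => x *m T in
  let H_T := range iota in
  let E_beta := order_component c etaB beta in
  let inside := fun E : set 'rV[R]_n.+1 =>
    is_component (~` amoeba (expsum A c)) E /\
    iota @^-1` (E_beta `&` H_T) `<=` E in
  E_beta `&` H_T !=set0 ->
  (exists E, inside E) /\
  (forall E, inside E -> has_order c etaA E (T *m beta)).
Proof.
subst A => iota H_T E_beta inside [u [Eu [x0 _ ux0]]].
have B_distinct : distinct_columns B.
  by move=> j l jl; apply: A_distinct; rewrite -!mulmx_col jl.
have key x : E_beta (x *m T) -> exists2 k : R, 0 < k &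
    bounded_below (T *m B) c x k /\ locally_affine (ronkin c etaA) x (T *m beta).
  move=> [E [[y Uy Ey] ordE]] Ex.
  have : (~` amoeba (expsum B c)) (x *m T) by move: Ex; rewrite Ey => /connected_component_sub.
  move=> /(notin_amoeba_bounded_below B_distinct)[k k0 hk].
  have [g [r r0 hg]] := ronkin_locally_affine haarB k0 hk.
  (* The slope is the gradient of N_g at xT, which membership in [E_beta] fixes to be beta. *)
  have gb : g = beta.
    have [_ <-] := locally_affine_differentiable (ex_intro2 _ _ r r0 hg).
    by have [_ ->] := ordE _ Ex.
  subst g.
  have [t t0 ht] := bounded_below_near k0 hk.
  exists k => //; split; first exact: bounded_below_pullback.
  have M0 : 0 < mxbound T by rewrite (lt_le_trans ltr01)// mxbound_ge1.
  have small (v : 'rV[R]_n.+1) (r' : R) : `|v| < r' / mxbound T -> `|v *m T| < r'.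
    by rewrite ltr_pdivlMr// mulrC => h; exact: le_lt_trans (norm_mulmx_le v T) h.
  exists (Num.min r t / mxbound T); first by rewrite divr_gt0// lt_min r0.
  move=> v /small; rewrite lt_min => /andP[vr vt].
  (* [ronkin_link] at level q needs the bound 2 q along the segment; near xT the bound k / 2 is at
     hand, so q = k / 4. *)
  have k40 : 0 < k / 4 by rewrite divr_gt0.
  have e := @ronkin_link _ _ _ _ B T etaA etaB haarA haarB c (k / 4) x v k40.
  have {}e : ronkin c etaB ((x + v) *m T) - ronkin c etaB (x *m T) =
      ronkin c etaA (x + v) - ronkin c etaA x.
    apply: e => s s01; have -> : 2 * (k / 4) = k / 2 by field.
    rewrite mulmxDl; apply: ht; rewrite -scalemxAl normrZ (le_lt_trans _ vt)//.
    by move: s01 => /andP[s0 s1]; rewrite ger0_norm// ler_piMl.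
  have h := hg _ vr; rewrite mulmxDl h in e.
  have -> : pairing v (T *m beta) = pairing (v *m T) beta by rewrite /pairing mulmxA.
  have aux (a b p q : R) : a + p - a = q - b -> q = b + p by move=> h'; rewrite -(subrK b q) -h'; ring.
  exact: aux e.
have Ex0 : E_beta (iota x0) by rewrite ux0.
have [k0 k00 [b0 l0]] := key x0 Ex0.
have Ux0 := bounded_below_notin_amoeba k00 b0.
split.
  exists (connected_component (~` amoeba (expsum (T *m B) c)) x0); split; first by exists x0.
  (* By [key] every point x1 of the preimage has the slope T beta of x0, so the segment from x0 to
     x1 stays off the amoeba. *)
  move=> x1 [/key[k1 k10 [b1 l1]] _].
  have [k kp hk] := same_slope_bounded_below haarA k00 k10 b0 b1 l0 l1.
  exact: segment_bounded_below kp hk.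
move=> E [compE subE]; apply: (component_locally_affine haarA A_distinct compE _ l0).
by apply: subE; split; [exact: Ex0|exists x0].
Qed.
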